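(* Let $X,Y$ be complex Hilbert spaces, $Y$ continuously and densely embedded in $X$ with $\|y\|_X\le\|y\|_Y$ for all $y\in Y$, let $A(\cdot,\cdot)$ be a sesquilinear form on $Y$ satisfying $\mathrm{Re}\,A(v,v)\ge c_0\|v\|_Y^2$ and $|A(u,v)|\le C_0\|u\|_Y\|v\|_Y$ for all $u,v\in Y$ (with constants $c_0,C_0>0$), and let $A$ be the associated regularly accretive operator on $X$. Let $\beta\in(0,1)$, let $M,N>0$ be integers, let $k>0$, and let $\mathcal Q_k^{-\beta}(A)$ be the sinc quadrature approximation of $A^{-\beta}$ with step $k$ and parameters $M,N$. Let $t\ge 0$, $-t\le s<\beta$, and set $s^+=\max(0,s)$. Then there is a constant $C$ depending only on $\beta$, $s$, $c_0$ and $C_0$ such that for all $f\in D(A^t)$ $$\|(A^{-\beta}-\mathcal Q_k^{-\beta}(A))f\|_{D(A^{s+t})}\le C\Big[\big(\sinh(\pi^2/(2k))\big)^{-1}e^{-\pi^2/(2k)}+e^{-(\beta-s^+)Nk}+e^{-(1-\beta)Mk}\Big]\|f\|_{D(A^t)}.$$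
   Context: Associated operator: by Lax--Milgram, for $f\in X$ let $Tf\in Y$ be the unique solution of $A(Tf,\phi)=(f,\phi)_X$ for all $\phi\in Y$. $T$ is one-to-one; the regularly accretive operator $A$ is $A:=T^{-1}$ with domain $D(A):=\mathrm{Range}(T)\subset Y$. It is a closed densely defined operator on $X$. (Sesquilinear means linear in the first and conjugate-linear in the second argument.) Fractional powers: for $\beta\in(0,1)$ and $f\in X$, $$A^{-\beta}f=\frac{\sin(\pi\beta)}{\pi}\int_0^\infty\mu^{-\beta}(\mu I+A)^{-1}f\,d\mu,$$ a bounded operator on $X$. For a nonnegative integer $n$, $A^n$ and $D(A^n)$ are the usual ones ($A^0=I$, $D(A^0)=X$). For $r>0$ not an integer with $n-1<r<n$, $D(A^r):=\{x\in X: A^{r-n}x\in D(A^n)\}$ and $A^rx:=A^nA^{r-n}x$. The norm on $D(A^r)$, $r\ge 0$, is $\|v\|_{D(A^r)}:=\|A^rv\|_X$. Sinc quadrature: for $k>0$ and positive integers $M,N$, with $y_\ell:=\ell k$, $$\mathcal Q_k^{-\beta}(A)f:=\frac{k\sin(\pi\beta)}{\pi}\sum_{\ell=-M}^{N}e^{(1-\beta)y_\ell}(e^{y_\ell}I+A)^{-1}f .$$ *)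

(* Defs.v *)
From Stdlib Require Import Reals ZArith Lra Lia.
From Coquelicot Require Import Coquelicot.
Open Scope R_scope.

Record is_inner_product {X : NormedModule C_AbsRing} (ip : X -> X -> C) : Prop := {
  inner_plus_l : forall x y z : X, ip (plus x y) z = Cplus (ip x z) (ip y z);
  inner_scal_l : forall (c : C) (x y : X), ip (scal c x) y = Cmult c (ip x y);
  inner_conj : forall x y : X, ip y x = Cconj (ip x y);
  inner_norm : forall x : X, ip x x = RtoC (norm x ^ 2)
}.

Record HilbertSpace := {
  hilbert_carrier :> CompleteNormedModule C_AbsRing;
  inner : hilbert_carrier -> hilbert_carrier -> C;
  inner_axioms : is_inner_product inner
}.

Arguments inner {h} _ _.

(* Coquelicot integrates functions with values in real normed modules only, so
   a complex Banach space is viewed as a real one, with the same vectors,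
   norm and uniform structure, by restriction of scalars along RtoC. *)
Section RestrictionOfScalars.

Context (X : CompleteNormedModule C_AbsRing).

Definition rscal (r : R) (x : X) : X := scal (RtoC r) x.

Lemma rscal_assoc (r s : R) (x : X) : rscal r (rscal s x) = rscal (mult r s) x.
Proof.
unfold rscal; rewrite scal_assoc; apply f_equal2; [|reflexivity].
symmetry; exact (RtoC_mult r s).
Qed.

Lemma rscal_one (x : X) : rscal one x = x.
Proof. exact (scal_one x). Qed.

Lemma rscal_distr_l (r : R) (x y : X) :
  rscal r (plus x y) = plus (rscal r x) (rscal r y).
Proof. exact (scal_distr_l (RtoC r) x y). Qed.

Lemma rscal_distr_r (r s : R) (x : X) :
  rscal (plus r s) x = plus (rscal r x) (rscal s x).
Proof.
unfold rscal; apply eq_trans with (2 := scal_distr_r (RtoC r) (RtoC s) x).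
apply f_equal2; [|reflexivity].
exact (RtoC_plus r s).
Qed.

Definition real_ModuleSpace_mixin :=
  ModuleSpace.Mixin R_AbsRing X rscal
    rscal_assoc rscal_one rscal_distr_l rscal_distr_r.

Definition real_ModuleSpace : ModuleSpace R_AbsRing :=
  ModuleSpace.Pack R_AbsRing X
    (ModuleSpace.Class _ _ (AbelianGroup.class X) real_ModuleSpace_mixin) X.

Definition real_NormedModuleAux : NormedModuleAux R_AbsRing :=
  NormedModuleAux.Pack R_AbsRing X
    (NormedModuleAux.Class _ _ (ModuleSpace.class _ real_ModuleSpace)
       (UniformSpace.class X)) X.

Lemma rscal_norm (r : R) (x : X) : norm (rscal r x) <= abs r * norm x.
Proof.
unfold rscal; apply Rle_trans with (1 := norm_scal (RtoC r) x).
apply Req_le; apply f_equal2; [|reflexivity].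
exact (Cmod_R r).
Qed.

Definition real_NormedModule_mixin :=
  NormedModule.Mixin R_AbsRing real_NormedModuleAux norm norm_factor
    (@norm_triangle _ X) rscal_norm
    (@norm_compat1 _ X) (@norm_compat2 _ X) (@norm_eq_zero _ X).

Definition real_CompleteNormedModule : CompleteNormedModule R_AbsRing :=
  CompleteNormedModule.Pack R_AbsRing X
    (CompleteNormedModule.Class _ _
       (NormedModule.Class _ _ (NormedModuleAux.class _ real_NormedModuleAux)
          real_NormedModule_mixin)
       (CompleteSpace.class X)) X.

End RestrictionOfScalars.

Record is_sesquilinear {Y : NormedModule C_AbsRing} (a : Y -> Y -> C) : Prop := {
  sesqui_plus_l : forall u v w : Y, a (plus u v) w = Cplus (a u w) (a v w);
  sesqui_scal_l : forall (c : C) (u v : Y), a (scal c u) v = Cmult c (a u v);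
  sesqui_plus_r : forall u v w : Y, a u (plus v w) = Cplus (a u v) (a u w);
  sesqui_scal_r : forall (c : C) (u v : Y), a u (scal c v) = Cmult (Cconj c) (a u v)
}.

(* The inclusion of Y in X is the explicit map j; continuity is part of
   Coquelicot's is_linear. *)
Record is_dense_embedding {Y X : NormedModule C_AbsRing} (j : Y -> X) : Prop := {
  embedding_linear : is_linear j;
  embedding_injective : forall u v : Y, j u = j v -> u = v;
  embedding_dense : forall (x : X) (eps : posreal), exists u : Y, norm (minus (j u) x) < eps
}.

(* Coquelicot's [iota P] is the element satisfying P whenever that element
   exists and is unique. *)
Section RegularlyAccretiveOperator.

Context {X Y : HilbertSpace} (j : Y -> X) (a : Y -> Y -> C).

Definition solution_op (f : X) : Y :=
  iota (fun u : Y => forall phi : Y, a u phi = inner f (j phi)).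

Definition dom (x : X) : Prop := exists f : X, j (solution_op f) = x.

Definition op (x : X) : X := iota (fun f : X => j (solution_op f) = x).

Definition resolvent (mu : R) (f : X) : X :=
  iota (fun u : X => dom u /\ plus (scal (RtoC mu) u) (op u) = f).

Definition neg_pow (beta : R) (f : X) : X :=
  scal (RtoC (sin (PI * beta) / PI))
    (RInt_gen (V := real_CompleteNormedModule X)
       (fun mu : R => scal (RtoC (Rpower mu (- beta))) (resolvent mu f))
       (at_right 0) (Rbar_locally p_infty)).

Fixpoint dom_npow (n : nat) (x : X) : Prop :=
  match n with
  | O => True
  | S m => dom x /\ dom_npow m (op x)
  end.

Definition npow (n : nat) (x : X) : X := Nat.iter n op x.

Definition nat_ceil (r : R) : nat := Z.to_nat (- Int_part (- r)).

(* For r >= 0 the integer n = nat_ceil r is r itself, or satisfies n-1 < r < n;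
   in the latter case A^(r-n) is [neg_pow (n - r)]. *)
Definition neg_part_pow (r : R) (x : X) : X :=
  let n := nat_ceil r in
  if Req_EM_T r (INR n) then x else neg_pow (INR n - r) x.

Definition dom_pow (r : R) (x : X) : Prop :=
  dom_npow (nat_ceil r) (neg_part_pow r x).

Definition pow_op (r : R) (x : X) : X :=
  npow (nat_ceil r) (neg_part_pow r x).

Definition norm_dom_pow (r : R) (x : X) : R := norm (pow_op r x).

(* The index i = 0, ..., M + N stands for l = i - M. *)
Definition sinc_quadrature (beta k : R) (M N : nat) (f : X) : X :=
  scal (RtoC (k * sin (PI * beta) / PI))
    (sum_n (fun i : nat =>
       let y := (INR i - INR M) * k in
       scal (RtoC (exp ((1 - beta) * y))) (resolvent (exp y) f))
     (M + N)).

End RegularlyAccretiveOperator.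

(* Main.v *)
(** The substitution [mu = exp y] turns [A^(-beta)] into an integral over the real line
    of [F y = exp ((1 - beta) y) (exp y + A)^(-1)], and the sinc quadrature is its truncated
    trapezoidal sum. Since [Re A >= c0], [F] extends holomorphically to [|Im y| < PI / 2],
    with the bounds [|(z + A)^(-1)| <= C / (1 + |z|)] for [Re z >= 0].

    On the interval between the half-integer nodes [-(M + 1/2) k] and [(N + 1/2) k] the
    trapezoidal sum minus the integral is, by convergence of the Dirichlet kernel, the limit of
    the integrals of [F] against [exp (2 PI i n y / k)], [0 < |n| <= L]. Shifting the contours to
    [Im y = +- PI / 2] gives the factor [exp (- PI^2 |n| / k)], hence [1 / sinh]; at the
    half-integer end points the exponentials sum to an alternating series, so the vertical
    sides, like the integral outside the interval, are of the size of the two truncation terms.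

    For [s > 0] the same argument is applied to [A^s (z + A)^(-1) = A (z + A)^(-1) A^(s - 1)],
    which is bounded by [(1 + |z|)^(s - 1)]. The passage from [D(A^t)] to [D(A^(s + t))] uses the
    semigroup law [A^(-r) A^(-q) = A^(-(r + q))]; it is obtained from Fubini's theorem and the
    resolvent identity by comparison with the scalar operator [A = 1]. *)

Require Import Defs.
From Stdlib Require Import Reals ZArith Lra Lia FunctionalExtensionality.
From Coquelicot Require Import Coquelicot.
Open Scope R_scope.

(** * Holomorphic functions in a strip *)

(** The constant may not depend on [t], so the factors attached to the fractional parts of [t] and
    [s + t] must be bounded uniformly, also when these approach 0 or 1. The resolvent integral of
    exponent [al] is of size [1 / (al (1 - al))]. Both [sin (PI al) / PI] and division by the beta
    integral compensate this. The proof normalises by the beta integral, because the semigroup law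
    is then exact without the reflection formula; returning to the sine costs a factor in
    [[1/8, 2]], whence the 16 in the final constant.

    Vector-valued analysis is reduced to real functions by pairing with a test vector and taking the
    real part, which determines a vector and its norm. Cauchy's theorem is thus needed for pairs of
    real functions only.

    Positive powers are never applied to the error. Membership in a domain is an equation between
    negative powers, and such equations are proved after application of an injective negative power,
    with which the error operator commutes. *)

Record cauchy_riemann (U V P Q : R -> R -> R) : Prop := {
  cr_dUx : forall x y, Rabs y < PI / 2 -> is_derive (fun x => U x y) x (P x y);
  cr_dVx : forall x y, Rabs y < PI / 2 -> is_derive (fun x => V x y) x (Q x y);
  cr_dUy : forall x y, Rabs y < PI / 2 -> is_derive (fun y => U x y) y (- Q x y);
  cr_dVy : forall x y, Rabs y < PI / 2 -> is_derive (fun y => V x y) y (P x y);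
  cr_U : forall x y, Rabs y < PI / 2 -> continuity_2d_pt U x y;
  cr_V : forall x y, Rabs y < PI / 2 -> continuity_2d_pt V x y;
  cr_P : forall x y, Rabs y < PI / 2 -> continuity_2d_pt P x y;
  cr_Q : forall x y, Rabs y < PI / 2 -> continuity_2d_pt Q x y
}.

(* [U] and [V] are the real and imaginary parts of a holomorphic function of
   [x + i y] in the strip [|y| < PI / 2]. *)
Definition holomorphic_pair (U V : R -> R -> R) : Prop :=
  exists P Q, cauchy_riemann U V P Q.

Lemma is_derive_Rmult (f g : R -> R) (x df dg : R) :
  is_derive f x df -> is_derive g x dg ->
  is_derive (fun t => f t * g t) x (df * g x + f x * dg).
Proof.
intros Hf Hg; exact (is_derive_mult f g x df dg Hf Hg Rmult_comm).
Qed.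

Lemma is_derive_Rplus (f g : R -> R) (x df dg : R) :
  is_derive f x df -> is_derive g x dg ->
  is_derive (fun t => f t + g t) x (df + dg).
Proof. exact (is_derive_plus f g x df dg). Qed.

Lemma is_derive_Rminus (f g : R -> R) (x df dg : R) :
  is_derive f x df -> is_derive g x dg ->
  is_derive (fun t => f t - g t) x (df - dg).
Proof. exact (is_derive_minus f g x df dg). Qed.

Lemma is_derive_eq (f : R -> R) (x l l' : R) :
  is_derive f x l -> l = l' -> is_derive f x l'.
Proof. now intros H <-. Qed.

Lemma holomorphic_pair_mult (U1 V1 U2 V2 : R -> R -> R) :
  holomorphic_pair U1 V1 -> holomorphic_pair U2 V2 ->
  holomorphic_pair (fun x y => U1 x y * U2 x y - V1 x y * V2 x y)
                   (fun x y => U1 x y * V2 x y + V1 x y * U2 x y).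
Proof.
intros [P1 [Q1 H1]] [P2 [Q2 H2]].
exists (fun x y => (P1 x y * U2 x y + U1 x y * P2 x y)
                   - (Q1 x y * V2 x y + V1 x y * Q2 x y)).
exists (fun x y => (P1 x y * V2 x y + U1 x y * Q2 x y)
                   + (Q1 x y * U2 x y + V1 x y * P2 x y)).
split; intros x y Hy.
- eapply is_derive_eq;
    [apply is_derive_Rminus; apply is_derive_Rmult;
     [apply (cr_dUx _ _ _ _ H1) | apply (cr_dUx _ _ _ _ H2)
     |apply (cr_dVx _ _ _ _ H1) | apply (cr_dVx _ _ _ _ H2)]; exact Hy
    |cbv beta; ring].
- eapply is_derive_eq;
    [apply is_derive_Rplus; apply is_derive_Rmult;
     [apply (cr_dUx _ _ _ _ H1) | apply (cr_dVx _ _ _ _ H2)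
     |apply (cr_dVx _ _ _ _ H1) | apply (cr_dUx _ _ _ _ H2)]; exact Hy
    |cbv beta; ring].
- eapply is_derive_eq;
    [apply is_derive_Rminus; apply is_derive_Rmult;
     [apply (cr_dUy _ _ _ _ H1) | apply (cr_dUy _ _ _ _ H2)
     |apply (cr_dVy _ _ _ _ H1) | apply (cr_dVy _ _ _ _ H2)]; exact Hy
    |cbv beta; ring].
- eapply is_derive_eq;
    [apply is_derive_Rplus; apply is_derive_Rmult;
     [apply (cr_dUy _ _ _ _ H1) | apply (cr_dVy _ _ _ _ H2)
     |apply (cr_dVy _ _ _ _ H1) | apply (cr_dUy _ _ _ _ H2)]; exact Hy
    |cbv beta; ring].
- destruct H1, H2; apply continuity_2d_pt_minus; apply continuity_2d_pt_mult; auto.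
- destruct H1, H2; apply continuity_2d_pt_plus; apply continuity_2d_pt_mult; auto.
- destruct H1, H2; apply continuity_2d_pt_minus; apply continuity_2d_pt_plus;
    apply continuity_2d_pt_mult; auto.
- destruct H1, H2; apply continuity_2d_pt_plus; apply continuity_2d_pt_plus;
    apply continuity_2d_pt_mult; auto.
Qed.

Lemma holomorphic_pair_plus (U1 V1 U2 V2 : R -> R -> R) :
  holomorphic_pair U1 V1 -> holomorphic_pair U2 V2 ->
  holomorphic_pair (fun x y => U1 x y + U2 x y) (fun x y => V1 x y + V2 x y).
Proof.
intros [P1 [Q1 H1]] [P2 [Q2 H2]].
exists (fun x y => P1 x y + P2 x y), (fun x y => Q1 x y + Q2 x y).
split; intros x y Hy; try (destruct H1, H2; apply continuity_2d_pt_plus; auto; fail).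
- apply is_derive_Rplus; [apply (cr_dUx _ _ _ _ H1) | apply (cr_dUx _ _ _ _ H2)]; exact Hy.
- apply is_derive_Rplus; [apply (cr_dVx _ _ _ _ H1) | apply (cr_dVx _ _ _ _ H2)]; exact Hy.
- eapply is_derive_eq;
    [apply is_derive_Rplus; [apply (cr_dUy _ _ _ _ H1) | apply (cr_dUy _ _ _ _ H2)]; exact Hy
    |cbv beta; ring].
- apply is_derive_Rplus; [apply (cr_dVy _ _ _ _ H1) | apply (cr_dVy _ _ _ _ H2)]; exact Hy.
Qed.

Lemma holomorphic_pair_const (c d : R) :
  holomorphic_pair (fun _ _ => c) (fun _ _ => d).
Proof.
exists (fun _ _ => 0), (fun _ _ => 0).
split; intros x y _; try apply continuity_2d_pt_const;
  try (eapply is_derive_eq; [apply (is_derive_const (K := R_AbsRing) (V := R_NormedModule)) | ]);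
  unfold zero; simpl; ring.
Qed.

Lemma continuity_2d_pt_comp1 (f : R -> R) (x y : R) :
  continuity_pt f x -> continuity_2d_pt (fun u _ => f u) x y.
Proof.
intros H; apply (continuity_1d_2d_pt_comp f (fun u _ => u)); auto.
apply continuity_2d_pt_id1.
Qed.

Lemma continuity_2d_pt_comp2 (f : R -> R) (x y : R) :
  continuity_pt f y -> continuity_2d_pt (fun _ v => f v) x y.
Proof.
intros H; apply (continuity_1d_2d_pt_comp f (fun _ v => v)); auto.
apply continuity_2d_pt_id2.
Qed.

Lemma continuity_pt_derive (f : R -> R) (x : R) :
  ex_derive f x -> continuity_pt f x.
Proof.
intros H; apply continuity_pt_filterlim.
exact (ex_derive_continuous f x H).
Qed.

(* [exp (c z)] *)
Lemma holomorphic_pair_exp (c : R) :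
  holomorphic_pair (fun x y => exp (c * x) * cos (c * y))
                   (fun x y => exp (c * x) * sin (c * y)).
Proof.
exists (fun x y => c * (exp (c * x) * cos (c * y))),
       (fun x y => c * (exp (c * x) * sin (c * y))).
split; intros x y _;
  try (auto_derive; [ exact I | ring ]);
  repeat apply continuity_2d_pt_mult;
  try apply continuity_2d_pt_const;
  first [ apply (continuity_2d_pt_comp1 (fun u => exp (c * u)))
        | apply (continuity_2d_pt_comp2 (fun u => cos (c * u)))
        | apply (continuity_2d_pt_comp2 (fun u => sin (c * u))) ];
  apply continuity_pt_derive; auto_derive; exact I.
Qed.

(* [exp (i c z)] *)
Lemma holomorphic_pair_expi (c : R) :
  holomorphic_pair (fun x y => exp (- (c * y)) * cos (c * x))
                   (fun x y => exp (- (c * y)) * sin (c * x)).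
Proof.
exists (fun x y => - c * (exp (- (c * y)) * sin (c * x))),
       (fun x y => c * (exp (- (c * y)) * cos (c * x))).
split; intros x y _;
  try (auto_derive; [ exact I | ring ]);
  repeat apply continuity_2d_pt_mult;
  try apply continuity_2d_pt_const;
  first [ apply (continuity_2d_pt_comp2 (fun u => exp (- (c * u))))
        | apply (continuity_2d_pt_comp1 (fun u => cos (c * u)))
        | apply (continuity_2d_pt_comp1 (fun u => sin (c * u))) ];
  apply continuity_pt_derive; auto_derive; exact I.
Qed.

(* The Schwarz reflection [conj (F (conj z))]. *)
Lemma holomorphic_pair_reflect (U V : R -> R -> R) :
  holomorphic_pair U V ->
  holomorphic_pair (fun x y => U x (- y)) (fun x y => - V x (- y)).
Proof.
assert (refl : forall f x y, continuity_2d_pt f x (- y) ->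
           continuity_2d_pt (fun x y => f x (- y)) x y).
{ intros f x y H eps; destruct (H eps) as [d Hd]; exists d; intros u v Hu Hv.
  apply Hd; [exact Hu|].
  replace (- v - - y) with (- (v - y)) by ring; now rewrite Rabs_Ropp. }
intros [P [Q []]].
exists (fun x y => P x (- y)), (fun x y => - Q x (- y)).
split; intros x y Hy; rewrite <- (Rabs_Ropp y) in Hy;
  try (repeat apply continuity_2d_pt_opp; apply refl; auto).
- auto.
- apply (is_derive_opp (K := R_AbsRing) (V := R_NormedModule)); auto.
- eapply is_derive_eq; [apply (is_derive_comp (fun t => U x t) (fun t => - t))|].
  + now apply cr_dUy0.
  + apply (is_derive_opp (K := R_AbsRing) (V := R_NormedModule)).
    apply (is_derive_id (K := R_AbsRing)).
  + unfold scal, opp, one; simpl; unfold mult; simpl; ring.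
- eapply is_derive_eq.
  + apply (is_derive_opp (K := R_AbsRing) (V := R_NormedModule)).
    apply (is_derive_comp (fun t => V x t) (fun t => - t)).
    * now apply cr_dVy0.
    * apply (is_derive_opp (K := R_AbsRing) (V := R_NormedModule)).
      apply (is_derive_id (K := R_AbsRing)).
  + unfold scal, opp, one; simpl; unfold mult; simpl; ring.
Qed.

Lemma continuity_2d_pt_slice (f : R -> R -> R) (x y : R) :
  continuity_2d_pt f x y -> continuous (fun x => f x y) x.
Proof.
intros H; apply continuity_pt_filterlim.
intros eps Heps; destruct (H (mkposreal eps Heps)) as [d Hd].
exists d; split; [apply cond_pos|]; intros u [_ Hu].
apply Hd; [exact Hu|].
rewrite Rminus_diag_eq, Rabs_R0; [apply cond_pos|reflexivity].
Qed.

Lemma holomorphic_pair_ex_RInt (U V : R -> R -> R) (y a b : R) :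
  holomorphic_pair U V -> Rabs y < PI / 2 -> ex_RInt (fun x => U x y) a b.
Proof.
intros [P [Q H]] Hy; apply (ex_RInt_continuous (V := R_CompleteNormedModule)).
intros x _; apply continuity_2d_pt_slice, (cr_U _ _ _ _ H); exact Hy.
Qed.

Lemma continuity_2d_pt_swap (f : R -> R -> R) (x y : R) :
  continuity_2d_pt f x y -> continuity_2d_pt (fun u v => f v u) y x.
Proof.
intros H eps; destruct (H eps) as [d Hd]; exists d; intros u v Hu Hv.
now apply Hd.
Qed.

Lemma Rabs_lt_locally (r x : R) :
  Rabs x < r -> locally x (fun y => Rabs y < r).
Proof.
intros H; assert (Hd : 0 < r - Rabs x) by lra.
exists (mkposreal _ Hd); intros y Hy.
change (Rabs (y - x) < r - Rabs x) in Hy.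
replace y with (x + (y - x)) by ring.
apply Rle_lt_trans with (1 := Rabs_triang _ _); lra.
Qed.

(* Cauchy's theorem on the rectangle [a, b] x [0, d], where the two vertical
   sides are estimated by the mean value theorem. *)
Lemma contour_shift (U V : R -> R -> R) (a b d : R) :
  holomorphic_pair U V -> 0 < d < PI / 2 ->
  exists y, 0 <= y <= d /\
    RInt (fun x => U x d) a b - RInt (fun x => U x 0) a b
    = - d * (V b y - V a y).
Proof.
intros HUV Hd; generalize HUV; intros [P [Q H]].
(* Differentiation under the integral sign turns [U] into [- Q], and [Q] is the [x]-derivative of
   [V]; only boundary values of [V] remain. *)
assert (Hder : forall y, Rabs y < PI / 2 ->
  is_derive (fun y => RInt (fun x => U x y) a b) y (- (V b y - V a y))).
{ intros y Hy.
  assert (HD : locally y (fun z => forall x,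
             is_derive (fun y => U x y) z (- Q x z))).
  { generalize (Rabs_lt_locally _ _ Hy); apply filter_imp.
    intros z Hz x; now apply (cr_dUy _ _ _ _ H). }
  eapply is_derive_eq.
  - apply (is_derive_RInt_param (fun y x => U x y)).
    + revert HD; apply filter_imp; intros z Hz x _; exists (- Q x z); apply Hz.
    + intros x _.
      apply continuity_2d_pt_ext_loc with (fun y x => - Q x y).
      * destruct HD as [e He]; exists e; intros u v Hu _; symmetry.
        apply is_derive_unique, He; exact Hu.
      * apply (continuity_2d_pt_swap (fun x y => - Q x y)).
        apply continuity_2d_pt_opp, (cr_Q _ _ _ _ H), Hy.
    + generalize (Rabs_lt_locally _ _ Hy); apply filter_imp.
      intros z Hz; now apply holomorphic_pair_ex_RInt with V.
  - rewrite (RInt_ext _ (fun x => opp (Q x y))).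
    2: intros x _; apply is_derive_unique, (cr_dUy _ _ _ _ H), Hy.
    apply is_RInt_unique.
    apply (is_RInt_opp (V := R_NormedModule) (fun x => Q x y)).
    apply (is_RInt_derive (V := R_CompleteNormedModule) (fun x => V x y)).
    + intros x _; now apply (cr_dVx _ _ _ _ H).
    + intros x _; apply continuity_2d_pt_slice, (cr_Q _ _ _ _ H), Hy. }
destruct (MVT_gen (fun y => RInt (fun x => U x y) a b) 0 d
            (fun y => - (V b y - V a y))) as [y [Hy E]].
- rewrite Rmin_left, Rmax_right by lra; intros y Hy; apply Hder.
  rewrite Rabs_pos_eq; lra.
- rewrite Rmin_left, Rmax_right by lra; intros y Hy.
  apply continuity_pt_derive; eexists; apply Hder.
  rewrite Rabs_pos_eq; lra.
- rewrite Rmin_left, Rmax_right in Hy by lra.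
  exists y; split; [exact Hy|]; rewrite E; ring.
Qed.

(** * The trapezoidal rule for functions holomorphic in a strip *)

(* Real and imaginary part of [sum_(1 <= n <= L) exp (i n l (x + i y))]. *)
Fixpoint geom_re (l : R) (L : nat) (x y : R) : R :=
  match L with
  | O => 0
  | S m => geom_re l m x y + exp (- (l * INR L * y)) * cos (l * INR L * x)
  end.

Fixpoint geom_im (l : R) (L : nat) (x y : R) : R :=
  match L with
  | O => 0
  | S m => geom_im l m x y + exp (- (l * INR L * y)) * sin (l * INR L * x)
  end.

Lemma holomorphic_pair_geom (l : R) (L : nat) :
  holomorphic_pair (geom_re l L) (geom_im l L).
Proof.
induction L as [|L IH].
- exact (holomorphic_pair_const 0 0).
- apply (holomorphic_pair_plus (geom_re l L) (geom_im l L)); [exact IH|].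
  apply (holomorphic_pair_expi (l * INR (S L))).
Qed.

(** Each factor [exp (i l (x + i y))] has modulus [exp (- (l y)) < 1], so the geometric series
    bounds all partial sums at once; uniformity in [L] permits the later limit [L -> oo]. *)
Lemma geom_sum_bound (l : R) (L : nat) (x y : R) : 0 < l -> 0 < y ->
  Rabs (geom_re l L x y) <= exp (- (l * y)) / (1 - exp (- (l * y))) /\
  Rabs (geom_im l L x y) <= exp (- (l * y)) / (1 - exp (- (l * y))).
Proof.
intros Hl Hy; set (r := exp (- (l * y))).
assert (Hr : 0 < r < 1).
{ split; [apply exp_pos|]; unfold r; rewrite <- exp_0; apply exp_increasing; nra. }
assert (E : forall n, exp (- (l * INR n * y)) = r ^ n).
{ intros n; unfold r; induction n as [|n IH].
  - simpl; rewrite <- exp_0; f_equal; ring.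
  - rewrite S_INR; simpl; rewrite <- IH, <- exp_plus; f_equal; ring. }
assert (Hsum : Rabs (geom_re l L x y) <= r * (1 - r ^ L) / (1 - r) /\
               Rabs (geom_im l L x y) <= r * (1 - r ^ L) / (1 - r)).
{ induction L as [|L [IH1 IH2]].
  - simpl; rewrite Rabs_R0; split; apply Req_le; field; lra.
  - assert (Hstep : r * (1 - r ^ S L) / (1 - r) = r * (1 - r ^ L) / (1 - r) + r ^ S L).
    { simpl; field; lra. }
    assert (Hb : forall t, -1 <= t <= 1 -> Rabs (exp (- (l * INR (S L) * y)) * t) <= r ^ S L).
    { intros t Ht; rewrite E, Rabs_mult.
      assert (0 < r ^ S L) by (apply pow_lt; lra).
      rewrite (Rabs_pos_eq (r ^ S L)) by lra.
      assert (Rabs t <= 1) by (apply Rabs_le; lra); nra. }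
    rewrite Hstep; split.
    + change (geom_re l (S L) x y) with
        (geom_re l L x y + exp (- (l * INR (S L) * y)) * cos (l * INR (S L) * x)).
      apply Rle_trans with (1 := Rabs_triang _ _); apply Rplus_le_compat; auto.
      apply Hb, COS_bound.
    + change (geom_im l (S L) x y) with
        (geom_im l L x y + exp (- (l * INR (S L) * y)) * sin (l * INR (S L) * x)).
      apply Rle_trans with (1 := Rabs_triang _ _); apply Rplus_le_compat; auto.
      apply Hb, SIN_bound. }
assert (0 < r ^ L) by (apply pow_lt; lra).
assert (r * (1 - r ^ L) / (1 - r) <= r / (1 - r)).
{ apply Rmult_le_compat_r; [left; apply Rinv_0_lt_compat; lra|]; nra. }
lra.
Qed.

(* On the lines where [exp (i l x) = -1] the sum is alternating. *)
Lemma geom_sum_half_period (l : R) (L : nat) (x y : R) :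
  0 < l -> 0 <= y -> (forall n, cos (l * INR n * x) = (-1) ^ n) ->
  (forall n, sin (l * INR n * x) = 0) ->
  Rabs (geom_re l L x y) <= 1 /\ geom_im l L x y = 0.
Proof.
intros Hl Hy Hc Hs; set (r := exp (- (l * y))).
assert (Hr : 0 < r <= 1).
{ split; [apply exp_pos|]; unfold r; rewrite <- exp_0.
  destruct (Req_dec y 0) as [->|Hy0].
  - right; f_equal; ring.
  - left; apply exp_increasing; assert (0 < y) by lra; nra. }
assert (E : forall n, exp (- (l * INR n * y)) = r ^ n).
{ intros n; unfold r; induction n as [|n IH].
  - simpl; rewrite <- exp_0; f_equal; ring.
  - rewrite S_INR; simpl; rewrite <- IH, <- exp_plus; f_equal; ring. }
split.
(* The geometric sum with ratio [- r]; its modulus is at most [2 r / (1 + r) <= 1]. *)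
- assert (Es : geom_re l L x y = - r * (1 - (- r) ^ L) / (1 + r)).
  { induction L as [|L IH]; [simpl; field; lra|].
    change (geom_re l (S L) x y) with
      (geom_re l L x y + exp (- (l * INR (S L) * y)) * cos (l * INR (S L) * x)).
    rewrite IH, E, Hc, <- Rpow_mult_distr.
    replace (r * -1) with (- r) by ring; simpl; field; lra. }
  rewrite Es; unfold Rdiv; rewrite !Rabs_mult, Rabs_Ropp, Rabs_inv.
  rewrite (Rabs_pos_eq r), (Rabs_pos_eq (1 + r)) by lra.
  assert (Hp : Rabs ((- r) ^ L) <= 1).
  { rewrite <- RPow_abs, Rabs_Ropp, Rabs_pos_eq by lra.
    rewrite <- (pow1 L); apply pow_incr; lra. }
  assert (Rabs (1 - (- r) ^ L) <= 2).
  { apply Rle_trans with (1 := Rabs_triang _ _).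
    rewrite Rabs_R1, Rabs_Ropp; lra. }
  assert (0 <= Rabs (1 - (- r) ^ L)) by apply Rabs_pos.
  apply Rmult_le_reg_r with (1 + r); [lra|].
  rewrite Rmult_assoc, Rinv_l by lra; nra.
- induction L as [|L IH]; [reflexivity|].
  change (geom_im l (S L) x y) with
    (geom_im l L x y + exp (- (l * INR (S L) * y)) * sin (l * INR (S L) * x)).
  rewrite IH, Hs; ring.
Qed.

(** * Convergence of Dirichlet kernel integrals to the trapezoidal sum *)

Lemma dirichlet_kernel (l : R) (L : nat) (x : R) :
  (1 + 2 * geom_re l L x 0) * sin (l * x / 2) = sin ((2 * INR L + 1) * (l * x / 2)).
Proof.
induction L as [|L IH].
- simpl; rewrite Rmult_0_r, Rplus_0_l, Rmult_1_l; ring.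
- change (geom_re l (S L) x 0) with
    (geom_re l L x 0 + exp (- (l * INR (S L) * 0)) * cos (l * INR (S L) * x)).
  rewrite Rmult_0_r, Ropp_0, exp_0.
  replace (sin ((2 * INR (S L) + 1) * (l * x / 2))) with
    (sin (l * INR (S L) * x + l * x / 2)) by (f_equal; rewrite S_INR; field).
  replace ((2 * INR L + 1) * (l * x / 2)) with
    (l * INR (S L) * x - l * x / 2) in IH by (rewrite S_INR; field).
  rewrite sin_plus; rewrite sin_minus in IH.
  nra.
Qed.

(** Below [PI / 3] the derivative [cos] is at least [1 / 2]. Above it [sin] is at least
    [sqrt 3 / 2 > 17 / 20], and [17 / 20 >= PI / 4] because [PI <= 34 / 10]. *)
Lemma half_le_sin (x : R) : 0 <= x <= PI / 2 -> x / 2 <= sin x.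
Proof.
intros [H0 H1].
destruct (Rle_lt_dec x (PI / 3)) as [H|H].
- destruct (Req_dec x 0) as [->|Hx]; [rewrite sin_0; lra|].
  destruct (MVT_cor2 sin cos 0 x) as [c [E Hc]]; [lra|intros; apply derivable_pt_lim_sin|].
  rewrite sin_0 in E.
  assert (cos (PI / 3) <= cos c) by (apply cos_decr_1; lra).
  rewrite cos_PI3 in H2; nra.
- assert (sin (PI / 3) <= sin x) by (apply sin_incr_1; lra).
  rewrite sin_PI3 in H2.
  assert (17 / 10 < sqrt 3).
  { rewrite <- (sqrt_Rsqr (17/10)) by lra; apply sqrt_lt_1; unfold Rsqr; lra. }
  assert (PI <= 34 / 10).
  { generalize (PI_ineq 3); intros [_ Hp]; unfold tg_alt, PI_tg in Hp; simpl in Hp; lra. }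
  lra.
Qed.

Lemma is_RInt_eq {V : NormedModule R_AbsRing} (f : R -> V) (a b : R) (l l' : V) :
  is_RInt f a b l -> l = l' -> is_RInt f a b l'.
Proof. now intros H <-. Qed.

(** Integration by parts against [- cos (lam x) / lam]; this is a Riemann-Lebesgue lemma with a
    rate. *)
Lemma riemann_lebesgue_derive (G G' : R -> R) (p q : R) :
  p <= q -> (forall x, p <= x <= q -> is_derive G x (G' x)) ->
  (forall x, p <= x <= q -> continuous G' x) ->
  exists K, forall lam, 0 < lam ->
    Rabs (RInt (fun x => G x * sin (lam * x)) p q) <= K / lam.
Proof.
intros Hpq HG HG'.
destruct (bounded_continuity (K := R_AbsRing) (V := R_NormedModule) G' p q HG') as [M1 HM1].
exists (Rabs (G q) + Rabs (G p) + (q - p) * M1); intros lam Hlam.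
assert (HM1' : 0 <= M1).
{ left; apply Rle_lt_trans with (2 := HM1 p (conj (Rle_refl p) Hpq)); apply norm_ge_0. }
set (S0 := fun x => - cos (lam * x) / lam).
assert (HS : forall x, Rabs (S0 x) <= / lam).
{ intros x; unfold S0, Rdiv; rewrite Rabs_mult, Rabs_Ropp, Rabs_inv.
  rewrite (Rabs_pos_eq lam) by lra.
  assert (Rabs (cos (lam * x)) <= 1) by (apply Rabs_le, COS_bound).
  assert (0 < / lam) by (apply Rinv_0_lt_compat; lra); nra. }
assert (HI : is_RInt (fun x => scal (G' x) (S0 x)) p q (RInt (fun x => G' x * S0 x) p q)).
{ apply (RInt_correct (V := R_CompleteNormedModule)).
  apply (ex_RInt_continuous (V := R_CompleteNormedModule)).
  rewrite Rmin_left, Rmax_right by exact Hpq; intros x Hx.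
  apply (continuous_mult G' S0); [auto|].
  apply (ex_derive_continuous S0); unfold S0; auto_derive; auto. }
apply (is_RInt_scal_derive_r (V := R_CompleteNormedModule)) with (g' := fun x => sin (lam * x)) (f := G) in HI;
  try (rewrite Rmin_left, Rmax_right by exact Hpq).
2: exact HG.
2: { intros x _; unfold S0; auto_derive; [exact I|]; field; lra. }
2: exact HG'.
2: { intros x _; apply (ex_derive_continuous (fun x => sin (lam * x))); auto_derive; auto. }
apply is_RInt_unique in HI; unfold scal in HI; simpl in HI; unfold mult in HI; simpl in HI.
rewrite HI; unfold minus, plus, opp; simpl.
assert (Hb : Rabs (RInt (fun x => G' x * S0 x) p q) <= (q - p) * (M1 * / lam)).
{ apply abs_RInt_le_const; [exact Hpq| |].
  - apply (ex_RInt_continuous (V := R_CompleteNormedModule)).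
    rewrite Rmin_left, Rmax_right by exact Hpq; intros x Hx.
    apply (continuous_mult G' S0); [auto|].
    apply (ex_derive_continuous S0); unfold S0; auto_derive; auto.
  - intros x Hx; rewrite Rabs_mult.
    apply Rmult_le_compat; try apply Rabs_pos; [|apply HS].
    left; apply (HM1 x Hx). }
apply Rle_trans with (1 := Rabs_triang _ _); rewrite Rabs_Ropp.
apply Rle_trans with (Rabs (G q * S0 q) + Rabs (G p * S0 p) + (q - p) * (M1 * / lam)).
- apply Rplus_le_compat; [|exact Hb].
  apply Rle_trans with (1 := Rabs_triang _ _); rewrite Rabs_Ropp; lra.
- rewrite !Rabs_mult.
  assert (H1 := HS p); assert (H2 := HS q).
  assert (0 <= Rabs (G p)) by apply Rabs_pos; assert (0 <= Rabs (G q)) by apply Rabs_pos.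
  unfold Rdiv; rewrite !Rmult_plus_distr_r, !Rmult_assoc.
  apply Rplus_le_compat_r, Rplus_le_compat; apply Rmult_le_compat_l; lra.
Qed.

Lemma geom_re_continuous (l : R) (L : nat) (x : R) :
  continuous (fun x => geom_re l L x 0) x.
Proof.
destruct (holomorphic_pair_geom l L) as [P [Q H]].
apply continuity_2d_pt_slice, (cr_U _ _ _ _ H).
rewrite Rabs_R0; generalize PI_RGT_0; lra.
Qed.

Lemma sin_INR_PI (n : nat) : sin (INR n * PI) = 0.
Proof.
induction n as [|n IH]; [simpl; rewrite Rmult_0_l; apply sin_0|].
rewrite S_INR, Rmult_plus_distr_r, Rmult_1_l, neg_sin, IH; ring.
Qed.

Lemma cos_INR_PI (n : nat) : cos (INR n * PI) = (-1) ^ n.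
Proof.
induction n as [|n IH]; [simpl; rewrite Rmult_0_l; apply cos_0|].
rewrite S_INR, Rmult_plus_distr_r, Rmult_1_l, neg_cos, IH; simpl; ring.
Qed.

(** A cell of length [k] contains an integral number of full waves of every cosine. Hence the
    Dirichlet kernel of [dirichlet_cell] has integral [k]. *)
Lemma geom_re_mean (k : R) (L : nat) : 0 < k ->
  is_RInt (fun x => geom_re (2 * PI / k) L x 0) (- (k / 2)) (k / 2) 0.
Proof.
intros Hk; assert (HPI := PI_RGT_0).
induction L as [|L IH].
- eapply is_RInt_eq; [exact (is_RInt_const (V := R_NormedModule) _ _ 0)|].
  unfold scal; simpl; unfold mult; simpl; ring.
- apply is_RInt_ext with
    (fun x => plus (geom_re (2 * PI / k) L x 0) (cos (2 * PI / k * INR (S L) * x))).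
  { intros x _; simpl geom_re; rewrite Rmult_0_r, Ropp_0, exp_0.
    unfold plus; simpl; ring. }
  apply is_RInt_eq with (plus 0 0); [|unfold plus; simpl; ring].
  apply (is_RInt_plus (V := R_NormedModule)); [exact IH|].
  set (c := 2 * PI / k * INR (S L)).
  assert (Hc : 0 < c).
  { unfold c; apply Rmult_lt_0_compat; [|apply lt_0_INR; lia].
    apply Rdiv_lt_0_compat; lra. }
  apply is_RInt_eq with (minus (sin (c * (k / 2)) / c) (sin (c * (- (k / 2))) / c)).
  + apply (is_RInt_derive (V := R_CompleteNormedModule) (fun x => sin (c * x) / c)).
    * intros x _; auto_derive; [exact I|]; field; lra.
    * intros x _; apply (ex_derive_continuous (fun x => cos (c * x))); auto_derive; auto.
  + replace (c * - (k / 2)) with (- (INR (S L) * PI)) by (unfold c; field; lra).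
    replace (c * (k / 2)) with (INR (S L) * PI) by (unfold c; field; lra).
    rewrite sin_neg, sin_INR_PI; unfold minus, plus, opp; simpl; field; lra.
Qed.

(** After subtraction of [f 0] the function vanishes to first order at the origin, where
    [|x| |D L x|] is bounded uniformly in [L]; so a short middle interval contributes little for all
    [L] at once. Away from the origin one may divide by [sin (l x / 2)], and integration by parts
    gives decay of order [1 / L]. Treating the middle apart avoids differentiating
    [g x / sin (l x / 2)] at 0. *)
Lemma dirichlet_cell (f f' : R -> R) (k : R) : 0 < k ->
  (forall x, is_derive f x (f' x)) -> (forall x, continuous f' x) ->
  is_lim_seq (fun L => RInt (fun x => f x * (1 + 2 * geom_re (2 * PI / k) L x 0))
                            (- (k / 2)) (k / 2)) (k * f 0).
Proof.
intros Hk Hf Hf'; assert (HPI := PI_RGT_0).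
set (l := 2 * PI / k); set (h := k / 2).
assert (Hl : 0 < l) by (apply Rdiv_lt_0_compat; lra).
assert (Hh : 0 < h) by (unfold h; lra).
assert (Hlh : l * h = PI) by (unfold l, h; field; lra).
set (D := fun L x => 1 + 2 * geom_re l L x 0).
set (g := fun x => f x - f 0).
assert (cD : forall L x, continuous (D L) x).
{ intros L x; apply (continuous_plus (fun _ => 1) (fun x => 2 * geom_re l L x 0)).
  - apply continuous_const.
  - apply (continuous_mult (fun _ => 2) (fun x => geom_re l L x 0)).
    + apply continuous_const.
    + apply geom_re_continuous. }
assert (cf : forall x, continuous f x).
{ intros x; apply (ex_derive_continuous f); exists (f' x); apply Hf. }
assert (cg : forall x, continuous g x).
{ intros x; apply (continuous_minus f (fun _ => f 0)); [apply cf|apply continuous_const]. }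
assert (cgD : forall L x, continuous (fun x => g x * D L x) x).
{ intros L x; apply (continuous_mult g (D L)); auto. }
assert (iD : forall L a b, ex_RInt (fun x => g x * D L x) a b).
{ intros L a b; apply (ex_RInt_continuous (V := R_CompleteNormedModule)); auto. }
assert (ED : forall L, RInt (fun x => f x * D L x) (- h) h
             = k * f 0 + RInt (fun x => g x * D L x) (- h) h).
{ intros L; apply is_RInt_unique.
  apply is_RInt_ext with (fun x => plus (scal (f 0) (D L x)) (g x * D L x)).
  { intros x _; unfold plus, scal, g; simpl; unfold mult; simpl; ring. }
  apply (is_RInt_plus (V := R_NormedModule)).
  - replace (k * f 0) with (scal (f 0) (plus (scal (h - - h) 1) (scal 2 0))).
    + apply (is_RInt_scal (V := R_NormedModule)).
      apply (is_RInt_plus (V := R_NormedModule) (fun _ => 1) (fun x => 2 * geom_re l L x 0)).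
      * apply (is_RInt_const (V := R_NormedModule)).
      * apply (is_RInt_scal (V := R_NormedModule)); apply geom_re_mean, Hk.
    + unfold scal, plus, h; simpl; unfold mult; simpl; field.
  - apply (RInt_correct (V := R_CompleteNormedModule)), iD. }
destruct (bounded_continuity (K := R_AbsRing) (V := R_NormedModule) f' (- h) h (fun x _ => Hf' x))
  as [M1 HM1].
assert (HM1' : 0 < M1).
{ apply Rle_lt_trans with (2 := HM1 0 ltac:(lra)); apply norm_ge_0. }
assert (Hg : forall x, - h <= x <= h -> Rabs (g x) <= M1 * Rabs x).
{ intros x Hx.
  destruct (MVT_abs f f' 0 x) as [c [E Hc]].
  { intros c _; apply is_derive_Reals, Hf. }
  unfold g; rewrite E, Rminus_0_r; apply Rmult_le_compat_r; [apply Rabs_pos|].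
  left; apply (HM1 c).
  revert Hc; unfold Rmin, Rmax; destruct (Rle_dec 0 x); lra. }
assert (Hsin : forall x, 0 <= x <= h -> l * x / 4 <= sin (l * x / 2)).
{ intros x Hx; replace (l * x / 4) with (l * x / 2 / 2) by field.
  apply half_le_sin; split; nra. }
(* [|g x| <= M1 |x|] against [|D L x| <= 1 / |sin (l x / 2)| <= 4 / (l |x|)]. *)
assert (HgD : forall L x, - h <= x <= h -> Rabs (g x * D L x) <= 4 * M1 / l).
{ intros L x Hx.
  destruct (Req_dec x 0) as [->|Hx0].
  { unfold g; rewrite Rminus_diag_eq, Rmult_0_l, Rabs_R0 by reflexivity.
    apply Rdiv_le_0_compat; lra. }
  assert (Hs : l * Rabs x / 4 <= Rabs (sin (l * x / 2))).
  { unfold Rabs at 1; destruct (Rcase_abs x) as [Hn|Hp].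
    - replace (l * x / 2) with (- (l * (- x) / 2)) by field.
      rewrite sin_neg, Rabs_Ropp; apply Rle_trans with (2 := Rle_abs _); apply Hsin; lra.
    - apply Rle_trans with (2 := Rle_abs _); apply Hsin; lra. }
  assert (HD : Rabs (D L x) * Rabs (sin (l * x / 2)) <= 1).
  { rewrite <- Rabs_mult; unfold D; rewrite dirichlet_kernel; apply Rabs_le, SIN_bound. }
  assert (0 < Rabs x) by (apply Rabs_pos_lt; exact Hx0).
  assert (0 <= Rabs (D L x)) by apply Rabs_pos.
  rewrite Rabs_mult.
  apply Rle_trans with (M1 * Rabs x * Rabs (D L x)).
  { apply Rmult_le_compat_r; [apply Rabs_pos|]; apply Hg; exact Hx. }
  apply Rmult_le_reg_r with l; [exact Hl|].
  replace (4 * M1 / l * l) with (4 * M1) by (field; lra).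
  assert (Rabs (D L x) * (l * Rabs x / 4) <= 1) by nra.
  nra. }
assert (RL : forall p q, -h <= p -> p <= q -> q <= h -> (q < 0 \/ 0 < p) ->
  exists K, forall L, Rabs (RInt (fun x => g x * D L x) p q) <= K / ((2 * INR L + 1) * (l / 2))).
{ intros p q Hp Hpq Hq H0.
  assert (Hnz : forall x, p <= x <= q -> sin (l * x / 2) <> 0).
  { intros x Hx; destruct H0 as [H0|H0].
    - replace (l * x / 2) with (- (l * (- x) / 2)) by field; rewrite sin_neg.
      assert (l * - x / 4 <= sin (l * - x / 2)) by (apply Hsin; lra).
      assert (0 < l * - x) by (apply Rmult_lt_0_compat; lra); lra.
    - assert (l * x / 4 <= sin (l * x / 2)) by (apply Hsin; lra).
      assert (0 < l * x) by (apply Rmult_lt_0_compat; lra); lra. }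
  destruct (riemann_lebesgue_derive (fun x => g x / sin (l * x / 2))
    (fun x => (f' x * sin (l * x / 2) - g x * (l / 2 * cos (l * x / 2))) / sin (l * x / 2) ^ 2)
    p q Hpq) as [K HK].
  - intros x Hx.
    apply (is_derive_div g (fun x => sin (l * x / 2)) x (f' x) (l / 2 * cos (l * x / 2))).
    + apply (is_derive_eq g x (f' x - 0)); [|ring].
      apply is_derive_Rminus; [apply Hf|apply (is_derive_const (K := R_AbsRing) (V := R_NormedModule))].
    + auto_derive; [exact I|]; unfold Rdiv; ring.
    + apply Hnz, Hx.
  - intros x Hx.
    apply (continuous_mult (fun x => f' x * sin (l * x / 2) - g x * (l / 2 * cos (l * x / 2)))
             (fun x => / sin (l * x / 2) ^ 2)).
    + apply (continuous_minus (fun x => f' x * sin (l * x / 2)) (fun x => g x * (l / 2 * cos (l * x / 2)))).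
      * apply (continuous_mult f' (fun x => sin (l * x / 2))); [apply Hf'|].
        apply (ex_derive_continuous (fun x => sin (l * x / 2))); auto_derive; auto.
      * apply (continuous_mult g (fun x => l / 2 * cos (l * x / 2))); [apply cg|].
        apply (ex_derive_continuous (fun x => l / 2 * cos (l * x / 2))); auto_derive; auto.
    + apply (ex_derive_continuous (fun x => / sin (l * x / 2) ^ 2)); auto_derive.
      apply (pow_nonzero _ 2), Hnz, Hx.
  - exists K; intros L.
    assert (HL : 0 < (2 * INR L + 1) * (l / 2)).
    { apply Rmult_lt_0_compat; [|lra]; generalize (pos_INR L); lra. }
    generalize (HK _ HL); apply Rle_trans, Req_le; f_equal; apply RInt_ext.
    rewrite Rmin_left, Rmax_right by exact Hpq; intros x Hx.
    replace ((2 * INR L + 1) * (l / 2) * x) with ((2 * INR L + 1) * (l * x / 2)) by field.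
    rewrite <- dirichlet_kernel.
    change (g x * (1 + 2 * geom_re l L x 0) =
      g x / sin (l * x / 2) * ((1 + 2 * geom_re l L x 0) * sin (l * x / 2))).
    field; apply Hnz; lra. }
apply is_lim_seq_spec; intros eps.
set (M2 := 4 * M1 / l).
assert (HM2 : 0 < M2) by (apply Rdiv_lt_0_compat; lra).
(* The middle interval of length [2 delta] contributes at most [2 delta M2 <= eps / 2]. *)
set (delta := Rmin h (eps / (4 * M2))).
assert (Hd : 0 < delta <= h).
{ split; [|apply Rmin_l]; apply Rmin_glb_lt; [exact Hh|].
  apply Rdiv_lt_0_compat; [apply cond_pos|lra]. }
assert (Hde : delta * M2 <= eps / 4).
{ apply Rle_trans with (eps / (4 * M2) * M2).
  - apply Rmult_le_compat_r; [lra|apply Rmin_r].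
  - right; field; lra. }
destruct (RL (- h) (- delta)) as [K1 HK1]; [lra|lra|lra|left; lra|].
destruct (RL delta h) as [K2 HK2]; [lra|lra|lra|right; lra|].
(* Beyond this index [L l] exceeds [4 (K1 + K2) / eps], so the two outer intervals together
   contribute at most [eps / 4]. *)
destruct (nfloor_ex (Rabs ((K1 + K2) / (l * (eps / 4))))) as [n [_ Hn]]; [apply Rabs_pos|].
exists (S n); intros L HL.
change (Rabs (RInt (fun x => f x * D L x) (- h) h - k * f 0) < eps).
assert (Ec : forall z : R, k * f 0 + z - k * f 0 = z) by (intros z; ring).
rewrite ED, Ec.
rewrite <- (RInt_Chasles (V := R_CompleteNormedModule) _ (- h) (- delta) h) by apply iD.
rewrite <- (RInt_Chasles (V := R_CompleteNormedModule) _ (- delta) delta h) by apply iD.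
unfold plus; simpl.
assert (Hmid : Rabs (RInt (fun x => g x * D L x) (- delta) delta) <= eps / 2).
{ apply Rle_trans with ((delta - - delta) * M2); [|lra].
  apply abs_RInt_le_const; [lra|apply iD|]; intros x Hx; apply HgD; lra. }
assert (HLn : (K1 + K2) / (l * (eps / 4)) < INR L).
{ apply Rle_lt_trans with (1 := Rle_abs _); apply Rlt_le_trans with (1 := Hn).
  apply le_INR in HL; rewrite S_INR in HL; exact HL. }
assert (Hlam : 0 < (2 * INR L + 1) * (l / 2)).
{ apply Rmult_lt_0_compat; [|lra]; generalize (pos_INR L); lra. }
assert (Hside : K1 / ((2 * INR L + 1) * (l / 2)) + K2 / ((2 * INR L + 1) * (l / 2)) <= eps / 4).
{ apply Rmult_le_reg_r with ((2 * INR L + 1) * (l / 2)); [exact Hlam|].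
  replace ((K1 / ((2 * INR L + 1) * (l / 2)) + K2 / ((2 * INR L + 1) * (l / 2))) *
     ((2 * INR L + 1) * (l / 2))) with (K1 + K2) by (field; split; generalize (pos_INR L); lra).
  assert (He := cond_pos eps).
  assert (Hle : 0 < l * (eps / 4)) by (apply Rmult_lt_0_compat; lra).
  apply Rlt_le in HLn; apply (Rmult_le_compat_r (l * (eps / 4))) in HLn; [|lra].
  replace ((K1 + K2) / (l * (eps / 4)) * (l * (eps / 4))) with (K1 + K2) in HLn by (field; lra).
  nra. }
generalize (HK1 L) (HK2 L) (cond_pos eps); intros H1 H2 He.
apply Rle_lt_trans with (1 := Rabs_triang _ _).
generalize (Rabs_triang (RInt (fun x => g x * D L x) (- delta) delta)
              (RInt (fun x => g x * D L x) delta h)).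
lra.
Qed.

Lemma norm_RInt_exp_left {V : CompleteNormedModule R_AbsRing} (F : R -> V) (K a A B : R) :
  0 < a -> A <= B -> (forall x, A <= x <= B -> continuous F x) -> 0 <= K ->
  (forall x, A <= x <= B -> norm (F x) <= K * exp (a * x)) ->
  norm (RInt F A B) <= K / a * exp (a * B).
Proof.
intros Ha HAB HF HK Hb.
apply Rle_trans with (K / a * exp (a * B) - K / a * exp (a * A)).
- apply (norm_RInt_le F (fun x => K * exp (a * x)) A B); auto.
  + apply (RInt_correct (V := V)), (ex_RInt_continuous (V := V)).
    rewrite Rmin_left, Rmax_right by exact HAB; exact HF.
  + apply (is_RInt_derive (V := R_CompleteNormedModule) (fun x => K / a * exp (a * x))).
    * intros x _; auto_derive; [exact I|]; field; lra.
    * intros x _; apply (ex_derive_continuous (fun x => K * exp (a * x))); auto_derive; exact I.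
- assert (0 <= K / a * exp (a * A)); [|lra].
  apply Rmult_le_pos; [apply Rdiv_le_0_compat; lra|left; apply exp_pos].
Qed.

Lemma norm_RInt_exp_right {V : CompleteNormedModule R_AbsRing} (F : R -> V) (K b A B : R) :
  0 < b -> A <= B -> (forall x, A <= x <= B -> continuous F x) -> 0 <= K ->
  (forall x, A <= x <= B -> norm (F x) <= K * exp (- (b * x))) ->
  norm (RInt F A B) <= K / b * exp (- (b * A)).
Proof.
intros Hb HAB HF HK HFb.
apply Rle_trans with (- (K / b * exp (- (b * B))) - - (K / b * exp (- (b * A)))).
- apply (norm_RInt_le F (fun x => K * exp (- (b * x))) A B); auto.
  + apply (RInt_correct (V := V)), (ex_RInt_continuous (V := V)).
    rewrite Rmin_left, Rmax_right by exact HAB; exact HF.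
  + apply (is_RInt_derive (V := R_CompleteNormedModule) (fun x => - (K / b * exp (- (b * x))))).
    * intros x _; auto_derive; [exact I|]; field; lra.
    * intros x _; apply (ex_derive_continuous (fun x => K * exp (- (b * x)))); auto_derive; exact I.
- assert (0 <= K / b * exp (- (b * B))); [|lra].
  apply Rmult_le_pos; [apply Rdiv_le_0_compat; lra|left; apply exp_pos].
Qed.

(* The two decay estimates are used on either side of [x0]. *)
Lemma norm_RInt_exp_split {V : CompleteNormedModule R_AbsRing} (F : R -> V) (K1 K2 a b x0 A B : R) :
  0 < a -> 0 < b -> A <= x0 <= B -> (forall x, continuous F x) -> 0 <= K1 -> 0 <= K2 ->
  (forall x, norm (F x) <= K1 * exp (a * x)) ->
  (forall x, norm (F x) <= K2 * exp (- (b * x))) ->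
  norm (RInt F A B) <= K1 / a * exp (a * x0) + K2 / b * exp (- (b * x0)).
Proof.
intros Ha Hb Hx HF HK1 HK2 H1 H2.
rewrite <- (RInt_Chasles (V := V) F A x0 B).
2, 3: apply (ex_RInt_continuous (V := V)); intros; apply HF.
eapply Rle_trans; [exact (norm_triangle (RInt F A x0) (RInt F x0 B))|].
apply Rplus_le_compat.
- apply norm_RInt_exp_left; auto; lra.
- apply norm_RInt_exp_right; auto; lra.
Qed.

(** Two natural numbers encode a number of periods of either sign, since the node index [i - M] may
    be negative. *)
Lemma cos_shift_period (x : R) (p q : nat) :
  cos (x + 2 * INR p * PI - 2 * INR q * PI) = cos x.
Proof.
rewrite <- (cos_period _ q).
replace (x + 2 * INR p * PI - 2 * INR q * PI + 2 * INR q * PI)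
  with (x + 2 * INR p * PI) by ring.
apply cos_period.
Qed.

Lemma geom_re_period (k : R) (L i M : nat) (x : R) : 0 < k ->
  geom_re (2 * PI / k) L (x + (INR i - INR M) * k) 0 = geom_re (2 * PI / k) L x 0.
Proof.
intros Hk; induction L as [|L IH]; [reflexivity|].
change (geom_re (2 * PI / k) L (x + (INR i - INR M) * k) 0
  + exp (- (2 * PI / k * INR (S L) * 0)) * cos (2 * PI / k * INR (S L) * (x + (INR i - INR M) * k))
  = geom_re (2 * PI / k) L x 0
  + exp (- (2 * PI / k * INR (S L) * 0)) * cos (2 * PI / k * INR (S L) * x)).
rewrite IH; do 2 f_equal.
rewrite <- (cos_shift_period (2 * PI / k * INR (S L) * x) (S L * i) (S L * M)).
f_equal; rewrite !mult_INR; field; lra.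
Qed.

Section SincQuadrature.

Context (f f' : R -> R) (k : R) (M : nat) (Hk : 0 < k).
Context (Hf : forall x, is_derive f x (f' x)) (Hf' : forall x, continuous f' x).

Let D (L : nat) (x : R) := 1 + 2 * geom_re (2 * PI / k) L x 0.

Lemma dirichlet_integrable (L : nat) (a b : R) : ex_RInt (fun x => f x * D L x) a b.
Proof.
apply (ex_RInt_continuous (V := R_CompleteNormedModule)); intros x _.
apply (continuous_mult f (D L)).
- apply (ex_derive_continuous f); exists (f' x); apply Hf.
- apply (continuous_plus (fun _ => 1) (fun x => 2 * geom_re (2 * PI / k) L x 0)).
  + apply continuous_const.
  + apply (continuous_mult (fun _ => 2) (fun x => geom_re (2 * PI / k) L x 0)).
    * apply continuous_const.
    * apply geom_re_continuous.
Qed.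

Lemma dirichlet_shifted_cell (i : nat) :
  is_lim_seq (fun L => RInt (fun x => f x * D L x)
                ((INR i - INR M) * k - k / 2) ((INR i - INR M) * k + k / 2))
             (k * f ((INR i - INR M) * k)).
Proof.
set (c := (INR i - INR M) * k).
assert (H := dirichlet_cell (fun x => f (x + c)) (fun x => f' (x + c)) k Hk).
cbv beta in H; rewrite Rplus_0_l in H.
assert (H1 : forall x, is_derive (fun x => f (x + c)) x (f' (x + c))).
{ intros x; eapply is_derive_eq; [apply (is_derive_comp f (fun x => x + c))|].
  - apply Hf.
  - auto_derive; [exact I|]; reflexivity.
  - unfold scal; simpl; unfold mult; simpl; ring. }
assert (H2 : forall x, continuous (fun x => f' (x + c)) x).
{ intros x; apply (continuous_comp (fun x => x + c) f'); [|apply Hf'].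
  apply (ex_derive_continuous (fun x => x + c)); auto_derive; exact I. }
apply is_lim_seq_ext with (2 := H H1 H2); intros L.
replace (c - k / 2) with (1 * (- (k / 2)) + c) by ring.
replace (c + k / 2) with (1 * (k / 2) + c) by ring.
rewrite <- (RInt_comp_lin (V := R_CompleteNormedModule)) by apply dirichlet_integrable.
apply RInt_ext; intros x _; unfold D, scal; simpl; unfold mult; simpl.
rewrite !Rmult_1_l; unfold c; rewrite geom_re_period by exact Hk; reflexivity.
Qed.

(** Each node is the midpoint of a cell of length [k]; the cells therefore tile an interval with
    half-integer end points. *)
Lemma dirichlet_trapezoid (n : nat) :
  is_lim_seq (fun L => RInt (fun x => f x * D L x)
                (- ((INR M + / 2) * k)) ((INR n - INR M + / 2) * k))
             (k * sum_n (fun i => f ((INR i - INR M) * k)) n).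
Proof.
induction n as [|n IH].
- rewrite sum_O; apply is_lim_seq_ext with (2 := dirichlet_shifted_cell 0).
  intros L; f_equal; simpl; field.
- assert (E : forall u v : R, k * plus u v = k * u + k * v)
    by (intros u v; unfold plus; simpl; ring).
  rewrite sum_Sn, E.
  apply is_lim_seq_ext with (2 := is_lim_seq_plus' _ _ _ _ IH (dirichlet_shifted_cell (S n))).
  intros L; rewrite S_INR.
  replace ((INR n + 1 - INR M) * k - k / 2) with ((INR n - INR M + / 2) * k) by field.
  replace ((INR n + 1 - INR M) * k + k / 2) with ((INR n + 1 - INR M + / 2) * k) by field.
  apply (RInt_Chasles (V := R_CompleteNormedModule)); apply dirichlet_integrable.
Qed.

End SincQuadrature.

(** * The error of the truncated trapezoidal sum *)

Definition exp_decay (U : R -> R -> R) (K a b : R) : Prop :=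
  forall x y, Rabs y < PI / 2 ->
    Rabs (U x y) <= K * exp (a * x) /\ Rabs (U x y) <= K * exp (- (b * x)).

(** The integrand is the real part of [F = U + i V] times the sum of the positive frequencies. On
    the line at height [d] that sum is bounded by [r / (1 - r)]; the vertical sides contribute [d]
    times the size of [F] at the end points, at the intermediate height given by [contour_shift]. *)
Lemma trapezoid_shift_bound (U V : R -> R -> R) (K a b k d : R) (M N L : nat) :
  holomorphic_pair U V -> 0 < a -> 0 < b -> 0 <= K -> 0 < k -> 0 < d < PI / 2 ->
  exp_decay U K a b -> exp_decay V K a b ->
  let r := exp (- (2 * PI / k * d)) in
  Rabs (RInt (fun x => U x 0 * geom_re (2 * PI / k) L x 0 - V x 0 * geom_im (2 * PI / k) L x 0)
          (- ((INR M + / 2) * k)) ((INR N + / 2) * k))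
  <= 2 * K * (/ a + / b) * (r / (1 - r))
     + d * K * (exp (- (a * ((INR M + / 2) * k))) + exp (- (b * ((INR N + / 2) * k)))).
Proof.
intros HUV Ha Hb HK Hk Hd HU HV r.
assert (HPI := PI_RGT_0).
set (l := 2 * PI / k) in *.
assert (Hl : 0 < l) by (apply Rdiv_lt_0_compat; lra).
set (A := - ((INR M + / 2) * k)); set (B := (INR N + / 2) * k).
assert (HA : A <= 0 <= B).
{ unfold A, B; generalize (pos_INR M) (pos_INR N); split; nra. }
assert (Hr : 0 < r < 1).
{ split; [apply exp_pos|]; unfold r; rewrite <- exp_0; apply exp_increasing.
  assert (0 < l * d) by (apply Rmult_lt_0_compat; lra); lra. }
assert (Hr' : 0 <= r / (1 - r)) by (apply Rdiv_le_0_compat; lra).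
assert (HG := holomorphic_pair_mult _ _ _ _ HUV (holomorphic_pair_geom l L)).
destruct (contour_shift _ _ A B d HG Hd) as [y [Hy E]].
assert (Hy' : Rabs y < PI / 2) by (rewrite Rabs_pos_eq; lra).
assert (Hd' : Rabs d < PI / 2) by (rewrite Rabs_pos_eq; lra).
set (I1 := RInt (fun x => U x d * geom_re l L x d - V x d * geom_im l L x d) A B) in *.
set (I0 := RInt (fun x => U x 0 * geom_re l L x 0 - V x 0 * geom_im l L x 0) A B) in *.
assert (H1 : Rabs I1 <= 2 * K * (/ a + / b) * (r / (1 - r))).
{ apply Rle_trans with ((2 * K * (r / (1 - r))) / a * exp (a * 0)
                        + (2 * K * (r / (1 - r))) / b * exp (- (b * 0))).
  2: { rewrite !Rmult_0_r, Ropp_0, exp_0; right; field; lra. }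
  assert (Hx : forall x m, Rabs (U x d) <= m -> Rabs (V x d) <= m ->
    Rabs (U x d * geom_re l L x d - V x d * geom_im l L x d) <= 2 * (r / (1 - r)) * m).
  { intros x m H1 H2; destruct (geom_sum_bound l L x d Hl (proj1 Hd)) as [B1 B2].
    fold r in B1, B2.
    apply Rle_trans with (1 := Rabs_triang _ _); rewrite Rabs_Ropp, !Rabs_mult.
    apply Rle_trans with (m * (r / (1 - r)) + m * (r / (1 - r))); [|lra].
    apply Rplus_le_compat; apply Rmult_le_compat; auto using Rabs_pos. }
  apply (norm_RInt_exp_split (V := R_CompleteNormedModule)
    (fun x => U x d * geom_re l L x d - V x d * geom_im l L x d)); auto.
  - intros x; destruct HG as [P [Q HG]].
    exact (continuity_2d_pt_slice _ _ _ (cr_U _ _ _ _ HG x d Hd')).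
  - apply Rmult_le_pos; lra.
  - apply Rmult_le_pos; lra.
  - intros x; destruct (HU x d Hd') as [h1 _]; destruct (HV x d Hd') as [h2 _].
    apply Rle_trans with (1 := Hx x _ h1 h2); right; ring.
  - intros x; destruct (HU x d Hd') as [_ h1]; destruct (HV x d Hd') as [_ h2].
    apply Rle_trans with (1 := Hx x _ h1 h2); right; ring. }
assert (Hside : forall X m, (forall n, cos (l * INR n * X) = (-1) ^ n) ->
   (forall n, sin (l * INR n * X) = 0) -> Rabs (V X y) <= m ->
   Rabs (U X y * geom_im l L X y + V X y * geom_re l L X y) <= m).
{ intros X m Hc Hs Hm.
  destruct (geom_sum_half_period l L X y Hl (proj1 Hy) Hc Hs) as [B1 ->].
  rewrite Rmult_0_r, Rplus_0_l, Rabs_mult.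
  generalize (Rabs_pos (V X y)) (Rabs_pos (geom_re l L X y)); nra. }
assert (HsA : Rabs (U A y * geom_im l L A y + V A y * geom_re l L A y)
              <= K * exp (- (a * ((INR M + / 2) * k)))).
{ apply Hside.
  (* [A] is an odd multiple of [k / 2], so the frequency [n] has the phase [n (2 M + 1) PI] up to
     sign; likewise at [B]. *)
  - intros n; replace (l * INR n * A) with (- (INR (n * (2 * M + 1)) * PI)).
    + rewrite cos_neg, cos_INR_PI, Nat.mul_comm, pow_mult.
      f_equal; rewrite Nat.add_1_r; apply pow_1_odd.
    + rewrite mult_INR, plus_INR, mult_INR; unfold l, A; simpl; field; lra.
  - intros n; replace (l * INR n * A) with (- (INR (n * (2 * M + 1)) * PI)).
    + rewrite sin_neg, sin_INR_PI; ring.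
    + rewrite mult_INR, plus_INR, mult_INR; unfold l, A; simpl; field; lra.
  - replace (- (a * ((INR M + / 2) * k))) with (a * A) by (unfold A; ring).
    apply HV, Hy'. }
assert (HsB : Rabs (U B y * geom_im l L B y + V B y * geom_re l L B y)
              <= K * exp (- (b * ((INR N + / 2) * k)))).
{ apply Hside.
  - intros n; replace (l * INR n * B) with (INR (n * (2 * N + 1)) * PI).
    + rewrite cos_INR_PI, Nat.mul_comm, pow_mult.
      f_equal; rewrite Nat.add_1_r; apply pow_1_odd.
    + rewrite mult_INR, plus_INR, mult_INR; unfold l, B; simpl; field; lra.
  - intros n; replace (l * INR n * B) with (INR (n * (2 * N + 1)) * PI).
    + apply sin_INR_PI.
    + rewrite mult_INR, plus_INR, mult_INR; unfold l, B; simpl; field; lra.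
  - apply HV, Hy'. }
set (vA := U A y * geom_im l L A y + V A y * geom_re l L A y) in *.
set (vB := U B y * geom_im l L B y + V B y * geom_re l L B y) in *.
assert (E0 : I0 = I1 + d * vB - d * vA).
{ unfold minus in E; simpl in E; lra. }
rewrite E0.
apply Rabs_le_between in H1; apply Rabs_le_between in HsA; apply Rabs_le_between in HsB.
set (eA := exp (- (a * ((INR M + / 2) * k)))) in *.
set (eB := exp (- (b * ((INR N + / 2) * k)))) in *.
assert (- (d * (K * eA)) <= d * vA <= d * (K * eA)) by (split; nra).
assert (- (d * (K * eB)) <= d * vB <= d * (K * eB)) by (split; nra).
apply Rabs_le; rewrite (Rmult_assoc d K), (Rmult_plus_distr_l K), (Rmult_plus_distr_l d);
  change (exp (- (b * B))) with eB; lra.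
Qed.

(* With the reflected function the terms [n < 0] of the Fourier series are treated
   as the terms [n > 0]; the limit [L -> oo] then gives the trapezoidal sum, and
   [d -> PI / 2] the exponent. *)
Theorem sinc_quadrature_bound (U V : R -> R -> R) (K a b k : R) (M N : nat) :
  holomorphic_pair U V -> 0 < a -> 0 < b -> 0 <= K -> 0 < k ->
  exp_decay U K a b -> exp_decay V K a b ->
  Rabs (k * sum_n (fun i => U ((INR i - INR M) * k) 0) (M + N)
        - RInt (fun x => U x 0) (- ((INR M + / 2) * k)) ((INR N + / 2) * k))
  <= K * (2 * (/ a + / b) * (/ sinh (PI ^ 2 / (2 * k)) * exp (- (PI ^ 2 / (2 * k))))
          + PI * (exp (- (a * INR M * k)) + exp (- (b * INR N * k)))).
Proof.
intros HUV Ha Hb HK Hk HU HV.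
assert (HPI := PI_RGT_0).
assert (H0 : Rabs 0 < PI / 2) by (rewrite Rabs_R0; lra).
set (l := 2 * PI / k).
assert (Hl : 0 < l) by (apply Rdiv_lt_0_compat; lra).
set (A := - ((INR M + / 2) * k)); set (B := (INR N + / 2) * k).
set (T := exp (- (a * ((INR M + / 2) * k))) + exp (- (b * ((INR N + / 2) * k)))).
set (err := k * sum_n (fun i => U ((INR i - INR M) * k) 0) (M + N)
            - RInt (fun x => U x 0) A B).
assert (HR := holomorphic_pair_reflect _ _ HUV).
assert (HUr : exp_decay (fun x y => U x (- y)) K a b).
{ intros x y Hy; apply HU; now rewrite Rabs_Ropp. }
assert (HVr : exp_decay (fun x y => - V x (- y)) K a b).
{ intros x y Hy; rewrite Rabs_Ropp; apply HV; now rewrite Rabs_Ropp. }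
assert (Hd : forall d, 0 < d < PI / 2 -> Rabs err <=
   4 * K * (/ a + / b) * (exp (- (l * d)) / (1 - exp (- (l * d)))) + 2 * d * K * T).
{ intros d Hd.
  set (bound := 4 * K * (/ a + / b) * (exp (- (l * d)) / (1 - exp (- (l * d)))) + 2 * d * K * T).
  assert (HL : forall L, Rabs (RInt (fun x => U x 0 * (1 + 2 * geom_re l L x 0)) A B
                 - RInt (fun x => U x 0) A B) <= bound).
  { intros L.
    assert (B1 := trapezoid_shift_bound U V K a b k d M N L HUV Ha Hb HK Hk Hd HU HV).
    assert (B2 := trapezoid_shift_bound _ _ K a b k d M N L HR Ha Hb HK Hk Hd HUr HVr).
    cbv beta zeta in B1, B2; fold l T A B in B1, B2; rewrite Ropp_0 in B2.
    assert (I1 := holomorphic_pair_ex_RInt _ _ 0 A B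
      (holomorphic_pair_mult _ _ _ _ HUV (holomorphic_pair_geom l L)) H0).
    assert (I2 := holomorphic_pair_ex_RInt _ _ 0 A B
      (holomorphic_pair_mult _ _ _ _ HR (holomorphic_pair_geom l L)) H0).
    assert (I3 := holomorphic_pair_ex_RInt _ _ 0 A B HUV H0).
    cbv beta in I2; rewrite Ropp_0 in I2.
    (* On the real axis the reflected function is [U - i V]. Adding the two sums over positive
       frequencies cancels [V] and doubles [U geom_re]. *)
    assert (E : RInt (fun x => U x 0 * (1 + 2 * geom_re l L x 0)) A B =
      RInt (fun x => U x 0) A B +
      (RInt (fun x => U x 0 * geom_re l L x 0 - V x 0 * geom_im l L x 0) A B +
       RInt (fun x => U x 0 * geom_re l L x 0 - - V x 0 * geom_im l L x 0) A B)).
    { apply is_RInt_unique.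
      apply is_RInt_ext with (fun x => plus (U x 0)
        (plus (U x 0 * geom_re l L x 0 - V x 0 * geom_im l L x 0)
              (U x 0 * geom_re l L x 0 - - V x 0 * geom_im l L x 0))).
      { intros x _; unfold plus; simpl; ring. }
      apply (is_RInt_plus (V := R_NormedModule));
        [|apply (is_RInt_plus (V := R_NormedModule))];
        apply (RInt_correct (V := R_CompleteNormedModule)); assumption. }
    rewrite E; unfold bound.
    apply Rabs_le_between in B1; apply Rabs_le_between in B2.
    apply Rabs_le_between; lra. }
  generalize HUV; intros [P [Q H]].
  assert (Hlim := dirichlet_trapezoid (fun x => U x 0) (fun x => P x 0) k M Hk
    (fun x => cr_dUx _ _ _ _ H x 0 H0)
    (fun x => continuity_2d_pt_slice _ _ _ (cr_P _ _ _ _ H x 0 H0)) (M + N)).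
  replace ((INR (M + N) - INR M + / 2) * k) with B in Hlim
    by (rewrite plus_INR; unfold B; ring).
  fold l A in Hlim.
  assert (Hlim' := is_lim_seq_abs _ _ (is_lim_seq_minus' _ _ _ _ Hlim
                    (is_lim_seq_const (RInt (fun x => U x 0) A B)))).
  exact (is_lim_seq_le _ _ _ _ HL Hlim' (is_lim_seq_const bound)). }
(* Holomorphy is available in the open strip only, so [d = PI / 2] is reached through continuity of
   the bound in [d]. *)
set (phi := fun d => 4 * K * (/ a + / b) * (exp (- (l * d)) / (1 - exp (- (l * d)))) + 2 * d * K * T).
assert (Hr : exp (- (l * (PI / 2))) < 1).
{ rewrite <- exp_0; apply exp_increasing; nra. }
assert (Hphi : continuous phi (PI / 2)).
{ apply (ex_derive_continuous phi); unfold phi; auto_derive; lra. }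
assert (Hfin : Rabs err <= phi (PI / 2)).
{ apply Rnot_lt_le; intros Hlt.
  assert (He : 0 < Rabs err - phi (PI / 2)) by lra.
  destruct (Hphi (fun z => z < Rabs err)) as [e Hee].
  { exists (mkposreal _ He); intros z Hz.
    change (Rabs (z - phi (PI / 2)) < Rabs err - phi (PI / 2)) in Hz.
    apply Rabs_lt_between in Hz; lra. }
  set (d := PI / 2 - Rmin (e / 2) (PI / 4)).
  assert (Hm : 0 < Rmin (e / 2) (PI / 4) <= PI / 4).
  { split; [apply Rmin_glb_lt; [generalize (cond_pos e)|]; lra|apply Rmin_r]. }
  assert (Hde : 0 < d < PI / 2) by (unfold d; lra).
  apply (Rlt_irrefl (Rabs err)), Rle_lt_trans with (1 := Hd d Hde).
  apply Hee; change (Rabs (d - PI / 2) < e).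
  unfold d; replace (PI / 2 - Rmin (e / 2) (PI / 4) - PI / 2) with (- Rmin (e / 2) (PI / 4)) by ring.
  rewrite Rabs_Ropp, Rabs_pos_eq by lra.
  apply Rle_lt_trans with (1 := Rmin_l _ _); generalize (cond_pos e); lra. }
apply Rle_trans with (1 := Hfin); unfold phi.
set (X := PI ^ 2 / (2 * k)).
assert (HX : 0 < X) by (apply Rdiv_lt_0_compat; [apply pow_lt|]; lra).
replace (l * (PI / 2)) with (2 * X) in * by (unfold l, X; field; lra).
(* The hyperbolic sine of the statement is the sum of the geometric series of the damping factors of
   all frequencies. *)
assert (Hsinh : exp (- (2 * X)) / (1 - exp (- (2 * X))) = / 2 * (/ sinh X * exp (- X))).
{ unfold sinh; replace (- (2 * X)) with (- X + - X) in * by ring.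
  rewrite exp_plus in *; rewrite exp_Ropp in *.
  assert (1 < exp X) by (rewrite <- exp_0; apply exp_increasing; exact HX).
  field; repeat split; nra. }
rewrite Hsinh, (Rmult_plus_distr_l K); apply Rplus_le_compat; [right; set (c := / a + / b); set (S := / sinh X * exp (- X)); field|].
replace (2 * (PI / 2) * K * T) with (K * (PI * T)) by field.
apply Rmult_le_compat_l; [exact HK|]; apply Rmult_le_compat_l; [lra|].
unfold T; apply Rplus_le_compat; left; apply exp_increasing; nra.
Qed.

(** * Integrals over the line of exponentially decaying functions *)

Lemma exp_le (x y : R) : x <= y -> exp x <= exp y.
Proof.
intros [H|H]; [left; apply exp_increasing, H|right; now rewrite H].
Qed.

Lemma exp_eventually_small (K a eps : R) : 0 <= K -> 0 < a -> 0 < eps ->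
  exists B, 0 < B /\ forall x, B <= x -> K * exp (- (a * x)) < eps.
Proof.
intros HK Ha He; exists ((K + 1) / (a * eps)).
assert (Hae : 0 < a * eps) by (apply Rmult_lt_0_compat; lra).
split; [apply Rdiv_lt_0_compat; lra|]; intros x Hx.
assert (Hx' : K + 1 <= x * (a * eps)).
{ apply (Rmult_le_compat_r (a * eps)) in Hx; [|lra].
  replace ((K + 1) / (a * eps) * (a * eps)) with (K + 1) in Hx by (field; lra); exact Hx. }
assert (H1 := exp_ineq1_le (a * x)).
assert (Hp := exp_pos (a * x)).
rewrite exp_Ropp; apply Rmult_lt_reg_r with (exp (a * x)); [exact Hp|].
rewrite Rmult_assoc, Rinv_l, Rmult_1_r by lra; nra.
Qed.

Lemma minus_plus_middle {G : AbelianGroup} (x y z : G) :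
  minus (plus x (plus y z)) y = plus x z.
Proof.
unfold minus; rewrite (plus_comm y z), <- plus_assoc, <- plus_assoc; f_equal.
transitivity (plus z zero); [f_equal; apply plus_opp_r|apply plus_zero_r].
Qed.

Lemma norm_minus_trans {K : AbsRing} {V : CompleteNormedModule K} (x y z : V) :
  norm (minus x z) <= norm (minus x y) + norm (minus y z).
Proof. rewrite (minus_trans y x z); exact (norm_triangle (minus x y) (minus y z)). Qed.

Lemma norm_minus_sym {K : AbsRing} {V : CompleteNormedModule K} (x y : V) :
  norm (minus x y) = norm (minus y x).
Proof. rewrite <- (opp_minus y x); exact (norm_opp (minus y x)). Qed.

Section LineIntegral.

Context {V : CompleteNormedModule R_AbsRing}.

(** The two sides have separate constants: in [error_in_domain] only the left one carries the factor
    [1 / (1 + exp x)], and the gain there comes from this asymmetry. *)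
Record decaying (F : R -> V) (K1 K2 a b : R) : Prop := {
  decay_a : 0 < a;
  decay_b : 0 < b;
  decay_K1 : 0 <= K1;
  decay_K2 : 0 <= K2;
  decay_cont : forall x, continuous F x;
  decay_left : forall x, norm (F x) <= K1 * exp (a * x);
  decay_right : forall x, norm (F x) <= K2 * exp (- (b * x))
}.

Definition line (F : R -> V) : V :=
  RInt_gen F (Rbar_locally m_infty) (Rbar_locally p_infty).

Lemma decaying_ex_RInt (F : R -> V) (K1 K2 a b p q : R) :
  decaying F K1 K2 a b -> ex_RInt F p q.
Proof.
intros H; apply (ex_RInt_continuous (V := V)); intros; apply (decay_cont _ _ _ _ _ H).
Qed.

Lemma decaying_left_tail (F : R -> V) (K1 K2 a b p q x : R) :
  decaying F K1 K2 a b -> p <= x -> q <= x ->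
  norm (RInt F p q) <= K1 / a * exp (a * x).
Proof.
intros [].
assert (Hw : forall p q, p <= q -> q <= x -> norm (RInt F p q) <= K1 / a * exp (a * x)).
{ intros p0 q0 Hpq Hq.
  apply Rle_trans with (K1 / a * exp (a * q0)).
  - apply norm_RInt_exp_left; auto.
  - apply Rmult_le_compat_l; [apply Rdiv_le_0_compat; lra|].
    destruct (Req_dec q0 x) as [->|]; [right; reflexivity|].
    left; apply exp_increasing, Rmult_lt_compat_l; lra. }
intros Hp Hq; destruct (Rle_dec p q) as [H|H]; [apply Hw; assumption|].
rewrite <- (opp_RInt_swap (V := V)).
- rewrite (norm_opp (V := V)); apply Hw; lra.
- apply (ex_RInt_continuous (V := V)); auto.
Qed.

Lemma decaying_right_tail (F : R -> V) (K1 K2 a b p q x : R) :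
  decaying F K1 K2 a b -> x <= p -> x <= q ->
  norm (RInt F p q) <= K2 / b * exp (- (b * x)).
Proof.
intros [].
assert (Hw : forall p q, p <= q -> x <= p -> norm (RInt F p q) <= K2 / b * exp (- (b * x))).
{ intros p0 q0 Hpq Hq.
  apply Rle_trans with (K2 / b * exp (- (b * p0))).
  - apply norm_RInt_exp_right; auto.
  - apply Rmult_le_compat_l; [apply Rdiv_le_0_compat; lra|].
    destruct (Req_dec p0 x) as [->|]; [right; reflexivity|].
    left; apply exp_increasing, Ropp_lt_contravar, Rmult_lt_compat_l; lra. }
intros Hp Hq; destruct (Rle_dec p q) as [H|H]; [apply Hw; assumption|].
rewrite <- (opp_RInt_swap (V := V)).
- rewrite (norm_opp (V := V)); apply Hw; lra.
- apply (ex_RInt_continuous (V := V)); auto.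
Qed.

Lemma decaying_RInt_diff (F : R -> V) (K1 K2 a b p q p' q' X Y : R) :
  decaying F K1 K2 a b -> p <= X -> p' <= X -> Y <= q -> Y <= q' ->
  norm (minus (RInt F p q) (RInt F p' q')) <= K1 / a * exp (a * X) + K2 / b * exp (- (b * Y)).
Proof.
intros H Hp Hp' Hq Hq'.
assert (E : minus (RInt F p q) (RInt F p' q') = plus (RInt F p p') (RInt F q' q)).
{ rewrite <- (RInt_Chasles (V := V) F p p' q), <- (RInt_Chasles (V := V) F p' q' q);
    try (apply decaying_ex_RInt with K1 K2 a b; exact H).
  exact (minus_plus_middle (RInt F p p') (RInt F p' q') (RInt F q' q)). }
rewrite E; eapply Rle_trans; [apply (norm_triangle (V := V))|]; apply Rplus_le_compat.
- now apply decaying_left_tail with K2 b.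
- now apply decaying_right_tail with K1 a.
Qed.

Lemma decaying_uniform_tail (F : R -> V) (K1 K2 a b eps : R) :
  decaying F K1 K2 a b -> 0 < eps ->
  exists B, 0 < B /\ forall p q p' q', p <= - B -> p' <= - B -> B <= q -> B <= q' ->
    norm (minus (RInt F p q) (RInt F p' q')) < eps.
Proof.
intros H He; assert (H' := H); destruct H'.
destruct (exp_eventually_small (K1 / a) a (eps / 2)) as [B1 [HB1 H1]]; try lra.
{ apply Rdiv_le_0_compat; lra. }
destruct (exp_eventually_small (K2 / b) b (eps / 2)) as [B2 [HB2 H2]]; try lra.
{ apply Rdiv_le_0_compat; lra. }
exists (Rmax B1 B2); split; [apply Rlt_le_trans with (2 := Rmax_l _ _); exact HB1|].
intros p q p' q' Hp Hp' Hq Hq'.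
eapply Rle_lt_trans; [apply decaying_RInt_diff with (X := - Rmax B1 B2) (Y := Rmax B1 B2); eauto|].
assert (E1 := H1 _ (Rmax_l B1 B2)); assert (E2 := H2 _ (Rmax_r B1 B2)).
replace (a * - Rmax B1 B2) with (- (a * Rmax B1 B2)) by ring; lra.
Qed.

Lemma decaying_is_line (F : R -> V) (K1 K2 a b : R) :
  decaying F K1 K2 a b ->
  is_RInt_gen F (Rbar_locally m_infty) (Rbar_locally p_infty) (line F).
Proof.
intros H; apply (RInt_gen_correct (V := V)).
assert (Hf : exists y, filterlim (fun pq => RInt F (fst pq) (snd pq))
           (filter_prod (Rbar_locally m_infty) (Rbar_locally p_infty)) (locally y)).
{ apply (filterlim_locally_cauchy (U := V)); intros eps.
  destruct (decaying_uniform_tail F K1 K2 a b eps H (cond_pos eps)) as [B [_ HB]].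
  exists (fun pq => fst pq < - B /\ B < snd pq); split.
  - apply Filter_prod with (fun p => p < - B) (fun q => B < q); [exists (- B); auto|exists B; auto|].
    intros; split; assumption.
  - intros [p q] [p' q'] [Hp Hq] [Hp' Hq']; simpl in *.
    apply (norm_compat1 (V := V)), HB; lra. }
destruct Hf as [y Hy]; exists y; unfold is_RInt_gen.
apply filterlimi_lim_ext with (2 := Hy); intros [p q]; simpl.
apply (RInt_correct (V := V)); apply decaying_ex_RInt with K1 K2 a b; exact H.
Qed.

Lemma line_approx (F : R -> V) (K1 K2 a b eps : R) :
  decaying F K1 K2 a b -> 0 < eps ->
  exists B, 0 < B /\ forall p q, p <= - B -> B <= q -> norm (minus (line F) (RInt F p q)) < eps.
Proof.
intros H He.
destruct (decaying_uniform_tail F K1 K2 a b (eps / 2) H ltac:(lra)) as [B [HB0 HB]].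
exists B; split; [exact HB0|]; intros p q Hp Hq.
assert (Hl := decaying_is_line F K1 K2 a b H).
destruct (Hl _ (locally_ball_norm (V := V) (line F) (mkposreal (eps / 2) ltac:(lra))))
  as [Q1 Q2 [P1 HP1] [P2 HP2] HQ].
(* End points far enough for both the Cauchy estimate and the convergence to [line F], so that the
   integral over [[p', q']] links the two. *)
set (p' := Rmin p (P1 - 1)); set (q' := Rmax q (P2 + 1)).
destruct (HQ p' q') as [y [Hy Hb]].
{ apply HP1; apply Rle_lt_trans with (1 := Rmin_r _ _); lra. }
{ apply HP2; apply Rlt_le_trans with (2 := Rmax_r _ _); lra. }
simpl in Hy; apply is_RInt_unique in Hy; rewrite <- Hy in Hb.
apply ball_norm_sym in Hb; unfold ball_norm in Hb; simpl in Hb.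
assert (H1 : norm (minus (RInt F p' q') (RInt F p q)) < eps / 2).
{ apply HB; auto.
  - apply Rle_trans with (1 := Rmin_l _ _); exact Hp.
  - apply Rle_trans with (2 := Rmax_l _ _); exact Hq. }
assert (H2 := norm_minus_trans (line F) (RInt F p' q') (RInt F p q)).
change (norm (minus (line F) (RInt F p' q')) < eps / 2) in Hb.
apply Rle_lt_trans with (1 := H2); lra.
Qed.

Lemma line_truncation (F : R -> V) (K1 K2 a b A B : R) :
  decaying F K1 K2 a b ->
  norm (minus (line F) (RInt F A B)) <= K1 / a * exp (a * A) + K2 / b * exp (- (b * B)).
Proof.
intros H; apply Rnot_lt_le; intros Hlt.
set (bd := K1 / a * exp (a * A) + K2 / b * exp (- (b * B))) in *.
destruct (line_approx F K1 K2 a b (norm (minus (line F) (RInt F A B)) - bd) H ltac:(lra))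
  as [C [_ HC]].
set (p := Rmin A (- C)); set (q := Rmax B C).
assert (H1 := HC p q (Rmin_r _ _) (Rmax_r _ _)).
assert (H2 := decaying_RInt_diff F K1 K2 a b p q A B A B H (Rmin_l _ _) (Rle_refl _)
                (Rmax_l _ _) (Rle_refl _)).
fold bd in H2.
assert (H3 := norm_minus_trans (line F) (RInt F p q) (RInt F A B)).
lra.
Qed.

(** Truncation at [A = B = x0] leaves an empty interval. The point [x0] is free and serves to
    balance the two exponentials. *)
Lemma norm_line_le (F : R -> V) (K1 K2 a b x0 : R) :
  decaying F K1 K2 a b ->
  norm (line F) <= K1 / a * exp (a * x0) + K2 / b * exp (- (b * x0)).
Proof.
intros H; assert (H1 := line_truncation F K1 K2 a b x0 x0 H).
rewrite (RInt_point (V := V)) in H1.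
apply Rle_trans with (2 := H1); right; f_equal; symmetry.
exact (minus_zero_r (line F)).
Qed.

(** Decay already guarantees that the improper integral exists, so convergence along symmetric
    intervals is enough to identify it. *)
Lemma line_unique (F : R -> V) (K1 K2 a b : R) (l : V) :
  decaying F K1 K2 a b ->
  (forall eps, 0 < eps -> exists B, forall x, B <= x -> norm (minus (RInt F (- x) x) l) < eps) ->
  line F = l.
Proof.
intros H Hl; apply (ball_norm_eq (V := V)); intros eps; unfold ball_norm.
assert (He := cond_pos eps).
destruct (line_approx F K1 K2 a b (eps / 2) H ltac:(lra)) as [B1 [_ H1]].
destruct (Hl (eps / 2) ltac:(lra)) as [B2 H2].
set (x := Rmax B1 B2).
assert (E1 : norm (minus (line F) (RInt F (- x) x)) < eps / 2).
{ apply H1; [apply Ropp_le_contravar|]; apply Rmax_l. }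
assert (E2 := H2 x (Rmax_r _ _)).
assert (H3 := norm_minus_trans (line F) (RInt F (- x) x) l).
change (norm (minus l (line F)) < eps).
rewrite norm_minus_sym; apply Rle_lt_trans with (1 := H3); lra.
Qed.

Lemma line_ext (F G : R -> V) (K1 K2 a b : R) :
  decaying F K1 K2 a b -> (forall x, F x = G x) -> line F = line G.
Proof.
intros H E; apply (RInt_gen_ext_eq (V := V)); [exact E|].
exists (line F); apply decaying_is_line with K1 K2 a b; exact H.
Qed.

Lemma line_minus (F G : R -> V) (K1 K2 a b K1' K2' a' b' : R) :
  decaying F K1 K2 a b -> decaying G K1' K2' a' b' ->
  line (fun x => minus (F x) (G x)) = minus (line F) (line G).
Proof.
intros HF HG; apply (is_RInt_gen_unique (V := V)), (is_RInt_gen_minus (V := V)).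
- apply decaying_is_line with K1 K2 a b; exact HF.
- apply decaying_is_line with K1' K2' a' b'; exact HG.
Qed.

Lemma line_scal (F : R -> V) (c K1 K2 a b : R) :
  decaying F K1 K2 a b -> line (fun x => scal c (F x)) = scal c (line F).
Proof.
intros HF; apply (is_RInt_gen_unique (V := V)), (is_RInt_gen_scal (V := V)).
apply decaying_is_line with K1 K2 a b; exact HF.
Qed.

Lemma decaying_translate (F : R -> V) (K1 K2 a b w : R) :
  decaying F K1 K2 a b ->
  decaying (fun x => F (x + w)) (K1 * exp (a * w)) (K2 * exp (- (b * w))) a b.
Proof.
intros []; split; auto.
- apply Rmult_le_pos; [|left; apply exp_pos]; assumption.
- apply Rmult_le_pos; [|left; apply exp_pos]; assumption.
- intros x; apply (continuous_comp (fun x => x + w) F); [|auto].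
  apply (ex_derive_continuous (fun x => x + w)); auto_derive; exact I.
- intros x; rewrite Rmult_assoc, <- exp_plus.
  replace (a * w + a * x) with (a * (x + w)) by ring; auto.
- intros x; rewrite Rmult_assoc, <- exp_plus.
  replace (- (b * w) + - (b * x)) with (- (b * (x + w))) by ring; auto.
Qed.

Lemma RInt_translate (F : R -> V) (w p q : R) : ex_RInt F (p + w) (q + w) ->
  RInt (fun x => F (x + w)) p q = RInt F (p + w) (q + w).
Proof.
intros H.
assert (E := RInt_comp_lin (V := V) F 1 w p q); rewrite !Rmult_1_l in E.
rewrite <- (E H); apply (RInt_ext (V := V)); intros x _; rewrite Rmult_1_l.
symmetry; apply (scal_one (V := V)).
Qed.

Lemma line_translate (F : R -> V) (K1 K2 a b w : R) :
  decaying F K1 K2 a b -> line (fun x => F (x + w)) = line F.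
Proof.
intros H.
apply line_unique with (1 := decaying_translate F K1 K2 a b w H); intros eps He.
destruct (line_approx F K1 K2 a b eps H He) as [B [_ HB]].
exists (B + Rabs w); intros x Hx.
rewrite RInt_translate by (apply decaying_ex_RInt with K1 K2 a b; exact H).
rewrite norm_minus_sym.
assert (Hw := Rle_abs w); assert (Hw' := Rle_abs (- w)); rewrite Rabs_Ropp in Hw'.
apply HB; lra.
Qed.

Lemma is_RInt_gen_exp_subst (G : R -> V) (K1 K2 a b : R) :
  (forall mu, 0 < mu -> continuous G mu) ->
  decaying (fun y => scal (exp y) (G (exp y))) K1 K2 a b ->
  is_RInt_gen G (at_right 0) (Rbar_locally p_infty) (line (fun y => scal (exp y) (G (exp y)))).
Proof.
intros HG H; set (F := fun y => scal (exp y) (G (exp y))) in *.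
assert (HI : forall p q, 0 < p -> 0 < q -> is_RInt G p q (RInt F (ln p) (ln q))).
{ intros p q Hp Hq.
  replace (RInt F (ln p) (ln q)) with (RInt G p q).
  - apply (RInt_correct (V := V)), (ex_RInt_continuous (V := V)); intros z Hz; apply HG.
    apply Rlt_le_trans with (2 := proj1 Hz); apply Rmin_glb_lt; assumption.
  - symmetry; apply (is_RInt_unique (V := V)).
    rewrite <- (exp_ln p Hp) at 2; rewrite <- (exp_ln q Hq) at 2.
    apply (is_RInt_comp (V := V) G exp exp).
    + intros x _; apply HG, exp_pos.
    + intros x _; split; [apply is_derive_Reals, derivable_pt_lim_exp|].
      apply (ex_derive_continuous exp); exists (exp x); apply is_derive_Reals, derivable_pt_lim_exp. }
unfold is_RInt_gen.
apply (filterlimi_locally (U := V)); intros eps.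
destruct (line_approx F K1 K2 a b eps H (cond_pos eps)) as [B [_ HB]].
apply Filter_prod with (fun p => 0 < p < exp (- B)) (fun q => exp B < q).
- exists (mkposreal _ (exp_pos (- B))); intros p Hp Hp0; split; [exact Hp0|].
  change (Rabs (p - 0) < exp (- B)) in Hp; rewrite Rminus_0_r in Hp.
  apply Rle_lt_trans with (1 := Rle_abs p); exact Hp.
- exists (exp B); auto.
- intros p q Hp Hq; simpl; exists (RInt F (ln p) (ln q)); split.
  + apply HI; [apply Hp|apply Rlt_trans with (2 := Hq), exp_pos].
  + apply (norm_compat1 (V := V)).
    change (norm (minus (RInt F (ln p) (ln q)) (line F)) < eps).
    rewrite norm_minus_sym; apply HB.
    * rewrite <- (ln_exp (- B)); left; apply ln_increasing; apply Hp.
    * rewrite <- (ln_exp B); left; apply ln_increasing; [apply exp_pos|exact Hq].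
Qed.

End LineIntegral.

Notation rline := (line (V := R_CompleteNormedModule)).
Notation rdecaying := (decaying (V := R_CompleteNormedModule)).

(** A linear map commutes with Riemann sums, and continuity carries this to their limit. *)
Lemma is_RInt_linear {V W : NormedModule R_AbsRing} (L : V -> W) (F : R -> V) (p q : R) (l : V) :
  is_linear L -> is_RInt F p q l -> is_RInt (fun x => L (F x)) p q (L l).
Proof.
intros HL H; unfold is_RInt.
apply filterlim_ext with (fun ptd => L (scal (sign (q - p)) (Riemann_sum F ptd))).
- intros ptd; rewrite (linear_scal L HL); f_equal.
  apply SF_cons_ind with (s := ptd).
  + intros x; symmetry; unfold Riemann_sum; simpl; apply eq_sym, (linear_zero L HL).
  + intros h s IH; rewrite !Riemann_sum_cons, (linear_plus L HL), (linear_scal L HL), IH; reflexivity.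
- apply filterlim_comp with (1 := H); apply (linear_cont L l HL).
Qed.

Lemma decaying_linear {V W : CompleteNormedModule R_AbsRing} (L : V -> W) (F : R -> V)
  (c K1 K2 a b : R) :
  is_linear L -> 0 <= c -> (forall x, norm (L x) <= c * norm x) ->
  decaying F K1 K2 a b -> decaying (fun x => L (F x)) (c * K1) (c * K2) a b.
Proof.
intros HL Hc HLc []; split; auto.
- apply Rmult_le_pos; assumption.
- apply Rmult_le_pos; assumption.
- intros x; apply (continuous_comp F L); [auto|apply (linear_cont L _ HL)].
- intros x; apply Rle_trans with (1 := HLc _); rewrite Rmult_assoc.
  apply Rmult_le_compat_l; auto.
- intros x; apply Rle_trans with (1 := HLc _); rewrite Rmult_assoc.
  apply Rmult_le_compat_l; auto.
Qed.

Lemma line_linear {V W : CompleteNormedModule R_AbsRing} (L : V -> W) (F : R -> V)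
  (K1 K2 a b : R) :
  is_linear L -> decaying F K1 K2 a b -> line (fun x => L (F x)) = L (line F).
Proof.
intros HL H; destruct (linear_norm L HL) as [c [Hc HLc]].
apply line_unique with (1 := decaying_linear L F c K1 K2 a b HL (Rlt_le _ _ Hc) HLc H).
intros eps He.
destruct (line_approx F K1 K2 a b (eps / c) H) as [B [_ HB]].
{ apply Rdiv_lt_0_compat; assumption. }
exists B; intros x Hx.
rewrite (is_RInt_unique (V := W) _ _ _ (L (RInt F (- x) x))).
- rewrite <- (linear_minus L _ _ HL).
  apply Rle_lt_trans with (1 := HLc _).
  change (c * norm (minus (RInt F (- x) x) (line F)) < eps); rewrite norm_minus_sym.
  assert (Hx' : norm (minus (line F) (RInt F (- x) x)) < eps / c) by (apply HB; lra).
  apply (Rmult_lt_compat_l c) in Hx'; [|exact Hc].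
  replace (c * (eps / c)) with eps in Hx' by (field; lra); exact Hx'.
- apply (is_RInt_linear L F _ _ _ HL), (RInt_correct (V := V)).
  apply decaying_ex_RInt with K1 K2 a b; exact H.
Qed.

(** * Fubini's theorem *)

Lemma ex_RInt_slice1 (phi : R -> R -> R) (y a b : R) :
  (forall x y, continuity_2d_pt phi x y) -> ex_RInt (fun x => phi x y) a b.
Proof.
intros H; apply (ex_RInt_continuous (V := R_CompleteNormedModule)); intros x _.
apply continuity_2d_pt_slice, H.
Qed.

Lemma continuous_RInt_param (phi : R -> R -> R) (a b y : R) :
  (forall x y, continuity_2d_pt phi x y) ->
  continuous (fun y => RInt (fun x => phi x y) a b) y.
Proof.
intros H; apply continuity_pt_filterlim; intros eps Heps.
set (m := Rmin a b); set (M := Rmax a b).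
assert (HmM : m <= M) by (apply Rle_trans with a; [apply Rmin_l|apply Rmax_l]).
(* The [+ 1] keeps the denominator positive when [a = b]. *)
assert (He : 0 < eps / (2 * (M - m + 1))) by (apply Rdiv_lt_0_compat; lra).
destruct (uniform_continuity_2d_1d phi m M y (fun x _ => H x y) (mkposreal _ He)) as [d Hd].
exists d; split; [apply cond_pos|]; intros v [_ Hv]; simpl in Hv |- *; unfold R_dist in *.
assert (I1 : forall y p q, ex_RInt (fun x => phi x y) p q) by (intros; now apply ex_RInt_slice1).
assert (Hw : Rabs (RInt (fun x => minus (phi x v) (phi x y)) m M) <= (M - m) * (eps / (2 * (M - m + 1)))).
{ apply abs_RInt_le_const; [exact HmM| |].
  - apply (ex_RInt_minus (V := R_NormedModule)); apply I1.
  - intros x Hx; left.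
    assert (Hd0 := cond_pos d); apply Rabs_lt_between in Hv.
    apply (Hd x y x v); try (simpl; lra); rewrite ?Rminus_diag_eq, ?Rabs_R0; simpl; auto. }
rewrite (RInt_minus (V := R_CompleteNormedModule)) in Hw by apply I1.
assert (Hs : forall z, Rabs (RInt (fun x => phi x v) a b - RInt (fun x => phi x z) a b)
             = Rabs (RInt (fun x => phi x v) m M - RInt (fun x => phi x z) m M)).
{ intros z; unfold m, M, Rmin, Rmax; destruct (Rle_dec a b); [reflexivity|].
  rewrite <- (opp_RInt_swap (fun x => phi x v)), <- (opp_RInt_swap (fun x => phi x z)) by apply I1.
  unfold opp; simpl; rewrite <- Rabs_Ropp; f_equal; ring. }
rewrite Hs; apply Rle_lt_trans with (1 := Hw).
apply Rle_lt_trans with (eps / 2); [|lra].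
apply Rmult_le_reg_r with (2 * (M - m + 1)); [lra|].
replace ((M - m) * (eps / (2 * (M - m + 1))) * (2 * (M - m + 1))) with ((M - m) * eps) by (field; lra).
replace (eps / 2 * (2 * (M - m + 1))) with ((M - m) * eps + eps) by field; lra.
Qed.

(** As functions of the upper limit [b] both iterated integrals have the same derivative, and both
    vanish at [b = a]. *)
Lemma fubini_rectangle (phi : R -> R -> R) (a b c d : R) :
  (forall x y, continuity_2d_pt phi x y) ->
  RInt (fun x => RInt (fun y => phi x y) c d) a b = RInt (fun y => RInt (fun x => phi x y) a b) c d.
Proof.
intros H.
assert (H' : forall x y, continuity_2d_pt (fun y x => phi x y) x y).
{ intros x y; apply (continuity_2d_pt_swap phi), H. }
set (Psi := fun t => RInt (fun y => RInt (fun x => phi x y) a t) c d).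
assert (HD : forall t y, is_derive (fun t => RInt (fun x => phi x y) a t) t (phi t y)).
{ intros t y; apply (is_derive_RInt (V := R_NormedModule) (fun x => phi x y) _ a).
  - apply filter_forall; intros z; apply (RInt_correct (V := R_CompleteNormedModule)).
    now apply ex_RInt_slice1.
  - apply continuity_2d_pt_slice, H. }
assert (HPsi : forall t, is_derive Psi t (RInt (fun y => phi t y) c d)).
{ intros t; eapply is_derive_eq.
  - apply (is_derive_RInt_param (fun t y => RInt (fun x => phi x y) a t) c d t).
    + apply filter_forall; intros z y _; exists (phi z y); apply HD.
    + intros y _; apply continuity_2d_pt_ext with phi; [|apply H].
      intros u v; symmetry; apply is_derive_unique, HD.
    + apply filter_forall; intros z.
      apply (ex_RInt_continuous (V := R_CompleteNormedModule)); intros y _.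
      now apply continuous_RInt_param.
  - apply RInt_ext; intros y _; apply is_derive_unique, HD. }
apply is_RInt_unique.
replace (RInt (fun y => RInt (fun x => phi x y) a b) c d) with (minus (Psi b) (Psi a)).
- apply (is_RInt_derive (V := R_CompleteNormedModule) Psi).
  + intros t _; apply HPsi.
  + intros t _; apply (continuous_RInt_param (fun y x => phi x y)), H'.
- unfold Psi at 2; rewrite (RInt_ext _ (fun _ => 0)).
  + rewrite (RInt_const (V := R_CompleteNormedModule)); unfold minus, plus, opp, scal; simpl.
    unfold mult; simpl; unfold Psi; ring.
  + intros y _; apply (RInt_point (V := R_CompleteNormedModule)).
Qed.

Lemma exp_neg_abs_le (e x : R) : 0 <= e ->
  exp (- (e * Rabs x)) <= exp (e * x) /\ exp (- (e * Rabs x)) <= exp (- (e * x)).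
Proof.
intros He; assert (H1 := Rle_abs x); assert (H2 := Rle_abs (- x)); rewrite Rabs_Ropp in H2.
split; apply exp_le; nra.
Qed.

Section Fubini.

Context (phi : R -> R -> R) (K e : R) (He : 0 < e) (HK : 0 <= K).
Context (Hc : forall x y, continuity_2d_pt phi x y).
Context (Hb : forall x y, Rabs (phi x y) <= K * exp (- (e * Rabs x)) * exp (- (e * Rabs y))).

Lemma slice_decaying (x : R) :
  rdecaying (phi x)
    (K * exp (- (e * Rabs x))) (K * exp (- (e * Rabs x))) e e.
Proof.
assert (Hk : 0 <= K * exp (- (e * Rabs x))) by (apply Rmult_le_pos; [|left; apply exp_pos]; lra).
split; auto.
- intros y; exact (continuity_2d_pt_slice (fun y x => phi x y) y x (continuity_2d_pt_swap phi x y (Hc x y))).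
- intros y; apply Rle_trans with (1 := Hb x y), Rmult_le_compat_l; [exact Hk|].
  apply exp_neg_abs_le; lra.
- intros y; apply Rle_trans with (1 := Hb x y), Rmult_le_compat_l; [exact Hk|].
  apply exp_neg_abs_le; lra.
Qed.

Let tail (x X : R) : Rabs (rline (phi x) - RInt (phi x) (- X) X)
  <= 2 * K / e * exp (- (e * X)) * exp (- (e * Rabs x)).
Proof.
assert (H := line_truncation _ _ _ _ _ (- X) X (slice_decaying x)).
change (Rabs (rline (phi x) - RInt (phi x) (- X) X) <= 
  K * exp (- (e * Rabs x)) / e * exp (e * - X) + K * exp (- (e * Rabs x)) / e * exp (- (e * X))) in H.
apply Rle_trans with (1 := H); right.
replace (e * - X) with (- (e * X)) by ring; field; lra.
Qed.

Let partial_continuous (X x : R) : continuous (fun x => RInt (phi x) (- X) X) x.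
Proof.
apply (continuous_RInt_param (fun y x => phi x y)).
intros u v; apply (continuity_2d_pt_swap phi), Hc.
Qed.

Lemma line_slice_continuous (x : R) :
  continuous (fun x => rline (phi x)) x.
Proof.
apply continuity_pt_filterlim; intros eps Heps.
destruct (exp_eventually_small (2 * K / e) e (eps / 3)) as [B [HB HBe]]; try lra.
{ apply Rdiv_le_0_compat; lra. }
assert (Hu : forall z, Rabs (rline (phi z) - RInt (phi z) (- B) B) < eps / 3).
{ intros z; apply Rle_lt_trans with (1 := tail z B).
  apply Rle_lt_trans with (2 := HBe B (Rle_refl B)).
  rewrite <- (Rmult_1_r (2 * K / e * exp (- (e * B)))) at 2.
  apply Rmult_le_compat_l.
  - apply Rmult_le_pos; [apply Rdiv_le_0_compat; lra|left; apply exp_pos].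
  - rewrite <- exp_0; apply exp_le; generalize (Rabs_pos z); nra. }
assert (Hp := partial_continuous B x); apply continuity_pt_filterlim in Hp.
destruct (Hp (eps / 3) ltac:(lra)) as [d [Hd Hdd]].
exists d; split; [exact Hd|]; intros z Hz; specialize (Hdd z Hz).
simpl in Hdd |- *; unfold R_dist in *.
assert (H1 := Hu z); assert (H2 := Hu x).
apply Rabs_lt_between in H1; apply Rabs_lt_between in H2; apply Rabs_lt_between in Hdd.
apply Rabs_lt_between; lra.
Qed.

Lemma line_slice_decaying :
  rdecaying (fun x => rline (phi x))
    (2 * K / e) (2 * K / e) e e.
Proof.
assert (Hk : 0 <= 2 * K / e) by (apply Rdiv_le_0_compat; lra).
assert (H : forall x, Rabs (rline (phi x)) <= 2 * K / e * exp (- (e * Rabs x))).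
{ intros x; apply Rle_trans with (1 := norm_line_le _ _ _ _ _ 0 (slice_decaying x)).
  rewrite Rmult_0_r, Ropp_0, exp_0; right; field; lra. }
split; auto.
- exact line_slice_continuous.
- intros x; apply Rle_trans with (1 := H x), Rmult_le_compat_l; [exact Hk|].
  apply exp_neg_abs_le; lra.
- intros x; apply Rle_trans with (1 := H x), Rmult_le_compat_l; [exact Hk|].
  apply exp_neg_abs_le; lra.
Qed.

(** Truncating the inner integral and truncating the outer one each cost [4 K / e ^ 2] times
    [exp (- (e X))]. *)
Lemma line_slice_square (X : R) : 0 <= X ->
  Rabs (rline (fun x => rline (phi x))
        - RInt (fun x => RInt (phi x) (- X) X) (- X) X) <= 8 * K / e ^ 2 * exp (- (e * X)).
Proof.
intros HX.
assert (Hk : 0 <= 2 * K / e) by (apply Rdiv_le_0_compat; lra).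
set (G := fun x => minus (rline (phi x)) (RInt (phi x) (- X) X)).
assert (Hke : 0 <= 2 * K / e * exp (- (e * X))).
{ apply Rmult_le_pos; [exact Hk|left; apply exp_pos]. }
assert (H1 : Rabs (RInt G (- X) X) <= 2 * K / e * exp (- (e * X)) / e * exp (e * 0)
                                  + 2 * K / e * exp (- (e * X)) / e * exp (- (e * 0))).
{ apply (norm_RInt_exp_split (V := R_CompleteNormedModule) G); auto; try lra.
  - intros x; apply (continuous_minus (V := R_NormedModule)).
    + apply line_slice_continuous.
    + apply partial_continuous.
  - intros x; apply Rle_trans with (1 := tail x X), Rmult_le_compat_l; [exact Hke|].
    apply exp_neg_abs_le; lra.
  - intros x; apply Rle_trans with (1 := tail x X), Rmult_le_compat_l; [exact Hke|].
    apply exp_neg_abs_le; lra. }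
rewrite Rmult_0_r, Ropp_0, exp_0 in H1.
unfold G in H1; rewrite (RInt_minus (V := R_CompleteNormedModule)) in H1.
2: apply (ex_RInt_continuous (V := R_CompleteNormedModule)); intros; apply line_slice_continuous.
2: apply (ex_RInt_continuous (V := R_CompleteNormedModule)); intros; apply partial_continuous.
assert (H2 := line_truncation _ _ _ _ _ (- X) X line_slice_decaying).
change (Rabs (rline (fun x => rline (phi x))
  - RInt (fun x => rline (phi x)) (- X) X)
  <= 2 * K / e / e * exp (e * - X) + 2 * K / e / e * exp (- (e * X))) in H2.
change (Rabs (RInt (fun x => rline (phi x)) (- X) X
  - RInt (fun x => RInt (phi x) (- X) X) (- X) X)
  <= 2 * K / e * exp (- (e * X)) / e * 1 + 2 * K / e * exp (- (e * X)) / e * 1) in H1.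
replace (e * - X) with (- (e * X)) in H2 by ring.
replace (8 * K / e ^ 2 * exp (- (e * X))) with
  ((2 * K / e / e * exp (- (e * X)) + 2 * K / e / e * exp (- (e * X))) +
   (2 * K / e * exp (- (e * X)) / e * 1 + 2 * K / e * exp (- (e * X)) / e * 1)) by (field; lra).
apply Rabs_le_between in H1; apply Rabs_le_between in H2; apply Rabs_le_between; lra.
Qed.

End Fubini.

(** Both orders are compared with one integral over a large square, where the rectangle case
    applies. *)
Lemma fubini_line (phi : R -> R -> R) (K e : R) : 0 < e -> 0 <= K ->
  (forall x y, continuity_2d_pt phi x y) ->
  (forall x y, Rabs (phi x y) <= K * exp (- (e * Rabs x)) * exp (- (e * Rabs y))) ->
  rline (fun x => rline (fun y => phi x y))
  = rline (fun y => rline (fun x => phi x y)).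
Proof.
intros He HK Hc Hb.
assert (Hc' : forall x y, continuity_2d_pt (fun y x => phi x y) x y).
{ intros x y; apply (continuity_2d_pt_swap phi), Hc. }
assert (Hb' : forall y x, Rabs (phi x y) <= K * exp (- (e * Rabs y)) * exp (- (e * Rabs x))).
{ intros y x; apply Rle_trans with (1 := Hb x y); right; ring. }
set (I1 := rline (fun x => rline (fun y => phi x y))).
set (I2 := rline (fun y => rline (fun x => phi x y))).
apply Rminus_diag_uniq; destruct (Req_dec (I1 - I2) 0) as [E|E]; [exact E|exfalso].
apply Rabs_pos_lt in E.
destruct (exp_eventually_small (8 * K / e ^ 2) e (Rabs (I1 - I2) / 2)) as [B [HB HBe]]; try lra.
{ apply Rdiv_le_0_compat; [lra|apply pow_lt, He]. }
assert (H1 := line_slice_square phi K e He HK Hc Hb B ltac:(lra)).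
assert (H2 := line_slice_square (fun y x => phi x y) K e He HK Hc' Hb' B ltac:(lra)).
rewrite <- (fubini_rectangle phi) in H2 by exact Hc.
assert (H3 := HBe B (Rle_refl B)).
change (Rabs (I1 - RInt (fun x => RInt (phi x) (- B) B) (- B) B) <= 8 * K / e ^ 2 * exp (- (e * B))) in H1.
change (Rabs (I2 - RInt (fun x => RInt (phi x) (- B) B) (- B) B) <= 8 * K / e ^ 2 * exp (- (e * B))) in H2.
assert (Rabs (I1 - I2) < Rabs (I1 - I2)); [|lra].
apply Rabs_le_between in H1; apply Rabs_le_between in H2.
apply Rabs_lt_between; lra.
Qed.

(** * Kernels satisfying the resolvent identity *)

Lemma exp_div_le (c x : R) : 0 <= c <= 1 ->
  exp (c * x) / (1 + exp x) <= exp (c * x) /\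
  exp (c * x) / (1 + exp x) <= exp (- ((1 - c) * x)).
Proof.
intros Hc; assert (Hp := exp_pos x); assert (Hq := exp_pos (c * x)).
assert (Hr := exp_pos (- ((1 - c) * x))).
assert (E : exp (- ((1 - c) * x)) * exp x = exp (c * x)).
{ rewrite <- exp_plus; f_equal; ring. }
split; apply Rmult_le_reg_r with (1 + exp x); try lra;
  unfold Rdiv; rewrite Rmult_assoc, Rinv_l by lra; nra.
Qed.

Lemma exp_div_abs_le (c e x : R) : 0 < e -> e <= c -> e <= 1 - c ->
  exp (c * x) / (1 + exp x) <= exp (- (e * Rabs x)).
Proof.
intros He H1 H2; destruct (exp_div_le c x ltac:(lra)) as [L1 L2].
unfold Rabs; destruct (Rcase_abs x).
- apply Rle_trans with (1 := L1), exp_le; nra.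
- apply Rle_trans with (1 := L2), exp_le; nra.
Qed.

Lemma exp_weight_decaying {V : CompleteNormedModule R_AbsRing} (c K : R) (f : R -> V) :
  0 < c < 1 -> 0 <= K -> (forall x, continuous f x) ->
  (forall x, norm (f x) <= K / (1 + exp x)) ->
  decaying (fun x => scal (exp (c * x)) (f x)) K K c (1 - c).
Proof.
intros Hc HK Hf Hb.
assert (H : forall x, norm (scal (exp (c * x)) (f x)) <= K * (exp (c * x) / (1 + exp x))).
{ intros x; eapply Rle_trans; [apply (norm_scal (V := V))|].
  change (abs (exp (c * x))) with (Rabs (exp (c * x))).
  rewrite Rabs_pos_eq by (left; apply exp_pos).
  apply Rle_trans with (exp (c * x) * (K / (1 + exp x))).
  - apply Rmult_le_compat_l; [left; apply exp_pos|apply Hb].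
  - right; unfold Rdiv; ring. }
split; auto; try lra.
- intros x; apply (continuous_scal (V := V)); [|apply Hf].
  apply (ex_derive_continuous (fun x => exp (c * x))); auto_derive; exact I.
- intros x; apply Rle_trans with (1 := H x), Rmult_le_compat_l; [exact HK|].
  apply exp_div_le; lra.
- intros x; apply Rle_trans with (1 := H x), Rmult_le_compat_l; [exact HK|].
  apply exp_div_le; lra.
Qed.

(* Prototype: [phi x y = <R(e^x) R(e^y) f, v>] and [r x = <R(e^x) f, v>] with
   [R] the resolvent; the last field is then the resolvent identity. *)
Record resolvent_kernel (phi : R -> R -> R) (r : R -> R) (K : R) : Prop := {
  rk_pos : 0 <= K;
  rk_cont : forall x y, continuity_2d_pt phi x y;
  rk_bound : forall x y, Rabs (phi x y) <= K / ((1 + exp x) * (1 + exp y));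
  rk_r_cont : forall x, continuous r x;
  rk_r_bound : forall x, Rabs (r x) <= K / (1 + exp x);
  rk_identity : forall x y, phi x y * (exp y - exp x) = r x - r y
}.

Section KernelComparison.

Context (al ga : R) (Hal : 0 < al < 1) (Hga : 0 < ga < 1).

(** The density of [mu^(-al) nu^(-ga) dmu dnu] after the substitution [mu = exp x], [nu = exp y]. *)
Let weighted (phi : R -> R -> R) (x y : R) :=
  exp ((1 - al) * x) * exp ((1 - ga) * y) * phi x y.

(** The halving pays for the shear: decay of rate [2 e] in [x] and [y] becomes decay of rate [e] in
    [x] and [w = y - x]. *)
Let e := Rmin (Rmin al (1 - al)) (Rmin ga (1 - ga)) / 2.

Let e_bounds : 0 < e /\ 2 * e <= al /\ 2 * e <= 1 - al /\ 2 * e <= ga /\ 2 * e <= 1 - ga.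
Proof.
unfold e; repeat split; try (apply Rmult_lt_0_compat; [|lra]; repeat apply Rmin_glb_lt; lra);
  replace (2 * (Rmin (Rmin al (1 - al)) (Rmin ga (1 - ga)) / 2))
    with (Rmin (Rmin al (1 - al)) (Rmin ga (1 - ga))) by field.
- apply Rle_trans with (1 := Rmin_l _ _), Rmin_l.
- apply Rle_trans with (1 := Rmin_l _ _), Rmin_r.
- apply Rle_trans with (1 := Rmin_r _ _), Rmin_l.
- apply Rle_trans with (1 := Rmin_r _ _), Rmin_r.
Qed.

Lemma weighted_bound (phi : R -> R -> R) (r : R -> R) (K x y : R) :
  resolvent_kernel phi r K ->
  Rabs (weighted phi x y) <= K * exp (- (2 * e * Rabs x)) * exp (- (2 * e * Rabs y)).
Proof.
intros H; destruct e_bounds as [He [H1 [H2 [H3 H4]]]].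
assert (Hx := exp_pos x); assert (Hy := exp_pos y).
unfold weighted; rewrite Rabs_mult, (Rabs_pos_eq (exp _ * exp _)).
2: { apply Rmult_le_pos; left; apply exp_pos. }
apply Rle_trans with (exp ((1 - al) * x) * exp ((1 - ga) * y) * (K / ((1 + exp x) * (1 + exp y)))).
{ apply Rmult_le_compat_l; [apply Rmult_le_pos; left; apply exp_pos|apply (rk_bound _ _ _ H)]. }
replace (exp ((1 - al) * x) * exp ((1 - ga) * y) * (K / ((1 + exp x) * (1 + exp y)))) with
  (K * (exp ((1 - al) * x) / (1 + exp x)) * (exp ((1 - ga) * y) / (1 + exp y))) by (field; lra).
assert (B1 := exp_div_abs_le (1 - al) (2 * e) x ltac:(lra) ltac:(lra) ltac:(lra)).
assert (B2 := exp_div_abs_le (1 - ga) (2 * e) y ltac:(lra) ltac:(lra) ltac:(lra)).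
assert (HK := rk_pos _ _ _ H).
assert (P1 : 0 <= exp ((1 - al) * x) / (1 + exp x)).
{ apply Rdiv_le_0_compat; [left; apply exp_pos|lra]. }
assert (P2 : 0 <= exp ((1 - ga) * y) / (1 + exp y)).
{ apply Rdiv_le_0_compat; [left; apply exp_pos|lra]. }
apply Rmult_le_compat; auto.
- apply Rmult_le_pos; assumption.
- apply Rmult_le_compat_l; assumption.
Qed.

(** In the variables [x] and [w = y - x] the factor of the resolvent identity splits as
    [exp x (exp w - 1)]; after integration over [x] only differences of the profile [r] remain. *)
Let sheared (phi : R -> R -> R) (x w : R) := weighted phi x (x + w).

Lemma sheared_bound (phi : R -> R -> R) (r : R -> R) (K x w : R) :
  resolvent_kernel phi r K ->
  Rabs (sheared phi x w) <= K * exp (- (e * Rabs x)) * exp (- (e * Rabs w)).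
Proof.
intros H; destruct e_bounds as [He _].
apply Rle_trans with (1 := weighted_bound phi r K x (x + w) H).
rewrite !Rmult_assoc; apply Rmult_le_compat_l; [apply (rk_pos _ _ _ H)|].
rewrite <- !exp_plus; apply exp_le.
assert (Rabs w <= Rabs x + Rabs (x + w)).
{ replace w with (- x + (x + w)) at 1 by ring.
  apply Rle_trans with (1 := Rabs_triang _ _); rewrite Rabs_Ropp; lra. }
generalize (Rabs_pos x) (Rabs_pos (x + w)); nra.
Qed.

Lemma sheared_continuous (phi : R -> R -> R) (r : R -> R) (K x w : R) :
  resolvent_kernel phi r K -> continuity_2d_pt (sheared phi) x w.
Proof.
intros H; unfold sheared, weighted.
apply continuity_2d_pt_mult; [apply continuity_2d_pt_mult|].
- apply (continuity_2d_pt_comp1 (fun x => exp ((1 - al) * x))), continuity_pt_derive.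
  auto_derive; exact I.
- apply (continuity_1d_2d_pt_comp (fun y => exp ((1 - ga) * y)) (fun x w => x + w)).
  + apply continuity_pt_derive; auto_derive; exact I.
  + apply continuity_2d_pt_plus; [apply continuity_2d_pt_id1|apply continuity_2d_pt_id2].
- intros eps; destruct (rk_cont _ _ _ H x (x + w) eps) as [d Hd].
  exists (mkposreal (d / 2) (is_pos_div_2 d)); simpl; intros u v Hu Hv.
  assert (Hd0 := cond_pos d); apply Hd; [lra|].
  replace (u + v - (x + w)) with ((u - x) + (v - w)) by ring.
  apply Rle_lt_trans with (1 := Rabs_triang _ _); lra.
Qed.

Let inner (phi : R -> R -> R) (w : R) : R := rline (fun x => sheared phi x w).

(** The inner variable is translated by [x], and then the order of integration is exchanged. *)
Lemma double_line_inner (phi : R -> R -> R) (r : R -> R) (K : R) :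
  resolvent_kernel phi r K ->
  rline (fun x => rline (fun y => weighted phi x y)) = rline (inner phi).
Proof.
intros H; destruct e_bounds as [He [H1 [H2 [H3 H4]]]]; assert (HK := rk_pos _ _ _ H).
assert (Hw : forall x, rdecaying (weighted phi x) (K * exp (- (2 * e * Rabs x)))
                         (K * exp (- (2 * e * Rabs x))) (2 * e) (2 * e)).
{ intros x.
  assert (Hk : 0 <= K * exp (- (2 * e * Rabs x))) by (apply Rmult_le_pos; [|left; apply exp_pos]; lra).
  split; auto; try lra.
  - intros y; apply (continuous_mult (fun y => exp ((1 - al) * x) * exp ((1 - ga) * y)) (phi x)).
    + apply (ex_derive_continuous (fun y => exp ((1 - al) * x) * exp ((1 - ga) * y))).
      auto_derive; exact I.
    + exact (continuity_2d_pt_slice (fun y x => phi x y) y x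
               (continuity_2d_pt_swap phi x y (rk_cont _ _ _ H x y))).
  - intros y; apply Rle_trans with (1 := weighted_bound phi r K x y H), Rmult_le_compat_l; [exact Hk|].
    apply exp_neg_abs_le; lra.
  - intros y; apply Rle_trans with (1 := weighted_bound phi r K x y H), Rmult_le_compat_l; [exact Hk|].
    apply exp_neg_abs_le; lra. }
unfold inner.
rewrite <- (fubini_line (sheared phi) K e He HK).
- symmetry; apply line_ext with (2 * K / e) (2 * K / e) e e.
  + apply line_slice_decaying; auto; intros x w.
    * now apply sheared_continuous with r K.
    * now apply sheared_bound with r.
  + intros x; unfold sheared.
    transitivity (rline (fun w => weighted phi x (w + x))).
    2: exact (line_translate (V := R_CompleteNormedModule) (weighted phi x) _ _ _ _ x (Hw x)).
    apply line_ext with (K * exp (- (e * Rabs x))) (K * exp (- (e * Rabs x))) e e.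
    * apply (slice_decaying (sheared phi)); auto; intros u v.
      -- now apply sheared_continuous with r K.
      -- now apply sheared_bound with r.
    * intros w; f_equal; ring.
- intros x w; now apply sheared_continuous with r K.
- intros x w; now apply sheared_bound with r.
Qed.

Lemma inner_decaying (phi : R -> R -> R) (r : R -> R) (K : R) :
  resolvent_kernel phi r K -> rdecaying (inner phi) (2 * K / e) (2 * K / e) e e.
Proof.
intros H; destruct e_bounds as [He _].
apply (line_slice_decaying (fun w x => sheared phi x w)); auto; try apply (rk_pos _ _ _ H); intros w x.
- apply (continuity_2d_pt_swap (sheared phi)); now apply sheared_continuous with r K.
- apply Rle_trans with (1 := sheared_bound phi r K x w H); right; ring.
Qed.

Lemma column_decaying (phi : R -> R -> R) (r : R -> R) (K w : R) :
  resolvent_kernel phi r K ->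
  rdecaying (fun x => sheared phi x w) (K * exp (- (e * Rabs w))) (K * exp (- (e * Rabs w))) e e.
Proof.
intros H; destruct e_bounds as [He _].
apply (slice_decaying (fun w x => sheared phi x w)); auto; try apply (rk_pos _ _ _ H); intros v x.
- apply (continuity_2d_pt_swap (sheared phi)); now apply sheared_continuous with r K.
- apply Rle_trans with (1 := sheared_bound phi r K x v H); right; ring.
Qed.

(** The decay is inherited from [phi] through the resolvent identity. It cannot be read off the two
    terms separately: for [al + ga = 1] neither of them need be integrable. *)
Lemma difference_decaying (phi : R -> R -> R) (r : R -> R) (K w : R) :
  resolvent_kernel phi r K ->
  exists K', rdecaying (fun x => exp ((1 - (al + ga)) * x) * (r x - r (x + w))) K' K' e e.
Proof.
intros H; destruct e_bounds as [He _]; assert (HK := rk_pos _ _ _ H).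
set (c := exp (- ((1 - ga) * w)) * (exp w - 1)).
set (K0 := K * exp (- (e * Rabs w))).
assert (HK0 : 0 <= K0) by (apply Rmult_le_pos; [exact HK|left; apply exp_pos]).
exists (Rabs c * K0).
assert (E : forall x, exp ((1 - (al + ga)) * x) * (r x - r (x + w)) = c * sheared phi x w).
{ intros x; rewrite <- (rk_identity _ _ _ H), exp_plus; unfold c, sheared, weighted.
  replace (exp ((1 - (al + ga)) * x)) with
    (exp (- x) * exp ((1 - al) * x) * exp ((1 - ga) * (x + w)) * exp (- ((1 - ga) * w))).
  2: { rewrite <- !exp_plus; f_equal; ring. }
  rewrite exp_Ropp; field; generalize (exp_pos x); lra. }
assert (D := column_decaying phi r K w H); fold K0 in D.
split; try (apply Rmult_le_pos; [apply Rabs_pos|exact HK0]); try exact He.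
- intros x; apply (continuous_ext (fun x => c * sheared phi x w)).
  { intros z; symmetry; apply E. }
  apply (continuous_mult (fun _ => c) (fun x => sheared phi x w)); [apply continuous_const|apply (decay_cont _ _ _ _ _ D)].
- intros x; rewrite E; apply Rle_trans with (Rabs c * (K0 * exp (e * x))); [|right; ring].
  change (Rabs (c * sheared phi x w) <= Rabs c * (K0 * exp (e * x))).
  rewrite Rabs_mult; apply Rmult_le_compat_l; [apply Rabs_pos|apply (decay_left _ _ _ _ _ D)].
- intros x; rewrite E; apply Rle_trans with (Rabs c * (K0 * exp (- (e * x)))); [|right; ring].
  change (Rabs (c * sheared phi x w) <= Rabs c * (K0 * exp (- (e * x)))).
  rewrite Rabs_mult; apply Rmult_le_compat_l; [apply Rabs_pos|apply (decay_right _ _ _ _ _ D)].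
Qed.

(** The resolvent identity, integrated over [x]. The weights [exp ((1 - al) x)] and
    [exp ((1 - ga) x)], divided by [exp x], leave the exponent [1 - (al + ga)]. *)
Lemma inner_difference (phi : R -> R -> R) (r : R -> R) (K w : R) :
  resolvent_kernel phi r K ->
  (exp w - 1) * inner phi w
  = exp ((1 - ga) * w) * rline (fun x => exp ((1 - (al + ga)) * x) * (r x - r (x + w))).
Proof.
intros H.
destruct (difference_decaying phi r K w H) as [K' D].
assert (E1 := line_scal (V := R_CompleteNormedModule) _ (exp ((1 - ga) * w)) _ _ _ _ D).
assert (E2 := line_scal (V := R_CompleteNormedModule) _ (exp w - 1) _ _ _ _ (column_decaying phi r K w H)).
change ((exp w - 1) * inner phi w) with (scal (exp w - 1) (rline (fun x => sheared phi x w))).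
rewrite <- E2; etransitivity; [|exact E1].
unfold rline; apply (f_equal (fun F => RInt_gen F (Rbar_locally m_infty) (Rbar_locally p_infty))).
apply functional_extensionality; intros x.
unfold scal; simpl; unfold mult; simpl.
rewrite <- (rk_identity _ _ _ H), exp_plus; unfold sheared, weighted.
replace (exp ((1 - (al + ga)) * x)) with
  (exp (- x) * exp ((1 - al) * x) * exp ((1 - ga) * (x + w)) * exp (- ((1 - ga) * w))).
2: { rewrite <- !exp_plus; f_equal; ring. }
rewrite !exp_Ropp; field; generalize (exp_pos x) (exp_pos ((1 - ga) * w)); lra.
Qed.

(** The factor [n w] is common to the two kernels, so their functions [inner] are proportional, with
    ratio given by [L0] and [L1]. An explicit second kernel then replaces the evaluation of the
    integral over [w]. Cross-multiplication avoids dividing by [L0] or [L1]. *)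
Lemma kernel_comparison (n : R -> R) (phi0 phi1 : R -> R -> R) (r0 r1 : R -> R) (K0 K1 L0 L1 : R) :
  resolvent_kernel phi0 r0 K0 -> resolvent_kernel phi1 r1 K1 ->
  (forall w, rline (fun x => exp ((1 - (al + ga)) * x) * (r0 x - r0 (x + w))) = n w * L0) ->
  (forall w, rline (fun x => exp ((1 - (al + ga)) * x) * (r1 x - r1 (x + w))) = n w * L1) ->
  rline (fun x => rline (fun y => exp ((1 - al) * x) * exp ((1 - ga) * y) * phi0 x y)) * L1
  = rline (fun x => rline (fun y => exp ((1 - al) * x) * exp ((1 - ga) * y) * phi1 x y)) * L0.
Proof.
intros H0 H1 N0 N1.
assert (D0 := inner_decaying phi0 r0 K0 H0); assert (D1 := inner_decaying phi1 r1 K1 H1).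
assert (Hne : forall w, w <> 0 -> inner phi0 w * L1 = inner phi1 w * L0).
{ intros w Hw.
  assert (E0 := inner_difference phi0 r0 K0 w H0); rewrite N0 in E0.
  assert (E1 := inner_difference phi1 r1 K1 w H1); rewrite N1 in E1.
  assert (Hw' : exp w - 1 <> 0).
  { intros E; apply Hw; apply exp_inv; rewrite exp_0; lra. }
  apply Rmult_eq_reg_l with (exp w - 1); [|exact Hw'].
  rewrite <- !Rmult_assoc, E0, E1; ring. }
(* [inner] is continuous, which fills in the removable point [w = 0]. *)
assert (Heq : forall w, inner phi0 w * L1 = inner phi1 w * L0).
{ intros w; destruct (Req_dec w 0) as [->|Hw]; [|auto].
  set (g := fun w => inner phi0 w * L1 - inner phi1 w * L0).
  assert (Cg : continuous g 0).
  { apply (continuous_minus (V := R_NormedModule) (fun w => inner phi0 w * L1) (fun w => inner phi1 w * L0)).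
    - apply (continuous_mult (inner phi0) (fun _ => L1)); [apply (decay_cont _ _ _ _ _ D0)|apply continuous_const].
    - apply (continuous_mult (inner phi1) (fun _ => L0)); [apply (decay_cont _ _ _ _ _ D1)|apply continuous_const]. }
  apply Rminus_diag_uniq; change (g 0 = 0).
  destruct (Req_dec (g 0) 0) as [E|E]; [exact E|exfalso].
  destruct (Cg (fun z => z <> 0)) as [d Hd].
  { apply Rabs_pos_lt in E; exists (mkposreal _ E); intros z Hz Hz0.
    change (Rabs (z - g 0) < Rabs (g 0)) in Hz; rewrite Hz0 in Hz.
    rewrite Rminus_0_l, Rabs_Ropp in Hz; lra. }
  assert (Hd0 := cond_pos d).
  apply (Hd (d / 2)).
  - change (Rabs (d / 2 - 0) < d); rewrite Rminus_0_r, Rabs_pos_eq; lra.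
  - apply Rminus_diag_eq, Hne; lra. }
assert (F0 := double_line_inner phi0 r0 K0 H0); assert (F1 := double_line_inner phi1 r1 K1 H1).
unfold weighted in F0, F1; rewrite F0, F1.
assert (S0 := line_scal (V := R_CompleteNormedModule) (inner phi0) L1 _ _ _ _ D0).
assert (S1 := line_scal (V := R_CompleteNormedModule) (inner phi1) L0 _ _ _ _ D1).
rewrite (Rmult_comm _ L1), (Rmult_comm _ L0).
change (scal L1 (rline (inner phi0)) = scal L0 (rline (inner phi1))).
rewrite <- S0, <- S1; unfold line.
apply (f_equal (fun F => RInt_gen F (Rbar_locally m_infty) (Rbar_locally p_infty))).
apply functional_extensionality; intros w.
unfold scal; simpl; unfold mult; simpl; rewrite Rmult_comm, Heq; ring.
Qed.

End KernelComparison.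

(** For [de < 1] both terms are integrable by themselves, and translation of the second one produces
    the factor [exp (- ((1 - de) w))]. *)
Lemma line_power_difference (de K w : R) (r : R -> R) : 0 < de < 1 -> 0 <= K ->
  (forall x, continuous r x) -> (forall x, Rabs (r x) <= K / (1 + exp x)) ->
  rline (fun x => exp ((1 - de) * x) * (r x - r (x + w)))
  = (1 - exp (- ((1 - de) * w))) * rline (fun x => exp ((1 - de) * x) * r x).
Proof.
intros Hde HK Hc Hb.
assert (D := exp_weight_decaying (V := R_CompleteNormedModule) (1 - de) K r ltac:(lra) HK Hc Hb).
assert (Dw := decaying_translate (V := R_CompleteNormedModule) _ _ _ _ _ w D).
assert (T := line_translate (V := R_CompleteNormedModule) _ _ _ _ _ w D).
assert (S : rline (fun x => exp (- ((1 - de) * w)) * (exp ((1 - de) * (x + w)) * r (x + w)))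
            = exp (- ((1 - de) * w)) * rline (fun x => exp ((1 - de) * x) * r x)).
{ etransitivity.
  - exact (line_scal (V := R_CompleteNormedModule) _ (exp (- ((1 - de) * w))) _ _ _ _ Dw).
  - exact (f_equal (Rmult (exp (- ((1 - de) * w)))) T). }
assert (Ds : rdecaying (fun x => scal (exp (- ((1 - de) * w))) (scal (exp ((1 - de) * (x + w))) (r (x + w))))
   (exp (- ((1 - de) * w)) * (K * exp ((1 - de) * w)))
   (exp (- ((1 - de) * w)) * (K * exp (- ((1 - (1 - de)) * w)))) (1 - de) (1 - (1 - de))).
{ apply (decaying_linear (V := R_CompleteNormedModule) (W := R_CompleteNormedModule)
    (fun z => scal (exp (- ((1 - de) * w))) z)); auto.
  - apply (is_linear_scal_r (V := R_NormedModule)); exact Rmult_comm.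
  - left; apply exp_pos.
  - intros x; unfold scal; simpl; unfold mult; simpl.
    change (norm (exp (- ((1 - de) * w)) * x)) with (Rabs (exp (- ((1 - de) * w)) * x)).
    rewrite Rabs_mult, Rabs_pos_eq; [right; reflexivity|left; apply exp_pos]. }
assert (M := line_minus (V := R_CompleteNormedModule) _ _ _ _ _ _ _ _ _ _ D Ds).
etransitivity; [etransitivity; [|exact M]|].
- unfold line; apply (f_equal (fun F => RInt_gen F (Rbar_locally m_infty) (Rbar_locally p_infty))).
  apply functional_extensionality; intros x.
  unfold minus, plus, opp, scal; simpl; unfold mult; simpl.
  rewrite (Rmult_plus_distr_l (1 - de)), exp_plus, exp_Ropp; field.
  generalize (exp_pos ((1 - de) * w)); lra.
- change (rline (fun x => exp ((1 - de) * x) * r x)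
    - rline (fun x => exp (- ((1 - de) * w)) * (exp ((1 - de) * (x + w)) * r (x + w)))
    = (1 - exp (- ((1 - de) * w))) * rline (fun x => exp ((1 - de) * x) * r x)).
  rewrite S; ring.
Qed.

(** In the borderline case the weight is 1. Over [[- x, x]] the difference telescopes to an integral
    over an interval of length [|w|] near [- oo], where [r] is close to [L], minus one near [+ oo],
    where [r] is small. *)
Lemma line_telescope (al ga K L w : R) (phi : R -> R -> R) (r : R -> R) :
  0 < al < 1 -> 0 < ga < 1 -> al + ga = 1 ->
  resolvent_kernel phi r K -> (forall x, Rabs (r x - L) <= K * exp x) ->
  rline (fun x => exp ((1 - (al + ga)) * x) * (r x - r (x + w))) = w * L.
Proof.
intros Hal Hga Hs H HL; assert (HK := rk_pos _ _ _ H).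
destruct (difference_decaying al ga Hal Hga phi r K w H) as [K' D].
apply (line_unique (V := R_CompleteNormedModule) _ _ _ _ _ _ D).
intros eps He.
assert (Hc := rk_r_cont _ _ _ H).
assert (Ir : forall p q, ex_RInt r p q).
{ intros; apply (ex_RInt_continuous (V := R_CompleteNormedModule)); auto. }
assert (Hww : 0 <= Rabs w) by apply Rabs_pos.
destruct (exp_eventually_small (K * (Rabs w + 1)) 1 (eps / 2)) as [B [HB HBe]]; try lra.
{ apply Rmult_le_pos; lra. }
exists (B + Rabs w); intros x Hx.
assert (Hw1 := Rle_abs w); assert (Hw2 := Rle_abs (- w)); rewrite Rabs_Ropp in Hw2.
assert (E : RInt (fun x => exp ((1 - (al + ga)) * x) * (r x - r (x + w))) (- x) x
  = RInt r (- x) (- x + w) - RInt r x (x + w)).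
{ rewrite (RInt_ext _ (fun x => minus (r x) (r (x + w)))).
  2: { intros z _; rewrite Hs, Rminus_diag_eq, Rmult_0_l, exp_0, Rmult_1_l by reflexivity; reflexivity. }
  assert (Iw : ex_RInt (fun x => r (x + w)) (- x) x).
  { apply (ex_RInt_continuous (V := R_CompleteNormedModule)); intros z _.
    apply (continuous_comp (fun x => x + w) r); [|apply Hc].
    apply (ex_derive_continuous (fun x => x + w)); auto_derive; exact I. }
  rewrite (RInt_minus (V := R_CompleteNormedModule)) by auto.
  rewrite (RInt_translate (V := R_CompleteNormedModule) r) by apply Ir.
  assert (C1 := RInt_Chasles (V := R_CompleteNormedModule) r (- x) (- x + w) x (Ir _ _) (Ir _ _)).
  assert (C2 := RInt_Chasles (V := R_CompleteNormedModule) r (- x + w) x (x + w) (Ir _ _) (Ir _ _)).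
  rewrite <- C1, <- C2; unfold minus, plus, opp; simpl; ring. }
assert (B1 : Rabs (RInt r (- x) (- x + w) - w * L) <= Rabs w * (K * exp (- (x - Rabs w)))).
{ replace (RInt r (- x) (- x + w) - w * L) with (RInt (fun z => minus (r z) L) (- x) (- x + w)).
  2: { rewrite (RInt_minus (V := R_CompleteNormedModule)); auto.
       2: apply (ex_RInt_const (V := R_NormedModule)).
       rewrite (RInt_const (V := R_CompleteNormedModule)).
       unfold minus, plus, opp, scal; simpl; unfold mult; simpl; ring. }
  assert (Im : ex_RInt (fun z => minus (r z) L) (- x) (- x + w)).
  { apply (ex_RInt_minus (V := R_NormedModule)); [apply Ir|apply (ex_RInt_const (V := R_NormedModule))]. }
  assert (Hz : forall z, z <= - x + Rabs w -> Rabs (minus (r z) L) <= K * exp (- (x - Rabs w))).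
  { intros z Hz; apply Rle_trans with (1 := HL z), Rmult_le_compat_l; [exact HK|apply exp_le; lra]. }
  destruct (Rle_dec 0 w) as [Hw|Hw].
  - replace (Rabs w) with (- x + w - - x) at 1 by (rewrite Rabs_pos_eq; lra).
    apply abs_RInt_le_const; auto; [lra|]; intros z Hzz; apply Hz; lra.
  - rewrite <- (opp_RInt_swap (V := R_CompleteNormedModule)) by (apply ex_RInt_swap; exact Im).
    change (Rabs (- RInt (fun z => minus (r z) L) (- x + w) (- x)) <= Rabs w * (K * exp (- (x - Rabs w)))).
    rewrite Rabs_Ropp.
    replace (Rabs w) with (- x - (- x + w)) at 1 by (rewrite Rabs_left; lra).
    apply abs_RInt_le_const; [lra|apply ex_RInt_swap; exact Im|]; intros z Hzz; apply Hz; lra. }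
assert (B2 : Rabs (RInt r x (x + w)) <= Rabs w * (K * exp (- (x - Rabs w)))).
{ assert (Hz : forall z, x - Rabs w <= z -> Rabs (r z) <= K * exp (- (x - Rabs w))).
  { intros z Hz; apply Rle_trans with (1 := rk_r_bound _ _ _ H z).
    unfold Rdiv; apply Rmult_le_compat_l; [exact HK|].
    apply Rle_trans with (exp (- z)); [|apply exp_le; lra].
    rewrite exp_Ropp; apply Rinv_le_contravar; [apply exp_pos|]; lra. }
  destruct (Rle_dec 0 w) as [Hw|Hw].
  - replace (Rabs w) with (x + w - x) at 1 by (rewrite Rabs_pos_eq; lra).
    apply abs_RInt_le_const; auto; [lra|]; intros z Hzz; apply Hz; lra.
  - rewrite <- (opp_RInt_swap (V := R_CompleteNormedModule)) by apply Ir.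
    change (Rabs (- RInt r (x + w) x) <= Rabs w * (K * exp (- (x - Rabs w)))).
    rewrite Rabs_Ropp.
    replace (Rabs w) with (x - (x + w)) at 1 by (rewrite Rabs_left; lra).
    apply abs_RInt_le_const; auto; [lra|]; intros z Hzz; apply Hz; lra. }
assert (B3 := HBe (x - Rabs w) ltac:(lra)); rewrite Rmult_1_l in B3.
assert (B4 : Rabs w * (K * exp (- (x - Rabs w))) < eps / 2).
{ apply Rle_lt_trans with (2 := B3).
  assert (0 <= K * exp (- (x - Rabs w))) by (apply Rmult_le_pos; [exact HK|left; apply exp_pos]).
  nra. }
rewrite E.
change (Rabs ((RInt r (- x) (- x + w) - RInt r x (x + w)) - w * L) < eps).
apply Rabs_le_between in B1; apply Rabs_le_between in B2; apply Rabs_lt_between; lra.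
Qed.

(** * The beta integral *)

Lemma RInt_le_line (f : R -> R) (K1 K2 a b A B : R) : rdecaying f K1 K2 a b ->
  (forall x, 0 <= f x) -> A <= B -> RInt f A B <= rline f.
Proof.
intros D Hf HAB; apply Rnot_lt_le; intros Hlt.
destruct (line_approx f K1 K2 a b (RInt f A B - rline f) D ltac:(lra)) as [C [_ HC]].
set (p := Rmin A (- C)); set (q := Rmax B C).
assert (Hp : p <= A) by apply Rmin_l; assert (Hq : B <= q) by apply Rmax_l.
assert (H := HC p q (Rmin_r _ _) (Rmax_r _ _)).
change (Rabs (rline f - RInt f p q) < RInt f A B - rline f) in H.
assert (I : forall u v, ex_RInt f u v) by (intros; now apply (decaying_ex_RInt (V := R_CompleteNormedModule)) with K1 K2 a b).
assert (E1 := RInt_Chasles (V := R_CompleteNormedModule) f p A q (I _ _) (I _ _)).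
assert (E2 := RInt_Chasles (V := R_CompleteNormedModule) f A B q (I _ _) (I _ _)).
rewrite <- E1, <- E2 in H; unfold plus in H; simpl in H.
assert (P1 : 0 <= RInt f p A) by (apply RInt_ge_0; auto).
assert (P2 : 0 <= RInt f B q) by (apply RInt_ge_0; auto).
apply Rabs_lt_between in H; lra.
Qed.

Lemma inv_1_exp_continuous (x : R) : continuous (fun x => / (1 + exp x)) x.
Proof.
apply (ex_derive_continuous (fun x => / (1 + exp x))); auto_derive.
generalize (exp_pos x); lra.
Qed.

(* The beta integral [int_0^oo mu^-al / (1 + mu) dmu]; only its size is needed,
   not its value [PI / sin (PI * al)]. *)
Definition beta_integral (al : R) : R := rline (fun x => exp ((1 - al) * x) * / (1 + exp x)).

Lemma beta_integral_decaying (al : R) : 0 < al < 1 ->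
  rdecaying (fun x => exp ((1 - al) * x) * / (1 + exp x)) 1 1 (1 - al) al.
Proof.
intros Hal.
assert (Hb : forall x, norm (/ (1 + exp x)) <= 1 / (1 + exp x)).
{ intros x; assert (Hx := exp_pos x).
  change (Rabs (/ (1 + exp x)) <= 1 / (1 + exp x)); rewrite Rabs_pos_eq.
  - right; field; lra.
  - left; apply Rinv_0_lt_compat; lra. }
assert (D := exp_weight_decaying (V := R_CompleteNormedModule) (1 - al) 1 (fun x => / (1 + exp x))
  ltac:(lra) ltac:(lra) inv_1_exp_continuous Hb).
replace (1 - (1 - al)) with al in D by ring; exact D.
Qed.

(** Up to a factor between [1 / 2] and 1 the integrand is [exp ((1 - al) x)] for [x <= 0] and
    [exp (- (al x))] for [x >= 0]. For the lower bound the range is cut at [- / (1 - al)] and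
    [/ al], where these exponentials have dropped to [exp (-1) <= / 2]. *)
Lemma beta_integral_bounds (al : R) : 0 < al < 1 ->
  / (4 * (al * (1 - al))) <= beta_integral al <= / (al * (1 - al)).
Proof.
intros Hal; assert (D := beta_integral_decaying al Hal); split.
- set (f := fun x => exp ((1 - al) * x) * / (1 + exp x)) in *.
  assert (He : exp (-1) <= / 2).
  { replace (-1) with (- (1)) by ring; rewrite exp_Ropp.
    apply Rinv_le_contravar; [lra|]; generalize (exp_ineq1_le 1); lra. }
  assert (I : forall u v, ex_RInt f u v) by (intros; now apply (decaying_ex_RInt (V := R_CompleteNormedModule)) with 1 1 (1 - al) al).
  assert (Ha : 0 < / al) by (apply Rinv_0_lt_compat; lra).
  assert (Hb : 0 < / (1 - al)) by (apply Rinv_0_lt_compat; lra).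
  apply Rle_trans with (RInt f (- / (1 - al)) (/ al)).
  2: { apply RInt_le_line with (1 := D); [|lra].
       intros x; unfold f; apply Rmult_le_pos; left; [apply exp_pos|].
       apply Rinv_0_lt_compat; generalize (exp_pos x); lra. }
  rewrite <- (RInt_Chasles (V := R_CompleteNormedModule) f _ 0) by apply I.
  change (/ (4 * (al * (1 - al))) <= RInt f (- / (1 - al)) 0 + RInt f 0 (/ al)).
  assert (L1 : / (4 * (1 - al)) <= RInt f (- / (1 - al)) 0).
  { apply Rle_trans with (RInt (fun x => / 2 * exp ((1 - al) * x)) (- / (1 - al)) 0).
    - rewrite (is_RInt_unique (V := R_CompleteNormedModule) _ _ _
        (minus (/ 2 / (1 - al) * exp ((1 - al) * 0)) (/ 2 / (1 - al) * exp ((1 - al) * (- / (1 - al)))))).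
      + rewrite Rmult_0_r, exp_0; replace ((1 - al) * - / (1 - al)) with (-1) by (field; lra).
        change (/ (4 * (1 - al)) <= / 2 / (1 - al) * 1 - / 2 / (1 - al) * exp (-1)).
        replace (/ (4 * (1 - al))) with (/ 2 / (1 - al) * (1 - / 2)) by (field; lra).
        rewrite <- Rmult_minus_distr_l; apply Rmult_le_compat_l; [|lra].
        apply Rdiv_le_0_compat; lra.
      + apply (is_RInt_derive (V := R_CompleteNormedModule) (fun x => / 2 / (1 - al) * exp ((1 - al) * x))).
        * intros x _; auto_derive; [exact Logic.I|]; field; lra.
        * intros x _; apply (ex_derive_continuous (fun x => / 2 * exp ((1 - al) * x))).
          auto_derive; exact Logic.I.
    - apply RInt_le; try lra; auto.
      + apply (ex_RInt_continuous (V := R_CompleteNormedModule)); intros x _.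
        apply (ex_derive_continuous (fun x => / 2 * exp ((1 - al) * x))); auto_derive; exact Logic.I.
      + intros x Hx; unfold f; rewrite Rmult_comm; apply Rmult_le_compat_l; [left; apply exp_pos|].
        apply Rinv_le_contravar; [generalize (exp_pos x); lra|].
        assert (exp x <= exp 0) by (apply exp_le; lra); rewrite exp_0 in H; lra. }
  assert (L2 : / (4 * al) <= RInt f 0 (/ al)).
  { apply Rle_trans with (RInt (fun x => / 2 * exp (- (al * x))) 0 (/ al)).
    - rewrite (is_RInt_unique (V := R_CompleteNormedModule) _ _ _
        (minus (- (/ 2 / al * exp (- (al * / al)))) (- (/ 2 / al * exp (- (al * 0)))))).
      + rewrite Rmult_0_r, Ropp_0, exp_0; replace (al * / al) with 1 by (field; lra).
        replace (- (1)) with (-1) by ring.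
        change (/ (4 * al) <= - (/ 2 / al * exp (-1)) - - (/ 2 / al * 1)).
        replace (/ (4 * al)) with (/ 2 / al * (1 - / 2)) by (field; lra).
        apply Rle_trans with (/ 2 / al * (1 - exp (-1))); [|right; ring].
        apply Rmult_le_compat_l; [|lra].
        apply Rdiv_le_0_compat; lra.
      + apply (is_RInt_derive (V := R_CompleteNormedModule) (fun x => - (/ 2 / al * exp (- (al * x))))).
        * intros x _; auto_derive; [exact Logic.I|]; field; lra.
        * intros x _; apply (ex_derive_continuous (fun x => / 2 * exp (- (al * x)))).
          auto_derive; exact Logic.I.
    - apply RInt_le; try lra; auto.
      + apply (ex_RInt_continuous (V := R_CompleteNormedModule)); intros x _.
        apply (ex_derive_continuous (fun x => / 2 * exp (- (al * x)))); auto_derive; exact Logic.I.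
      + intros x Hx; unfold f.
        replace (exp ((1 - al) * x)) with (exp (- (al * x)) * exp x)
          by (rewrite <- exp_plus; f_equal; ring).
        rewrite Rmult_comm, Rmult_assoc; apply Rmult_le_compat_l; [left; apply exp_pos|].
        assert (1 <= exp x) by (rewrite <- exp_0; apply exp_le; lra).
        apply Rmult_le_reg_r with (1 + exp x); [lra|].
        rewrite Rmult_assoc, Rinv_l by lra; lra. }
  replace (/ (4 * (al * (1 - al)))) with (/ (4 * (1 - al)) + / (4 * al)) by (field; lra); lra.
- assert (H := norm_line_le _ _ _ _ _ 0 D).
  change (Rabs (beta_integral al) <= 1 / (1 - al) * exp ((1 - al) * 0) + 1 / al * exp (- (al * 0))) in H.
  rewrite !Rmult_0_r, Ropp_0, exp_0 in H.
  replace (1 / (1 - al) * 1 + 1 / al * 1) with (/ (al * (1 - al))) in H by (field; lra).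
  apply Rle_trans with (1 := Rle_abs _); exact H.
Qed.

(* The factor between [neg_pow al] and [inv_pow al] below; by the reflection formula
   it is 1, but bounds suffice. *)
Definition power_ratio (al : R) : R :=
  if Req_EM_T al 0 then 1 else sin (PI * al) / PI * beta_integral al.

Lemma sin_PI_mult_bounds (al : R) : 0 < al < 1 ->
  PI / 2 * (al * (1 - al)) <= sin (PI * al) <= 2 * PI * (al * (1 - al)).
Proof.
assert (HPI := PI_RGT_0).
assert (Hw : forall c, 0 < c <= / 2 -> PI / 2 * (c * (1 - c)) <= sin (PI * c) <= 2 * PI * (c * (1 - c))).
{ intros c Hc; split.
  - apply Rle_trans with (PI * c / 2); [|apply half_le_sin; split; nra].
    assert (0 < PI * c) by (apply Rmult_lt_0_compat; lra); nra.
  - apply Rle_trans with (PI * c); [left; apply sin_lt_x, Rmult_lt_0_compat; lra|].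
    assert (0 < PI * c) by (apply Rmult_lt_0_compat; lra); nra. }
intros Hal; destruct (Rle_dec al (/ 2)) as [H|H]; [apply Hw; lra|].
replace (PI * al) with (PI - PI * (1 - al)) by ring.
rewrite sin_PI_x; replace (al * (1 - al)) with ((1 - al) * (1 - (1 - al))) by ring.
apply Hw; lra.
Qed.

(** [sin (PI al) / PI] is comparable to [c = al (1 - al)] and the beta integral to [/ c]. The bounds
    do not depend on [al], which keeps [t] out of the final constant. *)
Lemma power_ratio_bounds (al : R) : 0 <= al < 1 -> / 8 <= power_ratio al <= 2.
Proof.
intros Hal; unfold power_ratio; destruct (Req_EM_T al 0) as [|H0]; [lra|].
assert (HPI := PI_RGT_0).
destruct (sin_PI_mult_bounds al ltac:(lra)) as [S1 S2].
destruct (beta_integral_bounds al ltac:(lra)) as [B1 B2].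
set (c := al * (1 - al)) in *.
assert (Hc : 0 < c) by (apply Rmult_lt_0_compat; lra).
assert (T1 : c / 2 <= sin (PI * al) / PI).
{ apply Rmult_le_reg_r with PI; [lra|].
  replace (sin (PI * al) / PI * PI) with (sin (PI * al)) by (field; lra); lra. }
assert (T2 : sin (PI * al) / PI <= 2 * c).
{ apply Rmult_le_reg_r with PI; [lra|].
  replace (sin (PI * al) / PI * PI) with (sin (PI * al)) by (field; lra); lra. }
assert (0 < / (4 * c)) by (apply Rinv_0_lt_compat; lra).
split.
- replace (/ 8) with (c / 2 * / (4 * c)) by (field; lra).
  apply Rmult_le_compat; lra.
- replace 2 with (2 * c * / c) by (field; lra).
  apply Rmult_le_compat; lra.
Qed.

(** * Comparison with the scalar operator [A = 1] *)

Lemma model_kernel :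
  resolvent_kernel (fun x y => / (1 + exp x) * / (1 + exp y)) (fun x => / (1 + exp x)) 1.
Proof.
assert (Hp : forall x, 0 < / (1 + exp x)).
{ intros x; apply Rinv_0_lt_compat; generalize (exp_pos x); lra. }
split; try lra.
- intros x y; apply continuity_2d_pt_mult.
  + apply (continuity_2d_pt_comp1 (fun x => / (1 + exp x))), continuity_pt_filterlim, inv_1_exp_continuous.
  + apply (continuity_2d_pt_comp2 (fun x => / (1 + exp x))), continuity_pt_filterlim, inv_1_exp_continuous.
- intros x y; rewrite Rabs_pos_eq by (left; apply Rmult_lt_0_compat; apply Hp).
  right; field; generalize (exp_pos x) (exp_pos y); lra.
- exact inv_1_exp_continuous.
- intros x; rewrite Rabs_pos_eq by (left; apply Hp).
  right; field; generalize (exp_pos x); lra.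
- intros x y; field; generalize (exp_pos x) (exp_pos y); lra.
Qed.

Lemma model_double_line (al ga : R) : 0 < al < 1 -> 0 < ga < 1 ->
  rline (fun x => rline (fun y => exp ((1 - al) * x) * exp ((1 - ga) * y) *
     (/ (1 + exp x) * / (1 + exp y)))) = beta_integral al * beta_integral ga.
Proof.
intros Hal Hga.
assert (Dg := beta_integral_decaying ga Hga); assert (Da := beta_integral_decaying al Hal).
transitivity (rline (fun x => scal (beta_integral ga) (exp ((1 - al) * x) * / (1 + exp x)))).
- unfold line at 1 3; apply (f_equal (fun F => RInt_gen F (Rbar_locally m_infty) (Rbar_locally p_infty))).
  apply functional_extensionality; intros x.
  transitivity (rline (fun y => scal (exp ((1 - al) * x) * / (1 + exp x)) (exp ((1 - ga) * y) * / (1 + exp y)))).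
  + unfold line; apply (f_equal (fun F => RInt_gen F (Rbar_locally m_infty) (Rbar_locally p_infty))).
    apply functional_extensionality; intros y.
    unfold scal; simpl; unfold mult; simpl; ring.
  + etransitivity; [exact (line_scal (V := R_CompleteNormedModule) _ _ _ _ _ _ Dg)|].
    unfold scal; simpl; unfold mult; simpl; apply Rmult_comm.
- etransitivity; [exact (line_scal (V := R_CompleteNormedModule) _ _ _ _ _ _ Da)|].
  unfold scal; simpl; unfold mult; simpl; apply Rmult_comm.
Qed.

(** For the model kernel the double integral factorises into two beta integrals; this supplies the
    constant. *)
Lemma double_line_power (al ga K : R) (phi : R -> R -> R) (r : R -> R) :
  0 < al -> 0 < ga -> al + ga < 1 -> resolvent_kernel phi r K ->
  rline (fun x => rline (fun y => exp ((1 - al) * x) * exp ((1 - ga) * y) * phi x y))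
    * beta_integral (al + ga)
  = beta_integral al * beta_integral ga * rline (fun x => exp ((1 - (al + ga)) * x) * r x).
Proof.
intros Hal Hga Hs H.
rewrite <- model_double_line by lra.
apply (kernel_comparison al ga ltac:(lra) ltac:(lra) (fun w => 1 - exp (- ((1 - (al + ga)) * w)))
  _ _ _ _ _ _ _ _ H model_kernel).
- intros w; exact (line_power_difference (al + ga) K w r ltac:(lra) (rk_pos _ _ _ H)
    (rk_r_cont _ _ _ H) (rk_r_bound _ _ _ H)).
- intros w; exact (line_power_difference (al + ga) 1 w (fun x => / (1 + exp x)) ltac:(lra) ltac:(lra)
    (rk_r_cont _ _ _ model_kernel) (rk_r_bound _ _ _ model_kernel)).
Qed.

(** [L] is the limit of the profile at [- oo]; in the application it is the pairing of [A^(-1) f]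
    with a test vector. For the model kernel it is 1. *)
Lemma double_line_power_one (al ga K L : R) (phi : R -> R -> R) (r : R -> R) :
  0 < al -> 0 < ga -> al + ga = 1 -> resolvent_kernel phi r K ->
  (forall x, Rabs (r x - L) <= K * exp x) ->
  rline (fun x => rline (fun y => exp ((1 - al) * x) * exp ((1 - ga) * y) * phi x y))
  = beta_integral al * beta_integral ga * L.
Proof.
intros Hal Hga Hs H HL.
assert (HL1 : forall x, Rabs (/ (1 + exp x) - 1) <= 1 * exp x).
{ intros x; assert (Hx := exp_pos x).
  replace (/ (1 + exp x) - 1) with (- (exp x * / (1 + exp x))) by (field; lra).
  assert (Hp : 0 < / (1 + exp x)) by (apply Rinv_0_lt_compat; lra).
  rewrite Rabs_Ropp, Rabs_pos_eq by (apply Rmult_le_pos; lra).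
  assert (/ (1 + exp x) <= 1) by (rewrite <- Rinv_1; apply Rinv_le_contravar; lra).
  nra. }
rewrite <- model_double_line by lra.
rewrite <- (Rmult_1_r (rline _)) at 1.
apply (kernel_comparison al ga ltac:(lra) ltac:(lra) (fun w => w)
  _ _ _ _ _ _ _ _ H model_kernel).
- intros w; exact (line_telescope al ga K L w phi r ltac:(lra) ltac:(lra) Hs H HL).
- intros w; exact (line_telescope al ga 1 1 w _ _ ltac:(lra) ltac:(lra) Hs model_kernel HL1).
Qed.

(** * Hilbert spaces and the Lax-Milgram lemma *)

Section HilbertBasics.

Context {X : HilbertSpace}.
Implicit Types x y z v : X.

Lemma ip_plus_l x y z : inner (plus x y) z = Cplus (inner x z) (inner y z).
Proof. exact (inner_plus_l _ (inner_axioms X) x y z). Qed.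

Lemma ip_scal_l (c : C) x y : inner (scal c x) y = Cmult c (inner x y).
Proof. exact (inner_scal_l _ (inner_axioms X) c x y). Qed.

Lemma ip_conj x y : inner y x = Cconj (inner x y).
Proof. exact (inner_conj _ (inner_axioms X) x y). Qed.

Lemma ip_self x : inner x x = RtoC (norm x ^ 2).
Proof. exact (inner_norm _ (inner_axioms X) x). Qed.

Lemma Cplus_self_cancel (c : C) : c = Cplus c c -> c = RtoC 0.
Proof.
intros E; apply (f_equal (fun t => Cminus t c)) in E.
replace (Cminus c c) with (RtoC 0) in E by ring.
replace (Cminus (Cplus c c) c) with c in E by ring; now symmetry.
Qed.

Lemma ip_zero_l y : inner (zero : X) y = RtoC 0.
Proof.
apply Cplus_self_cancel; rewrite <- ip_plus_l; f_equal; symmetry; exact (plus_zero_l zero).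
Qed.

Lemma ip_opp_l x y : inner (opp x) y = Copp (inner x y).
Proof.
assert (E : Cplus (inner x y) (inner (opp x) y) = RtoC 0).
{ rewrite <- ip_plus_l, <- (ip_zero_l y); f_equal; exact (plus_opp_r x). }
replace (Copp (inner x y)) with (Cminus (RtoC 0) (inner x y)) by ring.
rewrite <- E; ring.
Qed.

Lemma ip_minus_l x y z : inner (minus x y) z = Cminus (inner x z) (inner y z).
Proof.
change (minus x y) with (plus x (opp y)); rewrite ip_plus_l, ip_opp_l; reflexivity.
Qed.

Lemma ip_plus_r x y z : inner x (plus y z) = Cplus (inner x y) (inner x z).
Proof.
rewrite ip_conj, ip_plus_l, Cplus_conj, <- !ip_conj; reflexivity.
Qed.

Lemma ip_scal_r (c : C) x y : inner x (scal c y) = Cmult (Cconj c) (inner x y).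
Proof.
rewrite ip_conj, ip_scal_l, Cmult_conj, <- ip_conj; reflexivity.
Qed.

Lemma ip_minus_r x y z : inner x (minus y z) = Cminus (inner x y) (inner x z).
Proof.
rewrite ip_conj, ip_minus_l, Cminus_conj, <- !ip_conj; reflexivity.
Qed.

Lemma norm_sqr x : norm x ^ 2 = Re (inner x x).
Proof. rewrite ip_self; reflexivity. Qed.

Lemma hnorm_ge_0 x : 0 <= norm x.
Proof. exact (norm_ge_0 x). Qed.

Lemma hnorm_eq_0 x : norm x = 0 -> x = zero.
Proof. exact (norm_eq_zero x). Qed.

Lemma hnorm_triangle x y : norm (plus x y) <= norm x + norm y.
Proof. exact (norm_triangle x y). Qed.

Lemma minus_eq_0 x y : minus x y = zero -> x = y.
Proof.
intros H.
transitivity (plus (minus x y) y).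
- transitivity (plus x (plus (opp y) y)).
  + transitivity (plus x zero); [symmetry; exact (plus_zero_r x)|].
    f_equal; symmetry; exact (plus_opp_l y).
  + exact (plus_assoc x (opp y) y).
- rewrite H; exact (plus_zero_l y).
Qed.

Lemma ip_ext x y : (forall v, inner x v = inner y v) -> x = y.
Proof.
intros H; apply minus_eq_0, hnorm_eq_0.
assert (E : norm (minus x y) ^ 2 = 0).
{ rewrite norm_sqr, ip_minus_l, H; unfold Cminus; rewrite Cplus_opp_r; reflexivity. }
destruct (Req_dec (norm (minus x y)) 0) as [E0|E0]; [exact E0|].
now apply (pow_nonzero _ 2) in E0.
Qed.

Lemma hnorm_opp x : norm (opp x) = norm x.
Proof. exact (norm_opp x). Qed.

Lemma hnorm_scal (c : C) x : norm (scal c x) = Cmod c * norm x.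
Proof.
assert (E : norm (scal c x) ^ 2 = (Cmod c * norm x) ^ 2).
{ rewrite norm_sqr, ip_scal_l, ip_scal_r, Cmult_assoc, ip_self.
  rewrite <- Cmod2_conj; rewrite Rpow_mult_distr, RtoC_pow, <- RtoC_pow, <- RtoC_mult; reflexivity. }
apply Rsqr_inj; [apply hnorm_ge_0|apply Rmult_le_pos; [apply Cmod_ge_0|apply hnorm_ge_0]|].
unfold Rsqr; simpl in E; lra.
Qed.

Lemma Re_scal_R (r : R) (c : C) : Re (Cmult (RtoC r) c) = r * Re c.
Proof. unfold Re, Cmult, RtoC; simpl; ring. Qed.

Lemma norm_plus_sqr x y : norm (plus x y) ^ 2 = norm x ^ 2 + 2 * Re (inner x y) + norm y ^ 2.
Proof.
rewrite !norm_sqr, ip_plus_l, !ip_plus_r, (ip_conj x y).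
destruct (inner x y), (inner x x), (inner y y); unfold Re; simpl; ring.
Qed.

Lemma Re_inner_le x y : Rabs (Re (inner x y)) <= norm x * norm y.
Proof.
assert (H : forall x y, Re (inner x y) <= norm x * norm y).
{ clear x y; intros x y.
  destruct (Req_dec (norm x) 0) as [Ex|Ex].
  { assert (E0 : inner x y = RtoC 0) by (rewrite (hnorm_eq_0 x Ex); apply ip_zero_l).
    rewrite E0, Ex; simpl; lra. }
  destruct (Req_dec (norm y) 0) as [Ey|Ey].
  { rewrite (hnorm_eq_0 y Ey), ip_conj, ip_zero_l; simpl.
    apply Rmult_le_pos; apply hnorm_ge_0. }
  assert (Px : 0 < norm x) by (generalize (hnorm_ge_0 x); lra).
  assert (Py : 0 < norm y) by (generalize (hnorm_ge_0 y); lra).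
  (* 0 <= || |y| x - |x| y ||^2 *)
  assert (E := norm_plus_sqr (scal (RtoC (norm y)) x) (scal (RtoC (- norm x)) y)).
  rewrite !hnorm_scal, ip_scal_l, ip_scal_r, Re_scal_R, !Cmod_R, Rabs_Ropp in E.
  replace (Cconj (RtoC (- norm x))) with (RtoC (- norm x)) in E
    by (unfold Cconj, RtoC; simpl; f_equal; ring).
  rewrite Re_scal_R, !Rabs_pos_eq in E by apply hnorm_ge_0.
  assert (0 <= norm (plus (scal (RtoC (norm y)) x) (scal (RtoC (- norm x)) y)) ^ 2) by apply pow2_ge_0.
  assert (0 < norm x * norm y) by (apply Rmult_lt_0_compat; assumption).
  assert (norm x * norm y * (norm x * norm y - Re (inner x y)) >= 0) by nra.
  nra. }
apply Rabs_le; split; [|apply H].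
assert (H1 := H (opp x) y); rewrite ip_opp_l, hnorm_opp in H1.
replace (Re (Copp (inner x y))) with (- Re (inner x y)) in H1 by reflexivity; lra.
Qed.

(** The estimate of the real part, applied to [x] multiplied by the conjugate of [inner x y], which
    makes the inner product real and nonnegative. *)
Lemma cauchy_schwarz x y : Cmod (inner x y) <= norm x * norm y.
Proof.
destruct (Req_dec (Cmod (inner x y)) 0) as [E|E].
{ rewrite E; apply Rmult_le_pos; apply hnorm_ge_0. }
assert (P : 0 < Cmod (inner x y)) by (generalize (Cmod_ge_0 (inner x y)); lra).
assert (H := Re_inner_le (scal (Cconj (inner x y)) x) y).
rewrite ip_scal_l, hnorm_scal, Cmod_conj in H.
replace (Re (Cmult (Cconj (inner x y)) (inner x y))) with (Cmod (inner x y) ^ 2) in H.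
- rewrite Rabs_pos_eq in H by apply pow2_ge_0.
  apply Rmult_le_reg_l with (Cmod (inner x y)); [exact P|]; nra.
- rewrite Cmult_comm, <- Cmod2_conj; reflexivity.
Qed.

End HilbertBasics.

(* Completeness in the form of Cantor's intersection theorem. *)
Lemma nested_sets_limit (V : CompleteNormedModule C_AbsRing) (S : R -> V -> Prop) :
  (forall e, 0 < e -> exists u, S e u) ->
  (forall e e' u, e <= e' -> S e u -> S e' u) ->
  (forall d, 0 < d -> exists e, 0 < e /\ forall u v, S e u -> S e v -> norm (minus u v) < d) ->
  exists w, forall d e, 0 < d -> 0 < e -> exists u, S e u /\ norm (minus u w) < d.
Proof.
intros Hne Hmon Hd.
set (F := fun P : V -> Prop => exists e, 0 < e /\ forall u, S e u -> P u).
assert (FF : ProperFilter F).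
{ split.
  - intros P [e [He HP]]; destruct (Hne e He) as [u Hu]; exists u; auto.
  - split.
    + exists 1; split; [lra|auto].
    + intros P Q [e1 [H1 HP]] [e2 [H2 HQ]]; exists (Rmin e1 e2); split.
      * now apply Rmin_glb_lt.
      * intros u Hu; split; [apply HP|apply HQ]; eapply Hmon; try exact Hu;
          [apply Rmin_l|apply Rmin_r].
    + intros P Q HPQ [e [He HP]]; exists e; auto. }
assert (HC : cauchy F).
{ intros eps; destruct (Hd eps (cond_pos eps)) as [e [He H]].
  destruct (Hne e He) as [u Hu]; exists u; exists e; split; [exact He|].
  intros v Hv; apply (norm_compat1 (V := V)); now apply H. }
assert (HL := complete_cauchy (T := V) F FF HC).
exists (lim (T := V) F); intros d e Hd0 He.
(* Completeness speaks of balls of the uniform structure; this factor converts their radius into a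
   bound for the norm. *)
set (nf := norm_factor (V := V)).
assert (Hnf : 0 < nf) by apply norm_factor_gt_0.
assert (Hdn : 0 < d / nf) by (apply Rdiv_lt_0_compat; assumption).
destruct (HL (mkposreal _ Hdn)) as [e' [He' H]].
destruct (Hne (Rmin e e')) as [u Hu]; [now apply Rmin_glb_lt|].
exists u; split; [eapply Hmon; [apply Rmin_l|exact Hu]|].
assert (Hb := norm_compat2 (V := V) _ u (mkposreal _ Hdn)
  (H u (Hmon _ _ _ (Rmin_r e e') Hu))).
simpl in Hb; fold nf in Hb; replace (nf * (d / nf)) with d in Hb by (field; lra); exact Hb.
Qed.

Record is_antilinear {Y : HilbertSpace} (l : Y -> C) (K : R) : Prop := {
  antilin_plus : forall u v : Y, l (plus u v) = Cplus (l u) (l v);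
  antilin_scal : forall (c : C) (u : Y), l (scal c u) = Cmult (Cconj c) (l u);
  antilin_bound : forall u : Y, Cmod (l u) <= K * norm u
}.

Lemma Re_abs_le_Cmod (c : C) : Rabs (Re c) <= Cmod c.
Proof. apply Rle_trans with (2 := Rmax_Cmod c), Rmax_l. Qed.

Lemma RtoC_Cconj (r : R) : Cconj (RtoC r) = RtoC r.
Proof. unfold Cconj, RtoC; simpl; f_equal; ring. Qed.

Lemma C_eq_Re_rotate (c : C) : Re c = 0 -> Re (Cmult Ci c) = 0 -> c = RtoC 0.
Proof.
destruct c as [p q]; unfold Re, Ci, RtoC; simpl; intros -> H.
f_equal; lra.
Qed.

(* Minimise [|u|^2 - 2 Re (l u)]. *)
Lemma riesz_representation {Y : HilbertSpace} (l : Y -> C) (K : R) :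
  is_antilinear l K -> exists w : Y, forall phi, inner w phi = l phi.
Proof.
intros [Hp Hs Hb].
set (J := fun u : Y => norm u ^ 2 - 2 * Re (l u)).
assert (Hlow : forall u, - J u <= K ^ 2).
{ intros u; unfold J.
  assert (H1 := Rle_trans _ _ _ (Re_abs_le_Cmod (l u)) (Hb u)).
  apply Rabs_le_between in H1; generalize (pow2_ge_0 (norm u - K)); nra. }
destruct (completeness (fun r => exists u, r = - J u)) as [m [Hm1 Hm2]].
{ exists (K ^ 2); intros r [u ->]; apply Hlow. }
{ exists (- J zero); exists zero; reflexivity. }
assert (Hm : forall u, - m <= J u).
{ intros u; assert (- J u <= m) by (apply Hm1; exists u; reflexivity); lra. }
assert (Hmin : forall e, 0 < e -> exists u, J u < - m + e).
{ intros e He.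
  destruct (Classical_Prop.classic (exists u, J u < - m + e)) as [H|H]; [exact H|exfalso].
  assert (m <= m - e); [|lra].
  apply Hm2; intros r [u ->].
  destruct (Rlt_le_dec (J u) (- m + e)) as [Hu|Hu]; [exfalso; apply H; now exists u|lra]. }
assert (Hexp : forall (t : R) (u phi : Y),
  J (plus u (scal (RtoC t) phi)) = J u + 2 * t * Re (Cminus (inner u phi) (l phi)) + t ^ 2 * norm phi ^ 2).
{ intros t u phi; unfold J.
  rewrite norm_plus_sqr, Hp, Hs, RtoC_Cconj, hnorm_scal, ip_scal_r, RtoC_Cconj, Cmod_R.
  rewrite Rpow_mult_distr, pow2_abs, Re_scal_R.
  change (Re (Cplus (l u) (Cmult (RtoC t) (l phi)))) with (Re (l u) + Re (Cmult (RtoC t) (l phi))).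
  rewrite Re_scal_R.
  change (Re (Cminus (inner u phi) (l phi))) with (Re (inner u phi) - Re (l phi)); ring. }
destruct (nested_sets_limit Y (fun e u => J u < - m + e)) as [w Hw].
- exact Hmin.
- intros e e' u He Hu; lra.
(* By the parallelogram identity below, two points with [J < - m + e] have squared distance less
   than [4 e]. *)
- intros d Hd; exists (d ^ 2 / 4); assert (Hd2 : 0 < d ^ 2) by (apply pow_lt; lra).
  split; [lra|]; intros u v Hu Hv.
  assert (E : norm (minus u v) ^ 2
    = 2 * J u + 2 * J v - 4 * J (plus u (scal (RtoC (/ 2)) (minus v u)))).
  { rewrite Hexp.
    assert (Hl : l (minus v u) = Cminus (l v) (l u)).
    { replace (l v) with (l (plus (minus v u : Y) u)).
      - rewrite Hp; ring.
      - f_equal; apply ip_ext; intros z; rewrite ip_plus_l, ip_minus_l; ring. }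
    assert (Hn : norm (minus u v) ^ 2 = norm u ^ 2 - 2 * Re (inner u v) + norm v ^ 2).
    { rewrite !norm_sqr, ip_minus_l, !ip_minus_r, (ip_conj u v).
      destruct (inner u v), (inner u u), (inner v v); unfold Re; simpl; ring. }
    rewrite norm_minus_sym in Hn |- *.
    rewrite Hl, ip_minus_r, ip_self, Hn; unfold J, Re, Cminus, Cplus, Copp, RtoC; simpl.
    unfold Re in Hn; field. }
  assert (Hm' := Hm (plus u (scal (RtoC (/ 2)) (minus v u)))).
  assert (Hlt : norm (minus u v) ^ 2 < d ^ 2) by lra.
  apply Rsqr_incrst_0; [unfold Rsqr; nra|apply hnorm_ge_0|lra].
- exists w.
  assert (HRe : forall phi, Re (Cminus (inner w phi) (l phi)) = 0).
  { intros phi.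
    set (D := Re (Cminus (inner w phi) (l phi))).
    destruct (Req_dec D 0) as [E|E]; [exact E|exfalso].
    apply Rabs_pos_lt in E.
    set (n2 := norm phi ^ 2); assert (Hn2 : 0 <= n2) by apply pow2_ge_0.
    (* [w] is only a limit of near-minimisers, so the first variation is examined at a
       near-minimiser [u] with slack [t ^ 2]. The increments [t] and [- t] bound its first variation
       [Du] by [t (1 + n2) / 2], which for this [t] is [|D| / 4]; replacing [w] by [u] costs another
       [|D| / 4]. *)
    set (t := Rabs D / (2 * (1 + n2))).
    assert (Ht : 0 < t) by (apply Rdiv_lt_0_compat; lra).
    assert (Ht2 : 0 < t ^ 2) by (apply pow_lt; exact Ht).
    set (d := Rabs D / (4 * (1 + norm phi))).
    assert (Hphi := hnorm_ge_0 phi).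
    assert (Hd : 0 < d) by (apply Rdiv_lt_0_compat; lra).
    destruct (Hw d (t ^ 2) Hd Ht2) as [u [Hu Hdu]].
    assert (Hdiff : Rabs (D - Re (Cminus (inner u phi) (l phi))) <= Rabs D / 4).
    { replace (D - Re (Cminus (inner u phi) (l phi))) with (- Re (inner (minus u w) phi)).
      - rewrite Rabs_Ropp; apply Rle_trans with (1 := Re_inner_le _ _).
        apply Rle_trans with (d * (1 + norm phi)).
        + apply Rmult_le_compat; try apply hnorm_ge_0; lra.
        + right; unfold d; field; lra.
      - rewrite ip_minus_l; unfold D, Re, Cminus, Cplus, Copp; simpl; ring. }
    set (Du := Re (Cminus (inner u phi) (l phi))) in *.
    assert (Hv : forall s, 2 * s * Du + s ^ 2 * n2 >= - t ^ 2).
    { intros s; assert (H1 := Hexp s u phi); fold Du n2 in H1.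
      assert (H2 := Hm (plus u (scal (RtoC s) phi))); lra. }
    assert (H1 := Hv t); assert (H2 := Hv (- t)).
    assert (HDu : Rabs Du <= t * (1 + n2) / 2).
    { apply Rabs_le; split; apply Rmult_le_reg_l with (2 * t); try lra; nra. }
    assert (Et : t * (1 + n2) / 2 = Rabs D / 4) by (unfold t; field; lra).
    rewrite Et in HDu.
    assert (Rabs D <= Rabs D / 4 + Rabs D / 4); [|lra].
    replace D with ((D - Du) + Du) at 1 by ring.
    apply Rle_trans with (1 := Rabs_triang _ _); lra. }
  intros phi.
  assert (E : Cminus (inner w phi) (l phi) = RtoC 0).
  { apply C_eq_Re_rotate; [apply HRe|].
    (* Testing with [- i phi] turns the imaginary part into a real part. *)
    assert (H := HRe (scal (Copp Ci) phi)); rewrite ip_scal_r, Hs in H.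
    replace (Cconj (Copp Ci)) with Ci in H by (unfold Cconj, Copp, Ci; simpl; f_equal; ring).
    rewrite <- H; f_equal; ring. }
  replace (inner w phi) with (Cplus (Cminus (inner w phi) (l phi)) (l phi)) by ring.
  rewrite E; ring.
Qed.

Lemma plus_minus_cancel {Y : HilbertSpace} (u v : Y) : plus (minus u v : Y) v = u.
Proof. apply ip_ext; intros z; rewrite ip_plus_l, ip_minus_l; ring. Qed.

Section Sesquilinear.

Context {Y : HilbertSpace} (b : Y -> Y -> C) (Hb : is_sesquilinear b).

Lemma form_plus_l (u v w : Y) : b (plus u v) w = Cplus (b u w) (b v w).
Proof. exact (sesqui_plus_l _ Hb u v w). Qed.

Lemma form_scal_l (c : C) (u v : Y) : b (scal c u) v = Cmult c (b u v).
Proof. exact (sesqui_scal_l _ Hb c u v). Qed.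

Lemma form_minus_l (u v w : Y) : b (minus u v) w = Cminus (b u w) (b v w).
Proof.
rewrite <- (plus_minus_cancel u v) at 2; rewrite form_plus_l; ring.
Qed.

Lemma form_antilinear (C1 : R) (u : Y) :
  (forall v, Cmod (b u v) <= C1 * norm u * norm v) -> is_antilinear (b u) (C1 * norm u).
Proof.
intros H; split; [exact (sesqui_plus_r _ Hb u)| |exact H].
intros c v; exact (sesqui_scal_r _ Hb c u v).
Qed.

Lemma coercive_unique (c : R) (u v : Y) : 0 < c -> (forall v, c * norm v ^ 2 <= Re (b v v)) ->
  (forall phi, b u phi = b v phi) -> u = v.
Proof.
intros Hc H E; apply minus_eq_0, hnorm_eq_0.
assert (H1 := H (minus u v)); rewrite form_minus_l, E in H1.
replace (Re _) with 0 in H1 by (unfold Re, Cminus, Cplus, Copp; simpl; ring).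
assert (H2 : norm (minus u v) ^ 2 <= 0) by nra.
destruct (Req_dec (norm (minus u v)) 0) as [E0|E0]; [exact E0|].
assert (0 < norm (minus u v) ^ 2) by (apply pow2_gt_0; exact E0); lra.
Qed.

(* Richardson iteration [u - rho (A u - g)] contracts the residual, and by
   coercivity the sets of approximate solutions shrink to a point. *)
Lemma lax_milgram (c C1 K : R) (l : Y -> C) : 0 < c ->
  (forall v, c * norm v ^ 2 <= Re (b v v)) ->
  (forall u v, Cmod (b u v) <= C1 * norm u * norm v) ->
  is_antilinear l K -> exists u, forall phi, b u phi = l phi.
Proof.
intros Hc Hco Hbd Hl.
destruct (riesz_representation l K Hl) as [g Hg].
set (A := fun u : Y => iota (fun w : Y => forall phi, inner w phi = b u phi)).
assert (HA : forall u phi, inner (A u) phi = b u phi).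
{ intros u; apply (iota_correct (V := Y) (fun w => forall phi, inner w phi = b u phi)).
  (* The form becomes an operator: [A u] is the Riesz representative of [b u]. *)
  destruct (riesz_representation _ _ (form_antilinear C1 u (Hbd u))) as [w Hw].
  exists w; split; [exact Hw|]; intros w' Hw'; apply ip_ext; intros v; rewrite Hw; auto. }
(* A bound for the form that is positive and at least [c] whatever the sign of [C1], so that [kap]
   lies in [[0, 1)]. *)
set (C2 := Rabs C1 + c).
assert (HC2 : 0 < C2) by (generalize (Rabs_pos C1); unfold C2; lra).
assert (HcC : c <= C2) by (generalize (Rabs_pos C1); unfold C2; lra).
assert (HAn : forall u, norm (A u) <= C2 * norm u).
{ intros u; assert (Hu := hnorm_ge_0 u); assert (HAu := hnorm_ge_0 (A u)).
  assert (H := Rle_trans _ _ _ (Re_abs_le_Cmod _) (Hbd u (A u))).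
  rewrite <- HA, <- norm_sqr, Rabs_pos_eq in H by apply pow2_ge_0.
  assert (C1 <= C2) by (generalize (Rle_abs C1); unfold C2; lra).
  destruct (Req_dec (norm (A u)) 0) as [E|E]; [rewrite E; nra|].
  apply Rmult_le_reg_r with (norm (A u)); [lra|].
  assert (C1 * norm u * norm (A u) <= C2 * norm u * norm (A u)).
  { apply Rmult_le_compat_r; [exact HAu|]; apply Rmult_le_compat_r; assumption. }
  lra. }
assert (HAco : forall u, c * norm u ^ 2 <= Re (inner (A u) u)).
{ intros u; rewrite HA; apply Hco. }
assert (HAm : forall u v, A (minus u v) = minus (A u) (A v)).
{ intros u v; apply ip_ext; intros w; rewrite HA, ip_minus_l, form_minus_l, !HA; reflexivity. }
set (kap := 1 - c ^ 2 / C2 ^ 2).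
assert (HC22 : 0 < C2 ^ 2) by (apply pow_lt; exact HC2).
assert (Hkap : 0 <= kap < 1).
{ assert (0 < c ^ 2 / C2 ^ 2) by (apply Rdiv_lt_0_compat; [apply pow_lt|]; lra).
  assert (c ^ 2 / C2 ^ 2 <= 1).
  { apply Rmult_le_reg_r with (C2 ^ 2); [exact HC22|].
    unfold Rdiv; rewrite Rmult_assoc, Rinv_l by lra; nra. }
  unfold kap; lra. }
(* The minimiser of [1 - 2 rho c + rho ^ 2 C2 ^ 2], which bounds the growth of the squared residual
   in one step; the minimum is [kap]. *)
set (rho := c / C2 ^ 2).
assert (Hrho : 0 < rho) by (apply Rdiv_lt_0_compat; lra).
assert (Hres : forall n, exists u, norm (minus (A u) g) ^ 2 <= kap ^ n * norm (minus (A zero) g) ^ 2).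
{ induction n as [|n [u Hu]]; [exists zero; simpl; lra|].
  set (r := minus (A u) g : Y) in *.
  exists (minus u (scal (RtoC rho) r)).
  assert (E : minus (A (minus u (scal (RtoC rho) r))) g = plus r (scal (RtoC (- rho)) (A r))).
  { apply ip_ext; intros z.
    rewrite ip_minus_l, HA, form_minus_l, form_scal_l, ip_plus_l, ip_scal_l, !HA.
    unfold r at 2; rewrite ip_minus_l, HA, RtoC_opp; ring. }
  rewrite E, norm_plus_sqr, hnorm_scal, ip_scal_r, RtoC_Cconj, Re_scal_R, Cmod_R, Rabs_Ropp.
  rewrite Rpow_mult_distr, pow2_abs.
  assert (H1 := HAco r); assert (H2 := HAn r).
  replace (Re (inner r (A r))) with (Re (inner (A r) r)) by (rewrite ip_conj; reflexivity).
  assert (H3 : norm (A r) ^ 2 <= C2 ^ 2 * norm r ^ 2).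
  { rewrite <- Rpow_mult_distr; apply pow_incr; split; [apply hnorm_ge_0|exact H2]. }
  assert (Hk : norm r ^ 2 + 2 * (- rho * (c * norm r ^ 2)) + rho ^ 2 * (C2 ^ 2 * norm r ^ 2)
               = kap * norm r ^ 2) by (unfold rho, kap; field; lra).
  assert (0 <= rho ^ 2) by apply pow2_ge_0.
  apply Rle_trans with (kap * norm r ^ 2).
  - rewrite <- Hk; nra.
  - simpl pow at 2; rewrite Rmult_assoc; apply Rmult_le_compat_l; lra. }
destruct (nested_sets_limit Y (fun e u => norm (minus (A u) g) < e)) as [w Hw].
- intros e He.
  set (n0 := norm (minus (A zero) g) ^ 2) in *.
  assert (Hn0 : 0 <= n0) by apply pow2_ge_0.
  assert (He2 : 0 < e ^ 2) by (apply pow_lt; exact He).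
  destruct (pow_lt_1_zero kap ltac:(rewrite Rabs_pos_eq; lra) (e ^ 2 / (n0 + 1))) as [n Hn].
  { apply Rdiv_lt_0_compat; lra. }
  specialize (Hn n (le_n n)); rewrite Rabs_pos_eq in Hn by (apply pow_le; lra).
  destruct (Hres n) as [u Hu]; exists u.
  assert (Hlt : kap ^ n * n0 < e ^ 2).
  { apply (Rmult_lt_compat_r (n0 + 1)) in Hn; [|lra].
    replace (e ^ 2 / (n0 + 1) * (n0 + 1)) with (e ^ 2) in Hn by (field; lra).
    assert (0 <= kap ^ n) by (apply pow_le; lra); nra. }
  apply Rsqr_incrst_0; [unfold Rsqr; nra|apply hnorm_ge_0|lra].
- intros e e' u He Hu; lra.
(* Coercivity gives [c |u - v| <= |A (u - v)|], and two residuals below [c d / 2] keep the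
   right-hand side below [c d]. *)
- intros d Hd; exists (c * d / 2); split; [nra|]; intros u v Hu Hv.
  assert (H1 := HAco (minus u v)).
  assert (H2 := Re_inner_le (A (minus u v)) (minus u v)).
  assert (H3 : norm (A (minus u v)) < c * d).
  { rewrite HAm; apply Rle_lt_trans with (1 := norm_minus_trans _ g _).
    rewrite (norm_minus_sym g); lra. }
  apply Rabs_le_between in H2.
  assert (Hn := hnorm_ge_0 (minus u v)); assert (Hn' := hnorm_ge_0 (A (minus u v))).
  destruct (Req_dec (norm (minus u v)) 0) as [E|E]; [rewrite E; exact Hd|].
  assert (c * norm (minus u v) <= norm (A (minus u v))).
  { apply Rmult_le_reg_r with (norm (minus u v)); lra || nra. }
  apply Rmult_lt_reg_l with c; lra.
- exists w; intros phi; rewrite <- HA, <- Hg; f_equal; apply minus_eq_0, hnorm_eq_0.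
  destruct (Req_dec (norm (minus (A w) g)) 0) as [E|E]; [exact E|exfalso].
  assert (P : 0 < norm (minus (A w) g)) by (generalize (hnorm_ge_0 (minus (A w) g)); lra).
  (* A nonzero residual at [w] would exceed the residual at [u] plus the change of [A] from [u] to
     [w], each less than half of it. *)
  destruct (Hw (norm (minus (A w) g) / (2 * C2)) (norm (minus (A w) g) / 2)) as [u [H1 H2]].
  { apply Rdiv_lt_0_compat; lra. }
  { lra. }
  assert (H3 := norm_minus_trans (A w) (A u) g).
  rewrite <- HAm in H3; assert (H4 := HAn (minus w u)).
  rewrite (norm_minus_sym w u) in H4.
  apply (Rmult_lt_compat_l C2) in H2; [|exact HC2].
  replace (C2 * (norm (minus (A w) g) / (2 * C2))) with (norm (minus (A w) g) / 2) in H2 by (field; lra).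
  lra.
Qed.

End Sesquilinear.

(** * Complex differentiability *)

Lemma continuity_2d_pt_comp (f g h : R -> R -> R) (x y : R) :
  continuity_2d_pt f (g x y) (h x y) -> continuity_2d_pt g x y -> continuity_2d_pt h x y ->
  continuity_2d_pt (fun u v => f (g u v) (h u v)) x y.
Proof.
intros Hf Hg Hh eps; destruct (Hf eps) as [d Hd].
destruct (Hg d) as [d1 H1]; destruct (Hh d) as [d2 H2].
exists (mkposreal (Rmin d1 d2) (Rmin_stable_in_posreal d1 d2)); simpl; intros u v Hu Hv.
apply Hd; [apply H1|apply H2]; (eapply Rlt_le_trans; [eassumption|]);
  first [apply Rmin_l|apply Rmin_r].
Qed.

(** A quadratic remainder on the whole closed right half-plane in place of a limit, in the form in
    which the resolvent identity delivers it. *)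
Definition C_differentiable (g : C -> C) (z D : C) : Prop :=
  exists K, forall w : C, 0 <= Re w ->
    Cmod (Cminus (Cminus (g w) (g z)) (Cmult D (Cminus w z))) <= K * Cmod (Cminus w z) ^ 2.

Definition C_lipschitz_at (g : C -> C) (z : C) : Prop :=
  exists K, forall w : C, 0 <= Re w -> Cmod (Cminus (g w) (g z)) <= K * Cmod (Cminus w z).

Lemma Cmod_le_max (p q : R) : Cmod (p, q) <= 2 * Rmax (Rabs p) (Rabs q).
Proof.
replace (p, q) with (Cplus (RtoC p) (Cmult Ci (RtoC q)))
  by (unfold Cplus, Cmult, Ci, RtoC; simpl; f_equal; ring).
apply Rle_trans with (1 := Cmod_triangle _ _); rewrite Cmod_mult, Cmod_Ci, !Cmod_R.
generalize (Rmax_l (Rabs p) (Rabs q)) (Rmax_r (Rabs p) (Rabs q)); lra.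
Qed.

Lemma Im_abs_le_Cmod (c : C) : Rabs (Im c) <= Cmod c.
Proof. apply Rle_trans with (2 := Rmax_Cmod c), Rmax_r. Qed.

Lemma right_half_plane_locally (p q d : R) : 0 < p -> 0 < d ->
  exists e : posreal, forall u v, Rabs (u - p) < e -> Rabs (v - q) < e ->
    0 <= Re (u, v) /\ Rmax (Rabs (u - p)) (Rabs (v - q)) < d.
Proof.
intros Hp Hd; assert (Hm : 0 < Rmin p d) by now apply Rmin_glb_lt.
exists (mkposreal _ Hm); simpl; intros u v Hu Hv.
assert (H1 := Rmin_l p d); assert (H2 := Rmin_r p d); split.
- apply Rabs_lt_between in Hu; lra.
- apply Rmax_lub_lt; lra.
Qed.

Lemma C_differentiable_pair (g : C -> C) (p q : R) (D : C) :
  0 < p -> C_differentiable g (p, q) D ->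
  differentiable_pt_lim (fun u v => Re (g (u, v))) p q (Re D) (- Im D) /\
  differentiable_pt_lim (fun u v => Im (g (u, v))) p q (Im D) (Re D).
Proof.
intros Hp [K HK].
assert (HK' : forall w : C, 0 <= Re w ->
  Cmod (Cminus (Cminus (g w) (g (p, q))) (Cmult D (Cminus w (p, q)))) <= Rabs K * Cmod (Cminus w (p, q)) ^ 2).
{ intros w Hw; apply Rle_trans with (1 := HK w Hw), Rmult_le_compat_r; [apply pow2_ge_0|apply Rle_abs]. }
assert (HK0 := Rabs_pos K).
assert (H : forall eps : posreal, exists e : posreal, forall u v, Rabs (u - p) < e -> Rabs (v - q) < e ->
  Cmod (Cminus (Cminus (g (u, v)) (g (p, q))) (Cmult D (Cminus (u, v) (p, q))))
  <= eps * Rmax (Rabs (u - p)) (Rabs (v - q))).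
{ intros eps; assert (He := cond_pos eps).
  destruct (right_half_plane_locally p q (eps / (4 * Rabs K + 1)) Hp) as [e Hee].
  { apply Rdiv_lt_0_compat; lra. }
  exists e; intros u v Hu Hv; destruct (Hee u v Hu Hv) as [H1 H2].
  apply Rle_trans with (1 := HK' (u, v) H1).
  assert (H3 := Cmod_le_max (u - p) (v - q)).
  change (Cminus (u, v) (p, q)) with (u - p, v - q).
  set (m := Rmax (Rabs (u - p)) (Rabs (v - q))) in *.
  assert (Hm : 0 <= m) by (apply Rle_trans with (2 := Rmax_l _ _), Rabs_pos).
  assert (Hc := Cmod_ge_0 (u - p, v - q)).
  apply (Rmult_lt_compat_r (4 * Rabs K + 1)) in H2; [|lra].
  replace (eps / (4 * Rabs K + 1) * (4 * Rabs K + 1)) with (pos eps) in H2 by (field; lra).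
  assert (Cmod (u - p, v - q) ^ 2 <= 4 * m ^ 2) by nra.
  apply Rle_trans with (Rabs K * (4 * m ^ 2)); [apply Rmult_le_compat_l; lra|]; nra. }
split; intros eps; destruct (H eps) as [e He]; exists e; intros u v Hu Hv;
  apply Rle_trans with (2 := He u v Hu Hv).
- apply Rle_trans with (2 := Re_abs_le_Cmod _); right; f_equal.
  destruct (g (u, v)), (g (p, q)), D; unfold Re, Im; simpl; ring.
- apply Rle_trans with (2 := Im_abs_le_Cmod _); right; f_equal.
  destruct (g (u, v)), (g (p, q)), D; unfold Re, Im; simpl; ring.
Qed.

Lemma C_lipschitz_pair (g : C -> C) (p q : R) :
  0 < p -> C_lipschitz_at g (p, q) ->
  continuity_2d_pt (fun u v => Re (g (u, v))) p q /\
  continuity_2d_pt (fun u v => Im (g (u, v))) p q.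
Proof.
intros Hp [K HK]; assert (HK0 := Rabs_pos K).
assert (H : forall eps : posreal, exists e : posreal, forall u v, Rabs (u - p) < e -> Rabs (v - q) < e ->
  Cmod (Cminus (g (u, v)) (g (p, q))) < eps).
{ intros eps; assert (He := cond_pos eps).
  destruct (right_half_plane_locally p q (eps / (2 * Rabs K + 1)) Hp) as [e Hee].
  { apply Rdiv_lt_0_compat; lra. }
  exists e; intros u v Hu Hv; destruct (Hee u v Hu Hv) as [H1 H2].
  apply Rle_lt_trans with (1 := HK (u, v) H1).
  assert (H3 := Cmod_le_max (u - p) (v - q)).
  change (Cminus (u, v) (p, q)) with (u - p, v - q).
  set (m := Rmax (Rabs (u - p)) (Rabs (v - q))) in *.
  assert (Hm : 0 <= m) by (apply Rle_trans with (2 := Rmax_l _ _), Rabs_pos).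
  assert (Hc := Cmod_ge_0 (u - p, v - q)).
  apply (Rmult_lt_compat_r (2 * Rabs K + 1)) in H2; [|lra].
  replace (eps / (2 * Rabs K + 1) * (2 * Rabs K + 1)) with (pos eps) in H2 by (field; lra).
  assert (K <= Rabs K) by apply Rle_abs.
  apply Rle_lt_trans with (Rabs K * Cmod (u - p, v - q)); [apply Rmult_le_compat_r; lra|].
  apply Rle_lt_trans with (Rabs K * (2 * m)); [apply Rmult_le_compat_l; lra|]; nra. }
split; intros eps; destruct (H eps) as [e He]; exists e; intros u v Hu Hv;
  apply Rle_lt_trans with (2 := He u v Hu Hv).
- exact (Re_abs_le_Cmod (Cminus (g (u, v)) (g (p, q)))).
- exact (Im_abs_le_Cmod (Cminus (g (u, v)) (g (p, q)))).
Qed.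

Definition cexp (x y : R) : C := (exp x * cos y, exp x * sin y).

Lemma Cmod_cexp (x y : R) : Cmod (cexp x y) = exp x.
Proof.
unfold cexp, Cmod; simpl.
replace (_ + _) with (Rsqr (exp x)).
- apply sqrt_Rsqr; left; apply exp_pos.
- unfold Rsqr; generalize (sin2_cos2 y); unfold Rsqr; intros E.
  transitivity (exp x * exp x * (sin y * sin y + cos y * cos y)); [rewrite E|]; ring.
Qed.

Lemma Re_cexp_pos (x y : R) : Rabs y < PI / 2 -> 0 < Re (cexp x y).
Proof.
intros H; apply Rabs_lt_between in H; unfold Re; simpl.
apply Rmult_lt_0_compat; [apply exp_pos|apply cos_gt_0; lra].
Qed.

(** [cexp] maps the strip into the right half-plane. The chain rule gives the derivative
    [D (e^z) e^z], whose continuity rests on the Lipschitz hypothesis for [D]. *)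
Lemma holomorphic_pair_comp_exp (g D : C -> C) :
  (forall z, 0 < Re z -> C_differentiable g z (D z)) ->
  (forall z, 0 < Re z -> C_lipschitz_at D z) ->
  holomorphic_pair (fun x y => Re (g (cexp x y))) (fun x y => Im (g (cexp x y))).
Proof.
intros Hg HD.
assert (Hc : forall x y, continuity_2d_pt (fun x y => exp x * cos y) x y /\
                         continuity_2d_pt (fun x y => exp x * sin y) x y).
{ intros x y; split; apply continuity_2d_pt_mult;
    first [apply (continuity_2d_pt_comp1 exp)
          |apply (continuity_2d_pt_comp2 cos)|apply (continuity_2d_pt_comp2 sin)];
    apply continuity_pt_derive; auto_derive; exact Logic.I. }
exists (fun x y => Re (Cmult (D (cexp x y)) (cexp x y))),
       (fun x y => Im (Cmult (D (cexp x y)) (cexp x y))).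
assert (Hdx : forall x y, derivable_pt_lim (fun x => exp x * cos y) x (exp x * cos y) /\
                          derivable_pt_lim (fun x => exp x * sin y) x (exp x * sin y)).
{ intros x y; split; apply is_derive_Reals; auto_derive; try exact Logic.I; ring. }
assert (Hdy : forall x y, derivable_pt_lim (fun y => exp x * cos y) y (- (exp x * sin y)) /\
                          derivable_pt_lim (fun y => exp x * sin y) y (exp x * cos y)).
{ intros x y; split; apply is_derive_Reals; auto_derive; try exact Logic.I; ring. }
assert (Hdiff : forall x y, Rabs y < PI / 2 ->
  differentiable_pt_lim (fun u v => Re (g (u, v))) (exp x * cos y) (exp x * sin y)
    (Re (D (cexp x y))) (- Im (D (cexp x y))) /\
  differentiable_pt_lim (fun u v => Im (g (u, v))) (exp x * cos y) (exp x * sin y)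
    (Im (D (cexp x y))) (Re (D (cexp x y)))).
{ intros x y Hy; apply C_differentiable_pair.
  - exact (Re_cexp_pos x y Hy).
  - apply Hg, Re_cexp_pos, Hy. }
split; intros x y Hy; try (destruct (Hdiff x y Hy) as [D1 D2]; destruct (Hdx x y) as [X1 X2];
   destruct (Hdy x y) as [Y1 Y2]).
- eapply is_derive_eq; [apply is_derive_Reals|].
  + exact (derivable_pt_lim_comp_2d _ _ (fun x => exp x * sin y) _ _ _ _ _ D1 X1 X2).
  + unfold Re, Im, Cmult, cexp; simpl; ring.
- eapply is_derive_eq; [apply is_derive_Reals|].
  + exact (derivable_pt_lim_comp_2d _ _ (fun x => exp x * sin y) _ _ _ _ _ D2 X1 X2).
  + unfold Re, Im, Cmult, cexp; simpl; ring.
- eapply is_derive_eq; [apply is_derive_Reals|].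
  + exact (derivable_pt_lim_comp_2d _ (fun y => exp x * cos y) (fun y => exp x * sin y) _ _ _ _ _ D1 Y1 Y2).
  + unfold Re, Im, Cmult, cexp; simpl; ring.
- eapply is_derive_eq; [apply is_derive_Reals|].
  + exact (derivable_pt_lim_comp_2d _ (fun y => exp x * cos y) (fun y => exp x * sin y) _ _ _ _ _ D2 Y1 Y2).
  + unfold Re, Im, Cmult, cexp; simpl; ring.
- apply (continuity_2d_pt_comp (fun u v => Re (g (u, v)))); try apply Hc.
  apply differentiable_continuity_pt; eexists; eexists; exact D1.
- apply (continuity_2d_pt_comp (fun u v => Im (g (u, v)))); try apply Hc.
  apply differentiable_continuity_pt; eexists; eexists; exact D2.
- destruct (C_lipschitz_pair D (exp x * cos y) (exp x * sin y)) as [L1 L2].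
  { exact (Re_cexp_pos x y Hy). }
  { apply HD, Re_cexp_pos, Hy. }
  destruct (Hc x y) as [H1 H2].
  apply continuity_2d_pt_minus; apply continuity_2d_pt_mult; auto.
  + exact (continuity_2d_pt_comp (fun u v => Re (D (u, v))) _ _ x y L1 H1 H2).
  + exact (continuity_2d_pt_comp (fun u v => Im (D (u, v))) _ _ x y L2 H1 H2).
- destruct (C_lipschitz_pair D (exp x * cos y) (exp x * sin y)) as [L1 L2].
  { exact (Re_cexp_pos x y Hy). }
  { apply HD, Re_cexp_pos, Hy. }
  destruct (Hc x y) as [H1 H2].
  apply continuity_2d_pt_plus; apply continuity_2d_pt_mult; auto.
  + exact (continuity_2d_pt_comp (fun u v => Re (D (u, v))) _ _ x y L1 H1 H2).
  + exact (continuity_2d_pt_comp (fun u v => Im (D (u, v))) _ _ x y L2 H1 H2).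
Qed.

(** * The resolvent in the right half-plane *)

Record regularly_accretive {X Y : HilbertSpace} (j : Y -> X) (a : Y -> Y -> C) (c0 C0 : R) : Prop := {
  ra_c0 : 0 < c0;
  ra_C0 : 0 < C0;
  ra_embedding : is_dense_embedding j;
  ra_norm : forall y : Y, norm (j y) <= norm y;
  ra_form : is_sesquilinear a;
  ra_coercive : forall v : Y, c0 * norm v ^ 2 <= Re (a v v);
  ra_bounded : forall u v : Y, Cmod (a u v) <= C0 * norm u * norm v
}.

Section Resolvent.

Context {X Y : HilbertSpace} (j : Y -> X) (a : Y -> Y -> C) (c0 C0 : R).
Context (HA : regularly_accretive j a c0 C0).

Lemma j_plus (u v : Y) : j (plus u v) = plus (j u) (j v).
Proof. exact (linear_plus j (embedding_linear _ (ra_embedding _ _ _ _ HA)) u v). Qed.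

Lemma j_scal (c : C) (u : Y) : j (scal c u) = scal c (j u).
Proof. exact (linear_scal j (embedding_linear _ (ra_embedding _ _ _ _ HA)) c u). Qed.

Lemma j_inj (u v : Y) : j u = j v -> u = v.
Proof. exact (embedding_injective _ (ra_embedding _ _ _ _ HA) u v). Qed.

Lemma j_dense (x : X) (eps : R) : 0 < eps -> exists u : Y, norm (minus (j u) x) < eps.
Proof.
intros He; exact (embedding_dense _ (ra_embedding _ _ _ _ HA) x (mkposreal eps He)).
Qed.

Lemma dense_ip_zero (f : X) : (forall phi, inner f (j phi) = RtoC 0) -> f = zero.
Proof.
intros H; apply hnorm_eq_0.
destruct (Req_dec (norm f) 0) as [E|E]; [exact E|exfalso].
assert (P : 0 < norm f) by (generalize (hnorm_ge_0 f); lra).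
destruct (j_dense f (norm f / 2) ltac:(lra)) as [u Hu].
assert (H1 := Re_inner_le f (minus (j u) f)).
rewrite ip_minus_r, H, ip_self in H1.
replace (Re (Cminus (RtoC 0) (RtoC (norm f ^ 2)))) with (- norm f ^ 2) in H1
  by (unfold Re, Cminus, Cplus, Copp, RtoC; simpl; ring).
rewrite Rabs_Ropp, Rabs_pos_eq in H1 by apply pow2_ge_0; nra.
Qed.

Definition shifted_form (z : C) (u v : Y) : C := Cplus (a u v) (Cmult z (inner (j u) (j v))).

Lemma shifted_form_sesquilinear (z : C) : is_sesquilinear (shifted_form z).
Proof.
assert (Ha := ra_form _ _ _ _ HA); split; unfold shifted_form.
- intros u v w; change (j (plus u v)) with (j (plus (u : Y) v)).
  rewrite (sesqui_plus_l _ Ha), j_plus, ip_plus_l; ring.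
- intros c u v; change (j (scal c u)) with (j (scal c (u : Y))).
  rewrite (sesqui_scal_l _ Ha), j_scal, ip_scal_l; ring.
- intros u v w; change (j (plus v w)) with (j (plus (v : Y) w)).
  rewrite (sesqui_plus_r _ Ha), j_plus, ip_plus_r; ring.
- intros c u v; change (j (scal c v)) with (j (scal c (v : Y))).
  rewrite (sesqui_scal_r _ Ha), j_scal, ip_scal_r; ring.
Qed.

(** The added term has nonnegative real part, so the coercivity constant does not deteriorate with
    [z]. The upper bound of the form does grow, but it enters only the existence of solutions. *)
Lemma shifted_form_coercive (z : C) (v : Y) : 0 <= Re z ->
  c0 * norm v ^ 2 <= Re (shifted_form z v v).
Proof.
intros Hz; unfold shifted_form; rewrite ip_self.
apply Rle_trans with (1 := ra_coercive _ _ _ _ HA v).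
assert (0 <= norm (j v) ^ 2) by apply pow2_ge_0.
replace (Re (Cplus (a v v) (Cmult z (RtoC (norm (j v) ^ 2)))))
  with (Re (a v v) + Re z * norm (j v) ^ 2); [nra|].
unfold Re, Cplus, Cmult, RtoC; simpl; ring.
Qed.

Lemma shifted_form_bounded (z : C) (u v : Y) :
  Cmod (shifted_form z u v) <= (C0 + Cmod z) * norm u * norm v.
Proof.
unfold shifted_form; apply Rle_trans with (1 := Cmod_triangle _ _); rewrite Cmod_mult.
assert (H1 := ra_bounded _ _ _ _ HA u v).
assert (H2 := cauchy_schwarz (j u) (j v)).
assert (Hu := ra_norm _ _ _ _ HA u); assert (Hv := ra_norm _ _ _ _ HA v).
assert (Hz := Cmod_ge_0 z).
assert (H3 : norm (j u) * norm (j v) <= norm u * norm v).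
{ apply Rmult_le_compat; auto using hnorm_ge_0. }
assert (H4 : Cmod z * Cmod (inner (j u) (j v)) <= Cmod z * (norm u * norm v)).
{ apply Rmult_le_compat_l; lra. }
lra.
Qed.

Definition rsol (z : C) (f : X) : Y :=
  iota (fun u : Y => forall phi, shifted_form z u phi = inner f (j phi)).

(* The resolvent at the complex point [z]. *)
Definition Rz (z : C) (f : X) : X := j (rsol z f).

Lemma rsol_unique (z : C) (f : X) (u : Y) : 0 <= Re z ->
  (forall phi, shifted_form z u phi = inner f (j phi)) -> rsol z f = u.
Proof.
intros Hz Hu; apply (iota_unique (V := Y)); [|exact Hu].
intros v Hv; apply (coercive_unique (shifted_form z) (shifted_form_sesquilinear z) c0).
- exact (ra_c0 _ _ _ _ HA).
- intros w; now apply shifted_form_coercive.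
- intros phi; rewrite Hu, Hv; reflexivity.
Qed.

Lemma rsol_spec (z : C) (f : X) : 0 <= Re z ->
  forall phi, shifted_form z (rsol z f) phi = inner f (j phi).
Proof.
intros Hz.
destruct (lax_milgram (shifted_form z) (shifted_form_sesquilinear z) c0 (C0 + Cmod z) (norm f)
  (fun phi => inner f (j phi)) (ra_c0 _ _ _ _ HA)) as [u Hu].
- intros v; now apply shifted_form_coercive.
- apply shifted_form_bounded.
- split.
  + intros u v; rewrite j_plus, ip_plus_r; reflexivity.
  + intros c u; rewrite j_scal, ip_scal_r; reflexivity.
  + intros u; apply Rle_trans with (1 := cauchy_schwarz _ _), Rmult_le_compat_l;
      [apply hnorm_ge_0|apply (ra_norm _ _ _ _ HA)].
- rewrite (rsol_unique z f u Hz Hu); exact Hu.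
Qed.

Lemma Rz_plus (z : C) (f g : X) : 0 <= Re z -> Rz z (plus f g) = plus (Rz z f) (Rz z g).
Proof.
intros Hz; unfold Rz; rewrite <- j_plus; f_equal; apply rsol_unique; [exact Hz|].
intros phi; rewrite (form_plus_l _ (shifted_form_sesquilinear z)), !rsol_spec, ip_plus_l by exact Hz.
reflexivity.
Qed.

Lemma Rz_scal (z c : C) (f : X) : 0 <= Re z -> Rz z (scal c f) = scal c (Rz z f).
Proof.
intros Hz; unfold Rz; rewrite <- j_scal; f_equal; apply rsol_unique; [exact Hz|].
intros phi; rewrite (form_scal_l _ (shifted_form_sesquilinear z)), rsol_spec, ip_scal_l by exact Hz.
reflexivity.
Qed.

Lemma resolvent_identity (z w : C) (f : X) : 0 <= Re z -> 0 <= Re w ->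
  Rz z f = plus (Rz w f) (scal (Cminus w z) (Rz w (Rz z f))).
Proof.
intros Hz Hw; rewrite <- Rz_scal, <- Rz_plus by exact Hw.
unfold Rz at 1 2; f_equal; symmetry; apply rsol_unique; [exact Hw|].
intros phi; rewrite ip_plus_l, ip_scal_l, <- (rsol_spec z f Hz).
unfold shifted_form, Rz; ring.
Qed.

Lemma Rz_comm (z w : C) (f : X) : 0 <= Re z -> 0 <= Re w -> Rz z (Rz w f) = Rz w (Rz z f).
Proof.
intros Hz Hw; destruct (Ceq_dec z w) as [->|Hne]; [reflexivity|].
assert (E1 := resolvent_identity z w f Hz Hw); assert (E2 := resolvent_identity w z f Hw Hz).
apply ip_ext; intros v.
apply (f_equal (fun t => inner t v)) in E1; apply (f_equal (fun t => inner t v)) in E2.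
rewrite ip_plus_l, ip_scal_l in E1, E2.
assert (Hd : Cminus w z <> RtoC 0).
{ intros E; apply Hne; replace w with (Cplus (Cminus w z) z) by ring; rewrite E; ring. }
assert (E : Cmult (Cminus w z) (inner (Rz z (Rz w f)) v) = Cmult (Cminus w z) (inner (Rz w (Rz z f)) v)).
{ transitivity (Cminus (inner (Rz z f) v) (inner (Rz w f) v)).
  - rewrite E2; ring.
  - rewrite E1; ring. }
apply (f_equal (Cmult (Cinv (Cminus w z)))) in E.
rewrite !Cmult_assoc, Cinv_l, !Cmult_1_l in E by exact Hd; exact E.
Qed.

Lemma Rz_bound_c0 (z : C) (f : X) : 0 <= Re z -> norm (Rz z f) <= / c0 * norm f.
Proof.
intros Hz; set (u := rsol z f); change (Rz z f) with (j u).
assert (Hc := ra_c0 _ _ _ _ HA).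
assert (H1 := shifted_form_coercive z u Hz); unfold u at 2 in H1; rewrite rsol_spec in H1 by exact Hz.
fold u in H1.
assert (H2 := Re_inner_le f (j u)); apply Rabs_le_between in H2.
assert (H3 := ra_norm _ _ _ _ HA u).
assert (Hj := hnorm_ge_0 (j u)); assert (Hu := hnorm_ge_0 u); assert (Hf := hnorm_ge_0 f).
assert (H4 : c0 * norm u ^ 2 <= norm f * norm u) by nra.
apply Rmult_le_reg_l with c0; [exact Hc|].
rewrite <- Rmult_assoc, Rinv_r, Rmult_1_l by lra.
destruct (Req_dec (norm u) 0) as [E|E]; [rewrite E in H3; nra|].
apply Rle_trans with (c0 * norm u); [apply Rmult_le_compat_l; lra|].
apply Rmult_le_reg_r with (norm u); [lra|]; lra || nra.
Qed.

(** Testing with the solution [u] expresses [z |j u|^2] by [inner f (j u)] and [a u u]. The latter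
    is at most [C0 |u|^2], which coercivity bounds by [C0 / c0] times [|f| |j u|]. This gives decay
    [1 / |z|] up to the imaginary axis. *)
Lemma Rz_bound_sector (z : C) (f : X) : 0 <= Re z ->
  Cmod z * norm (Rz z f) <= (1 + C0 / c0) * norm f.
Proof.
intros Hz; set (u := rsol z f); change (Rz z f) with (j u).
assert (Hc := ra_c0 _ _ _ _ HA); assert (HC := ra_C0 _ _ _ _ HA).
assert (H1 := shifted_form_coercive z u Hz); unfold u at 2 in H1.
assert (Es := rsol_spec z f Hz u); fold u in Es.
unfold u at 2 in H1; fold u in H1; rewrite Es in H1.
assert (H2 := Re_inner_le f (j u)); apply Rabs_le_between in H2.
assert (H3 := cauchy_schwarz f (j u)).
assert (H4 := ra_bounded _ _ _ _ HA u u).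
assert (Hj := hnorm_ge_0 (j u)); assert (Hf := hnorm_ge_0 f).
assert (E : Cmult z (inner (j u) (j u)) = Cminus (inner f (j u)) (a u u)).
{ rewrite <- Es; unfold shifted_form; ring. }
assert (H5 : Cmod z * norm (j u) ^ 2 <= norm f * norm (j u) + C0 * norm u ^ 2).
{ replace (Cmod z * norm (j u) ^ 2) with (Cmod (Cmult z (inner (j u) (j u)))).
  - rewrite E; unfold Cminus; apply Rle_trans with (1 := Cmod_triangle _ _); rewrite Cmod_opp.
    replace (C0 * norm u ^ 2) with (C0 * norm u * norm u) by ring; lra.
  - rewrite Cmod_mult, ip_self, Cmod_R, Rabs_pos_eq by apply pow2_ge_0; reflexivity. }
assert (H6 : C0 * norm u ^ 2 <= C0 / c0 * (norm f * norm (j u))).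
{ apply Rmult_le_reg_l with (c0 / C0); [apply Rdiv_lt_0_compat; lra|].
  replace (c0 / C0 * (C0 * norm u ^ 2)) with (c0 * norm u ^ 2) by (field; lra).
  replace (c0 / C0 * (C0 / c0 * (norm f * norm (j u)))) with (norm f * norm (j u)) by (field; lra).
  lra. }
assert (HD : 0 < C0 / c0) by (apply Rdiv_lt_0_compat; lra).
destruct (Req_dec (norm (j u)) 0) as [E0|E0].
{ rewrite E0, Rmult_0_r; apply Rmult_le_pos; lra. }
apply Rmult_le_reg_r with (norm (j u)); [lra|].
replace (Cmod z * norm (j u) * norm (j u)) with (Cmod z * norm (j u) ^ 2) by ring.
apply Rle_trans with (1 := H5); lra.
Qed.

Definition res_const : R := / c0 + (1 + C0 / c0).

Lemma res_const_pos : 0 < res_const.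
Proof.
assert (Hc := ra_c0 _ _ _ _ HA); assert (HC := ra_C0 _ _ _ _ HA).
assert (0 < / c0) by (apply Rinv_0_lt_compat; lra).
assert (0 < C0 / c0) by (apply Rdiv_lt_0_compat; lra); unfold res_const; lra.
Qed.

Lemma Rz_bound (z : C) (f : X) : 0 <= Re z ->
  norm (Rz z f) <= res_const / (1 + Cmod z) * norm f.
Proof.
intros Hz; assert (H1 := Rz_bound_c0 z f Hz); assert (H2 := Rz_bound_sector z f Hz).
assert (Hm := Cmod_ge_0 z).
apply Rmult_le_reg_l with (1 + Cmod z); [lra|].
replace ((1 + Cmod z) * (res_const / (1 + Cmod z) * norm f)) with (res_const * norm f) by (field; lra).
unfold res_const; lra.
Qed.

Lemma Rz_bound_uniform (z : C) (f : X) : 0 <= Re z -> norm (Rz z f) <= res_const * norm f.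
Proof.
intros Hz; apply Rle_trans with (1 := Rz_bound z f Hz).
apply Rmult_le_compat_r; [apply hnorm_ge_0|].
assert (Hm := Cmod_ge_0 z); assert (Hr := res_const_pos).
apply Rmult_le_reg_r with (1 + Cmod z); [lra|].
unfold Rdiv; rewrite Rmult_assoc, Rinv_l by lra; nra.
Qed.

(* [A R(z) f = f - z R(z) f] *)
Definition ARz (z : C) (f : X) : X := minus f (scal z (Rz z f)).

Lemma ARz_bound (z : C) (f : X) : 0 <= Re z -> norm (ARz z f) <= (1 + res_const) * norm f.
Proof.
intros Hz; unfold ARz.
apply Rle_trans with (norm f + norm (scal z (Rz z f))).
{ change (minus f (scal z (Rz z f))) with (plus f (opp (scal z (Rz z f) : X))).
  apply Rle_trans with (1 := hnorm_triangle _ _); rewrite hnorm_opp; lra. }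
rewrite hnorm_scal; assert (H := Rz_bound_sector z f Hz).
assert (0 < / c0) by (apply Rinv_0_lt_compat, (ra_c0 _ _ _ _ HA)).
generalize (hnorm_ge_0 f); unfold res_const; nra.
Qed.

(** The factor [A] can be attached to either resolvent, and the other one then provides the decay;
    [error_in_domain] uses both choices. *)
Lemma ARz_Rz_comm (z w : C) (f : X) : 0 <= Re z -> 0 <= Re w -> ARz z (Rz w f) = ARz w (Rz z f).
Proof.
intros Hz Hw; unfold ARz; apply ip_ext; intros v.
assert (E := f_equal (fun t => inner t v) (resolvent_identity z w f Hz Hw)).
cbv beta in E; rewrite ip_plus_l, ip_scal_l in E.
rewrite !ip_minus_l, !ip_scal_l, (Rz_comm z w f Hz Hw), E; ring.
Qed.

Lemma Rz0_ARz (z : C) (f : X) : 0 <= Re z -> Rz (RtoC 0) (ARz z f) = Rz z f.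
Proof.
assert (H0 : 0 <= Re (RtoC 0)) by (simpl; lra).
intros Hz; rewrite (resolvent_identity z (RtoC 0) f Hz H0).
unfold ARz; change (minus f (scal z (Rz z f))) with (plus f (opp (scal z (Rz z f) : X))).
rewrite Rz_plus by exact H0.
apply ip_ext; intros v; rewrite !ip_plus_l, ip_scal_l; f_equal.
replace (opp (scal z (Rz z f) : X)) with (scal (Copp z) (Rz z f)).
- rewrite Rz_scal, ip_scal_l by exact H0; ring.
- apply ip_ext; intros w; rewrite ip_opp_l, !ip_scal_l; ring.
Qed.

Lemma solution_op_rsol (f : X) : j (solution_op j a f) = Rz (RtoC 0) f.
Proof.
assert (H0 : 0 <= Re (RtoC 0)) by (simpl; lra).
unfold Rz; f_equal; unfold solution_op; apply (iota_unique (V := Y)).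
- intros u Hu; symmetry; apply rsol_unique; [exact H0|].
  intros phi; rewrite <- Hu; unfold shifted_form; ring.
- intros phi; rewrite <- (rsol_spec (RtoC 0) f H0); unfold shifted_form; ring.
Qed.

Lemma Rz0_inj (f g : X) : Rz (RtoC 0) f = Rz (RtoC 0) g -> f = g.
Proof.
assert (H0 : 0 <= Re (RtoC 0)) by (simpl; lra).
intros H; apply j_inj in H; apply minus_eq_0, dense_ip_zero; intros phi.
rewrite ip_minus_l, <- !(rsol_spec (RtoC 0) _ H0), H; ring.
Qed.

Lemma dom_Rz0 (f : X) : dom j a (Rz (RtoC 0) f).
Proof. exists f; apply solution_op_rsol. Qed.

Lemma op_Rz0 (f : X) : op j a (Rz (RtoC 0) f) = f.
Proof.
apply (iota_unique (V := X)).
- intros g Hg; rewrite solution_op_rsol in Hg; apply Rz0_inj, Hg.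
- apply solution_op_rsol.
Qed.

(** An element of the domain is [R(0) g] for some [g], and the resolvent identity turns
    [mu R(0) g + g = f] into [R(0) g = R(mu) f]. Existence is the formula
    [A R(mu) f = f - mu R(mu) f]. *)
Lemma resolvent_Rz (mu : R) (f : X) : 0 <= mu -> resolvent j a mu f = Rz (RtoC mu) f.
Proof.
assert (H0 : 0 <= Re (RtoC 0)) by (simpl; lra).
intros Hmu; assert (Hm : 0 <= Re (RtoC mu)) by exact Hmu.
apply (iota_unique (V := X)).
- intros u [[g Hg] Hu]; rewrite solution_op_rsol in Hg; subst u; rewrite op_Rz0 in Hu.
  change (plus (scal (RtoC mu) (Rz (RtoC 0) g) : X) g = f) in Hu.
  rewrite (resolvent_identity (RtoC 0) (RtoC mu) g H0 Hm), <- Hu, Rz_plus, Rz_scal by exact Hm.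
  apply ip_ext; intros v; rewrite !ip_plus_l, !ip_scal_l; ring.
- rewrite <- Rz0_ARz by exact Hm; split; [apply dom_Rz0|].
  rewrite op_Rz0, Rz0_ARz by exact Hm; unfold ARz.
  change (plus (scal (RtoC mu) (Rz (RtoC mu) f) : X) (minus f (scal (RtoC mu) (Rz (RtoC mu) f))) = f).
  apply ip_ext; intros v; rewrite ip_plus_l, ip_minus_l, ip_scal_l; ring.
Qed.

Lemma Rz_lipschitz (z w : C) (f : X) : 0 <= Re z -> 0 <= Re w ->
  norm (minus (Rz w f) (Rz z f)) <= res_const ^ 2 * norm f * Cmod (Cminus w z).
Proof.
intros Hz Hw.
replace (minus (Rz w f) (Rz z f)) with (scal (Cminus z w) (Rz z (Rz w f))).
- rewrite hnorm_scal; replace (Cminus z w) with (Copp (Cminus w z)) by ring; rewrite Cmod_opp.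
  assert (H1 := Rz_bound_uniform z (Rz w f) Hz); assert (H2 := Rz_bound_uniform w f Hw).
  assert (Hr := res_const_pos); assert (Hc := Cmod_ge_0 (Cminus w z)).
  assert (norm (Rz z (Rz w f)) <= res_const ^ 2 * norm f).
  { apply Rle_trans with (1 := H1); replace (res_const ^ 2 * norm f) with (res_const * (res_const * norm f)) by ring.
    apply Rmult_le_compat_l; lra. }
  rewrite Rmult_comm; apply Rmult_le_compat_r; assumption.
- rewrite (resolvent_identity w z f Hw Hz) at 2.
  apply ip_ext; intros v; rewrite ip_minus_l, ip_plus_l; ring.
Qed.

(** Two applications of the resolvent identity leave the remainder [(w - z)^2 R(z) R(z) R(w) f]. *)
Lemma Rz_differentiable (z : C) (f v : X) : 0 <= Re z ->
  C_differentiable (fun z => inner (Rz z f) v) z (Copp (inner (Rz z (Rz z f)) v)).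
Proof.
intros Hz; exists (res_const ^ 3 * norm f * norm v); intros w Hw.
replace (Cminus (Cminus (inner (Rz w f) v) (inner (Rz z f) v))
           (Cmult (Copp (inner (Rz z (Rz z f)) v)) (Cminus w z)))
  with (Cmult (Cmult (Cminus w z) (Cminus w z)) (inner (Rz z (Rz z (Rz w f))) v)).
- rewrite !Cmod_mult.
  assert (Hr := res_const_pos); assert (Hc := Cmod_ge_0 (Cminus w z)).
  assert (H1 := cauchy_schwarz (Rz z (Rz z (Rz w f))) v).
  assert (H2 : norm (Rz z (Rz z (Rz w f))) <= res_const ^ 3 * norm f).
  { apply Rle_trans with (1 := Rz_bound_uniform _ _ Hz).
    replace (res_const ^ 3 * norm f) with (res_const * (res_const * (res_const * norm f))) by ring.
    apply Rmult_le_compat_l; [lra|]; apply Rle_trans with (1 := Rz_bound_uniform _ _ Hz).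
    apply Rmult_le_compat_l; [lra|]; exact (Rz_bound_uniform _ _ Hw). }
  assert (H3 : norm (Rz z (Rz z (Rz w f))) * norm v <= res_const ^ 3 * norm f * norm v).
  { apply Rmult_le_compat_r; [apply hnorm_ge_0|exact H2]. }
  replace (res_const ^ 3 * norm f * norm v * Cmod (Cminus w z) ^ 2)
    with (Cmod (Cminus w z) * Cmod (Cminus w z) * (res_const ^ 3 * norm f * norm v)) by ring.
  apply Rmult_le_compat_l; [apply Rmult_le_pos; exact Hc|lra].
- assert (E1 := resolvent_identity w z f Hw Hz).
  assert (E2 := f_equal (Rz z) E1); rewrite Rz_plus, Rz_scal in E2 by exact Hz.
  apply (f_equal (fun t => inner t v)) in E1; apply (f_equal (fun t => inner t v)) in E2.
  rewrite ip_plus_l, ip_scal_l in E1, E2; rewrite E1, E2; ring.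
Qed.

Lemma Rz_sqr_lipschitz (z : C) (f v : X) : 0 <= Re z ->
  C_lipschitz_at (fun z => Copp (inner (Rz z (Rz z f)) v)) z.
Proof.
intros Hz; exists (2 * res_const ^ 3 * norm f * norm v); intros w Hw.
assert (Hr := res_const_pos); assert (Hc := Cmod_ge_0 (Cminus w z)).
replace (Cminus (Copp (inner (Rz w (Rz w f)) v)) (Copp (inner (Rz z (Rz z f)) v)))
  with (Copp (inner (plus (minus (Rz w (Rz w f)) (Rz z (Rz w f)) : X)
                          (Rz z (minus (Rz w f) (Rz z f)))) v)).
- rewrite Cmod_opp; apply Rle_trans with (1 := cauchy_schwarz _ _).
  replace (2 * res_const ^ 3 * norm f * norm v * Cmod (Cminus w z))
    with (2 * res_const ^ 3 * norm f * Cmod (Cminus w z) * norm v) by ring.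
  apply Rmult_le_compat_r; [apply hnorm_ge_0|].
  apply Rle_trans with (1 := hnorm_triangle _ _).
  assert (H1 := Rz_lipschitz z w (Rz w f) Hz Hw).
  assert (H2 := Rz_bound_uniform z (minus (Rz w f) (Rz z f)) Hz).
  assert (H3 := Rz_lipschitz z w f Hz Hw).
  assert (H4 := Rz_bound_uniform w f Hw).
  assert (H5 : res_const ^ 2 * norm (Rz w f) * Cmod (Cminus w z)
               <= res_const ^ 3 * norm f * Cmod (Cminus w z)).
  { apply Rmult_le_compat_r; [exact Hc|].
    replace (res_const ^ 3 * norm f) with (res_const ^ 2 * (res_const * norm f)) by ring.
    apply Rmult_le_compat_l; [apply pow2_ge_0|exact H4]. }
  assert (H6 : res_const * norm (minus (Rz w f) (Rz z f)) <= res_const ^ 3 * norm f * Cmod (Cminus w z)).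
  { replace (res_const ^ 3 * norm f * Cmod (Cminus w z))
      with (res_const * (res_const ^ 2 * norm f * Cmod (Cminus w z))) by ring.
    apply Rmult_le_compat_l; lra. }
  lra.
- change (minus (Rz w f) (Rz z f)) with (plus (Rz w f) (opp (Rz z f))).
  rewrite Rz_plus by exact Hz.
  replace (opp (Rz z f)) with (scal (Copp (RtoC 1)) (Rz z f)).
  + rewrite Rz_scal, !ip_plus_l, ip_minus_l, ip_scal_l by exact Hz; ring.
  + apply ip_ext; intros t; rewrite ip_opp_l, ip_scal_l; ring.
Qed.

End Resolvent.

(** * Fractional powers *)

Notation realified := real_CompleteNormedModule.

(** Integrals are taken in the realified space, so real linearity is what lets an operator pass
    under [line]. *)
Definition real_linear {X : HilbertSpace} (L : X -> X) : Prop :=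
  is_linear (K := R_AbsRing) (U := realified X) (V := realified X) L.

Section RealLinear.

Context {X : HilbertSpace}.

Lemma real_linear_plus (L : X -> X) (x y : X) : real_linear L -> L (plus x y) = plus (L x) (L y).
Proof. intros H; exact (linear_plus (U := realified X) (V := realified X) L H x y). Qed.

Lemma real_linear_scal (L : X -> X) (r : R) (x : X) :
  real_linear L -> L (scal (RtoC r) x) = scal (RtoC r) (L x).
Proof. intros H; exact (linear_scal (U := realified X) (V := realified X) L H r x). Qed.

Lemma real_linear_comp (L1 L2 : X -> X) :
  real_linear L1 -> real_linear L2 -> real_linear (fun x => L2 (L1 x)).
Proof. exact (is_linear_comp (U := realified X) (V := realified X) (W := realified X) L1 L2). Qed.

Lemma real_linear_intro (L : X -> X) (c : R) :
  (forall x y : X, L (plus x y) = plus (L x) (L y)) ->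
  (forall (r : R) (x : X), L (scal (RtoC r) x) = scal (RtoC r) (L x)) ->
  (forall x : X, norm (L x) <= c * norm x) -> real_linear L.
Proof.
intros H1 H2 H3; split; [exact H1|exact H2|].
exists (Rabs c + 1); split; [generalize (Rabs_pos c); lra|].
intros x; apply Rle_trans with (1 := H3 x).
apply Rmult_le_compat_r; [exact (hnorm_ge_0 (X := X) x)|generalize (Rle_abs c); lra].
Qed.

Lemma real_linear_scale (r : R) : real_linear (fun x : X => scal (RtoC r) x).
Proof.
apply real_linear_intro with (Rabs r).
- intros x y; apply ip_ext; intros v; rewrite ip_scal_l, !ip_plus_l, !ip_scal_l; ring.
- intros t x; apply ip_ext; intros v; rewrite !ip_scal_l; ring.
- intros x; rewrite hnorm_scal, Cmod_R; lra.
Qed.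

(** With [v] ranging over all vectors the real part alone determines a vector and its norm, and it
    maps vector integrals to real ones. *)
Definition re_ip (v x : X) : R := Re (inner x v).

Lemma re_ip_linear (v : X) :
  is_linear (K := R_AbsRing) (U := realified X) (V := R_NormedModule) (re_ip v).
Proof.
split; unfold re_ip.
- intros x y; change (Re (inner (plus (x : X) y) v) = Re (inner x v) + Re (inner y v)).
  rewrite ip_plus_l; reflexivity.
- intros r x; change (Re (inner (scal (RtoC r) (x : X)) v) = r * Re (inner x v)).
  rewrite ip_scal_l, Re_scal_R; reflexivity.
- exists (norm v + 1); split; [generalize (hnorm_ge_0 v); lra|].
  intros x; apply Rle_trans with (1 := Re_inner_le (X := X) x v).
  change (norm x) with (norm (x : X)); generalize (hnorm_ge_0 (X := X) x); nra.
Qed.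

Lemma re_ip_ext (x y : X) : (forall v, re_ip v x = re_ip v y) -> x = y.
Proof.
intros H; apply minus_eq_0, hnorm_eq_0.
assert (E : norm (minus x y) ^ 2 = 0).
{ rewrite norm_sqr, ip_minus_l.
  change (re_ip (minus x y) x - re_ip (minus x y) y = 0); rewrite H; ring. }
destruct (Req_dec (norm (minus x y)) 0) as [E0|E0]; [exact E0|].
now apply (pow_nonzero _ 2) in E0.
Qed.

Lemma norm_le_re_ip (x : X) (c : R) : 0 <= c ->
  (forall v, Rabs (re_ip v x) <= c * norm v) -> norm x <= c.
Proof.
intros Hc H; assert (H1 := H x); unfold re_ip in H1.
rewrite <- norm_sqr, Rabs_pos_eq in H1 by apply pow2_ge_0.
generalize (hnorm_ge_0 x); intros Hx.
destruct (Req_dec (norm x) 0) as [E|E]; [lra|].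
apply Rmult_le_reg_r with (norm x); lra || nra.
Qed.

End RealLinear.

Section FractionalPowers.

Context {X Y : HilbertSpace} (j : Y -> X) (a : Y -> Y -> C) (c0 C0 : R).
Context (HA : regularly_accretive j a c0 C0).

Let Rr (mu : R) (f : X) : X := Rz j a (RtoC mu) f.
Let rc := res_const c0 C0.

Lemma Rz_real_linear (z : C) : 0 <= Re z -> real_linear (Rz j a z).
Proof.
intros Hz; apply real_linear_intro with rc.
- intros x y; now apply Rz_plus with c0 C0.
- intros r x; now apply Rz_scal with c0 C0.
- intros x; now apply Rz_bound_uniform.
Qed.

Lemma Rr_bound (mu : R) (f : X) : 0 <= mu -> norm (Rr mu f) <= rc * norm f / (1 + mu).
Proof.
intros H; apply Rle_trans with (1 := Rz_bound j a c0 C0 HA (RtoC mu) f H).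
rewrite Cmod_R, Rabs_pos_eq by exact H; right; unfold rc, Rdiv; ring.
Qed.

Lemma Rr_lipschitz (mu nu : R) (f : X) : 0 <= mu -> 0 <= nu ->
  norm (minus (Rr nu f) (Rr mu f)) <= rc ^ 2 * norm f * Rabs (nu - mu).
Proof.
intros H1 H2; apply Rle_trans with (1 := Rz_lipschitz j a c0 C0 HA (RtoC mu) (RtoC nu) f H1 H2).
rewrite <- RtoC_minus, Cmod_R; right; reflexivity.
Qed.

Lemma Rr_continuous (mu : R) (f : X) : 0 < mu ->
  continuous (U := realified X) (fun mu => Rr mu f) mu.
Proof.
intros H; apply (filterlim_locally_ball_norm (U := realified X)); intros eps.
assert (Hr : 0 < rc) by exact (res_const_pos j a c0 C0 HA).
assert (Hk : 0 <= rc ^ 2 * norm f) by (apply Rmult_le_pos; [apply pow2_ge_0|apply hnorm_ge_0]).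
assert (He := cond_pos eps).
assert (Hd : 0 < Rmin mu (eps / (rc ^ 2 * norm f + 1))).
{ apply Rmin_glb_lt; [exact H|apply Rdiv_lt_0_compat; lra]. }
exists (mkposreal _ Hd); intros nu Hnu.
change (Rabs (nu - mu) < Rmin mu (eps / (rc ^ 2 * norm f + 1))) in Hnu.
assert (H1 := Rmin_l mu (eps / (rc ^ 2 * norm f + 1))).
assert (H2 := Rmin_r mu (eps / (rc ^ 2 * norm f + 1))).
assert (Hnu0 : 0 <= nu) by (apply Rabs_lt_between in Hnu; lra).
change (norm (minus (Rr nu f) (Rr mu f)) < eps).
apply Rle_lt_trans with (1 := Rr_lipschitz mu nu f (Rlt_le _ _ H) Hnu0).
assert (H3 : Rabs (nu - mu) * (rc ^ 2 * norm f + 1) < eps).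
{ apply Rlt_le_trans with (eps / (rc ^ 2 * norm f + 1) * (rc ^ 2 * norm f + 1)).
  - apply Rmult_lt_compat_r; lra.
  - right; field; lra. }
generalize (Rabs_pos (nu - mu)); nra.
Qed.

Lemma Rr_exp_continuous (x : R) (f : X) :
  continuous (U := realified X) (fun x => Rr (exp x) f) x.
Proof.
apply (continuous_comp (W := realified X) exp (fun mu => Rr mu f)).
- apply (ex_derive_continuous exp); auto_derive; exact Logic.I.
- apply Rr_continuous, exp_pos.
Qed.

Definition power_integrand (al : R) (f : X) (x : R) : X :=
  scal (RtoC (exp ((1 - al) * x))) (Rr (exp x) f).

Definition power_integral (al : R) (f : X) : X := line (V := realified X) (power_integrand al f).

Lemma power_integrand_decaying (al : R) (f : X) : 0 < al < 1 ->
  decaying (V := realified X) (power_integrand al f) (rc * norm f) (rc * norm f) (1 - al) al.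
Proof.
intros Hal.
assert (Hr : 0 < rc) by exact (res_const_pos j a c0 C0 HA).
assert (D := exp_weight_decaying (V := realified X) (1 - al) (rc * norm f) (fun x => Rr (exp x) f)
  ltac:(lra) ltac:(apply Rmult_le_pos; [lra|apply hnorm_ge_0]) (fun x => Rr_exp_continuous x f)
  (fun x => Rr_bound (exp x) f (Rlt_le _ _ (exp_pos x)))).
replace (1 - (1 - al)) with al in D by ring; exact D.
Qed.

Lemma neg_pow_integral (al : R) (f : X) : 0 < al < 1 ->
  neg_pow j a al f = scal (RtoC (sin (PI * al) / PI)) (power_integral al f).
Proof.
intros Hal; unfold neg_pow; f_equal.
set (G := fun mu : R => scal (RtoC (Rpower mu (- al))) (resolvent j a mu f) : X).
assert (E : (fun y : R => scal (RtoC (exp y)) (G (exp y)) : X) = power_integrand al f).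
{ apply functional_extensionality; intros y; unfold G, power_integrand.
  rewrite (resolvent_Rz j a c0 C0 HA) by (left; apply exp_pos).
  apply ip_ext; intros v; rewrite !ip_scal_l, Cmult_assoc, <- RtoC_mult; do 2 f_equal.
  unfold Rpower; rewrite ln_exp, <- exp_plus; f_equal; ring. }
assert (Hgen : (forall mu, 0 < mu -> continuous (U := realified X) G mu) ->
  decaying (V := realified X) (power_integrand al f) (rc * norm f) (rc * norm f) (1 - al) al ->
  is_RInt_gen (V := realified X) G (at_right 0) (Rbar_locally p_infty) (power_integral al f)).
{ unfold power_integral; rewrite <- E.
  exact (is_RInt_gen_exp_subst (V := realified X) G (rc * norm f) (rc * norm f) (1 - al) al). }
apply (is_RInt_gen_unique (V := realified X)); apply Hgen.
- intros mu Hmu.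
  apply (continuous_ext_loc (U := realified X) G (fun mu => scal (RtoC (Rpower mu (- al))) (Rr mu f) : X) mu).
  + exists (mkposreal mu Hmu); intros nu Hnu.
    change (Rabs (nu - mu) < mu) in Hnu; apply Rabs_lt_between in Hnu.
    unfold G; rewrite (resolvent_Rz j a c0 C0 HA) by lra; reflexivity.
  + apply (continuous_scal (V := realified X) (fun mu => Rpower mu (- al)) (fun mu => Rr mu f)).
    * apply (ex_derive_continuous (fun mu => Rpower mu (- al))); unfold Rpower; auto_derive; exact Hmu.
    * now apply Rr_continuous.
- now apply power_integrand_decaying.
Qed.

Definition commutes_with_resolvent (L : X -> X) : Prop :=
  forall mu f, 0 <= mu -> L (Rr mu f) = Rr mu (L f).

Lemma power_integral_commutes (L : X -> X) (al : R) (f : X) : 0 < al < 1 ->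
  real_linear L -> commutes_with_resolvent L ->
  L (power_integral al f) = power_integral al (L f).
Proof.
intros Hal HL Hc; unfold power_integral.
etransitivity; [symmetry; exact (line_linear (V := realified X) (W := realified X) L _ _ _ _ _ HL
  (power_integrand_decaying al f Hal))|].
f_equal; apply functional_extensionality; intros x; unfold power_integrand.
rewrite real_linear_scal, Hc by (exact HL || (left; apply exp_pos)); reflexivity.
Qed.

Lemma power_integral_bound (al : R) (f : X) : 0 < al < 1 ->
  norm (power_integral al f) <= rc * (/ (al * (1 - al))) * norm f.
Proof.
intros Hal.
apply Rle_trans with (1 := norm_line_le (V := realified X) _ _ _ _ _ 0 (power_integrand_decaying al f Hal)).
rewrite !Rmult_0_r, Ropp_0, exp_0; right; field; lra.
Qed.

Lemma power_integral_real_linear (al : R) : 0 < al < 1 -> real_linear (power_integral al).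
Proof.
intros Hal; apply real_linear_intro with (rc * (/ (al * (1 - al)))).
- intros x y; unfold power_integral, line.
  apply (is_RInt_gen_unique (V := realified X)).
  assert (H := is_RInt_gen_plus (V := realified X) _ _ _ _
    (decaying_is_line _ _ _ _ _ (power_integrand_decaying al x Hal))
    (decaying_is_line _ _ _ _ _ (power_integrand_decaying al y Hal))).
  apply (is_RInt_gen_ext (V := realified X)) with (2 := H).
  apply filter_forall; intros [p q] t _; unfold power_integrand, Rr.
  rewrite (Rz_plus j a c0 C0 HA) by (left; apply exp_pos).
  symmetry; exact (scal_distr_l (RtoC (exp ((1 - al) * t))) (Rz j a (RtoC (exp t)) x) (Rz j a (RtoC (exp t)) y)).
- intros r x; symmetry; apply power_integral_commutes; [exact Hal|apply real_linear_scale|].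
  intros mu f Hmu; unfold Rr; rewrite (Rz_scal j a c0 C0 HA) by exact Hmu; reflexivity.
- intros x; now apply power_integral_bound.
Qed.

Lemma Rz_commutes (z : C) : 0 <= Re z -> commutes_with_resolvent (Rz j a z).
Proof. intros Hz mu f Hmu; now apply (Rz_comm j a c0 C0 HA). Qed.

Lemma power_integral_resolvent (al : R) : 0 < al < 1 -> commutes_with_resolvent (power_integral al).
Proof.
intros Hal mu f Hmu; symmetry; apply power_integral_commutes; auto.
- now apply Rz_real_linear.
- now apply Rz_commutes.
Qed.

Let kernel (f v : X) (x y : R) : R := re_ip v (Rr (exp x) (Rr (exp y) f)).
Let profile (f v : X) (x : R) : R := re_ip v (Rr (exp x) f).
Let kernel_const (f v : X) := (rc + rc ^ 2) * norm f * norm v.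

Lemma re_ip_le (v x : X) (c : R) : norm x <= c -> Rabs (re_ip v x) <= c * norm v.
Proof.
intros H; apply Rle_trans with (1 := Re_inner_le x v).
apply Rmult_le_compat_r; [apply hnorm_ge_0|exact H].
Qed.

Lemma kernel_continuous (f v : X) (x y : R) : continuity_2d_pt (kernel f v) x y.
Proof.
assert (Hr : 0 < rc) by exact (res_const_pos j a c0 C0 HA).
set (K := rc ^ 3 * norm f * norm v).
assert (HK : 0 <= K).
{ unfold K; repeat apply Rmult_le_pos; try apply hnorm_ge_0; try lra; apply pow_le; lra. }
(* One variable is moved at a time; commutation of the resolvents brings the moving one to the
   outside, where the Lipschitz bound applies. *)
assert (Hlip : forall u w, Rabs (kernel f v u w - kernel f v x y)
   <= K * Rabs (exp u - exp x) + K * Rabs (exp w - exp y)).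
{ intros u w.
  assert (Pu := Rlt_le _ _ (exp_pos u)); assert (Px := Rlt_le _ _ (exp_pos x)).
  assert (Pw := Rlt_le _ _ (exp_pos w)); assert (Py := Rlt_le _ _ (exp_pos y)).
  assert (E : kernel f v u w - kernel f v x y
    = re_ip v (minus (Rr (exp u) (Rr (exp w) f)) (Rr (exp x) (Rr (exp w) f)))
      + re_ip v (minus (Rr (exp w) (Rr (exp x) f)) (Rr (exp y) (Rr (exp x) f)))).
  { unfold kernel, re_ip; rewrite !ip_minus_l.
    unfold Rr; rewrite (Rz_comm j a c0 C0 HA (RtoC (exp w)) (RtoC (exp x)) f Pw Px).
    rewrite (Rz_comm j a c0 C0 HA (RtoC (exp y)) (RtoC (exp x)) f Py Px).
    unfold Re, Cminus, Cplus, Copp; simpl; ring. }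
  rewrite E; apply Rle_trans with (1 := Rabs_triang _ _); apply Rplus_le_compat.
  - eapply Rle_trans; [apply re_ip_le, Rr_lipschitz; assumption|].
    assert (H1 := Rz_bound_uniform j a c0 C0 HA (RtoC (exp w)) f Pw); fold rc in H1.
    assert (H2 : rc ^ 2 * norm (Rr (exp w) f) <= rc ^ 2 * (rc * norm f))
      by (apply Rmult_le_compat_l; [apply pow2_ge_0|exact H1]).
    replace (K * Rabs (exp u - exp x)) with (rc ^ 2 * (rc * norm f) * Rabs (exp u - exp x) * norm v)
      by (unfold K; ring).
    apply Rmult_le_compat_r; [apply hnorm_ge_0|]; apply Rmult_le_compat_r; [apply Rabs_pos|exact H2].
  - eapply Rle_trans; [apply re_ip_le, Rr_lipschitz; assumption|].
    assert (H1 := Rz_bound_uniform j a c0 C0 HA (RtoC (exp x)) f Px); fold rc in H1.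
    assert (H2 : rc ^ 2 * norm (Rr (exp x) f) <= rc ^ 2 * (rc * norm f))
      by (apply Rmult_le_compat_l; [apply pow2_ge_0|exact H1]).
    replace (K * Rabs (exp w - exp y)) with (rc ^ 2 * (rc * norm f) * Rabs (exp w - exp y) * norm v)
      by (unfold K; ring).
    apply Rmult_le_compat_r; [apply hnorm_ge_0|]; apply Rmult_le_compat_r; [apply Rabs_pos|exact H2]. }
assert (Ce : forall z, continuity_pt exp z).
{ intros z; apply continuity_pt_derive; auto_derive; exact Logic.I. }
intros eps; assert (He := cond_pos eps).
assert (Hd : 0 < eps / (2 * (K + 1))) by (apply Rdiv_lt_0_compat; lra).
destruct (continuity_2d_pt_comp1 exp x y (Ce x) (mkposreal _ Hd)) as [d1 H1].
destruct (continuity_2d_pt_comp2 exp x y (Ce y) (mkposreal _ Hd)) as [d2 H2].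
exists (mkposreal (Rmin d1 d2) (Rmin_stable_in_posreal d1 d2)); simpl; intros u w Hu Hw.
assert (Hu1 := Rmin_l d1 d2); assert (Hu2 := Rmin_r d1 d2).
specialize (H1 u w ltac:(lra) ltac:(lra)); specialize (H2 u w ltac:(lra) ltac:(lra)); simpl in H1, H2.
apply Rle_lt_trans with (1 := Hlip u w).
assert (E : eps / (2 * (K + 1)) * (K + 1) = eps / 2) by (field; lra).
generalize (Rabs_pos (exp u - exp x)) (Rabs_pos (exp w - exp y)); nra.
Qed.

Lemma resolvent_kernel_Rr (f v : X) :
  resolvent_kernel (kernel f v) (profile f v) (kernel_const f v).
Proof.
assert (Hr : 0 < rc) by exact (res_const_pos j a c0 C0 HA).
assert (Hf := hnorm_ge_0 f); assert (Hv := hnorm_ge_0 v).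
assert (Hfv : 0 <= norm f * norm v) by (apply Rmult_le_pos; assumption).
assert (Hr2 : 0 <= rc ^ 2) by apply pow2_ge_0.
split.
- unfold kernel_const; repeat apply Rmult_le_pos; lra.
- intros x y; apply kernel_continuous.
- intros x y; assert (Hx := exp_pos x); assert (Hy := exp_pos y).
  assert (H1 := Rr_bound (exp x) (Rr (exp y) f) (Rlt_le _ _ Hx)).
  assert (H2 := Rr_bound (exp y) f (Rlt_le _ _ Hy)).
  apply Rle_trans with (rc * (rc * norm f / (1 + exp y)) / (1 + exp x) * norm v).
  + apply re_ip_le; apply Rle_trans with (1 := H1).
    apply Rmult_le_compat_r; [left; apply Rinv_0_lt_compat; lra|].
    apply Rmult_le_compat_l; lra.
  + replace (rc * (rc * norm f / (1 + exp y)) / (1 + exp x) * norm v)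
      with (rc ^ 2 * norm f * norm v / ((1 + exp x) * (1 + exp y))) by (field; lra).
    apply Rmult_le_compat_r.
    * left; apply Rinv_0_lt_compat, Rmult_lt_0_compat; lra.
    * unfold kernel_const; nra.
- intros x; apply (continuous_comp (V := realified X) (fun x => Rr (exp x) f) (re_ip v)).
  + apply Rr_exp_continuous.
  + apply (linear_cont (U := realified X) (V := R_NormedModule)), re_ip_linear.
- intros x; assert (Hx := exp_pos x).
  apply Rle_trans with (rc * norm f / (1 + exp x) * norm v).
  + apply re_ip_le, Rr_bound; lra.
  + replace (rc * norm f / (1 + exp x) * norm v) with (rc * norm f * norm v / (1 + exp x)) by (field; lra).
    apply Rmult_le_compat_r; [left; apply Rinv_0_lt_compat; lra|unfold kernel_const; nra].
- intros x y; unfold kernel, profile, re_ip, Rr.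
  assert (E := resolvent_identity j a c0 C0 HA (RtoC (exp x)) (RtoC (exp y)) f
    (Rlt_le _ _ (exp_pos x)) (Rlt_le _ _ (exp_pos y))).
  rewrite E at 1; rewrite ip_plus_l, ip_scal_l, <- RtoC_minus.
  rewrite (Rz_comm j a c0 C0 HA (RtoC (exp y)) (RtoC (exp x)) f
    (Rlt_le _ _ (exp_pos y)) (Rlt_le _ _ (exp_pos x))).
  change (Re (Cplus (inner (Rz j a (RtoC (exp y)) f) v)
    (Cmult (RtoC (exp y - exp x)) (inner (Rz j a (RtoC (exp x)) (Rz j a (RtoC (exp y)) f)) v))))
    with (Re (inner (Rz j a (RtoC (exp y)) f) v) +
          Re (Cmult (RtoC (exp y - exp x)) (inner (Rz j a (RtoC (exp x)) (Rz j a (RtoC (exp y)) f)) v))).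
  rewrite Re_scal_R; ring.
Qed.

Lemma re_ip_power_integral (L : X -> X) (v f : X) (al : R) : 0 < al < 1 -> real_linear L ->
  re_ip v (L (power_integral al f)) = rline (fun x => exp ((1 - al) * x) * re_ip v (L (Rr (exp x) f))).
Proof.
intros Hal HL.
assert (HvL := is_linear_comp (U := realified X) (V := realified X) (W := R_NormedModule)
  L (re_ip v) HL (re_ip_linear v)).
etransitivity; [symmetry; exact (line_linear (V := realified X) (W := R_CompleteNormedModule)
  (fun x => re_ip v (L x)) _ _ _ _ _ HvL (power_integrand_decaying al f Hal))|].
f_equal; apply functional_extensionality; intros x.
exact (linear_scal (fun x : realified X => re_ip v (L x)) HvL (exp ((1 - al) * x)) (Rr (exp x) f)).
Qed.

Lemma power_integral_double (al ga : R) (f v : X) : 0 < al < 1 -> 0 < ga < 1 ->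
  re_ip v (power_integral al (power_integral ga f))
  = rline (fun x => rline (fun y => exp ((1 - al) * x) * exp ((1 - ga) * y) * kernel f v x y)).
Proof.
intros Hal Hga.
rewrite (re_ip_power_integral (fun x => x) v (power_integral ga f) al Hal).
2: { apply real_linear_intro with 1; intros; auto; lra. }
f_equal; apply functional_extensionality; intros x.
assert (HL := Rz_real_linear (RtoC (exp x)) (Rlt_le _ _ (exp_pos x))).
unfold Rr at 1; rewrite (re_ip_power_integral (Rz j a (RtoC (exp x))) v f ga Hga HL).
assert (HvL := is_linear_comp (U := realified X) (V := realified X) (W := R_NormedModule)
  _ (re_ip v) HL (re_ip_linear v)).
destruct (linear_norm _ HvL) as [c [Hc Hcb]].
assert (D := decaying_linear (V := realified X) (W := R_CompleteNormedModule)
  (fun u => re_ip v (Rz j a (RtoC (exp x)) u)) _ c _ _ _ _ HvL (Rlt_le _ _ Hc) Hcb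
  (power_integrand_decaying ga f Hga)).
assert (S := line_scal (V := R_CompleteNormedModule) _ (exp ((1 - al) * x)) _ _ _ _ D).
assert (E : forall y, re_ip v (Rz j a (RtoC (exp x)) (power_integrand ga f y))
                      = exp ((1 - ga) * y) * kernel f v x y).
{ intros y.
  exact (linear_scal (fun u : realified X => re_ip v (Rz j a (RtoC (exp x)) u)) HvL
           (exp ((1 - ga) * y)) (Rr (exp y) f)). }
transitivity (exp ((1 - al) * x) * rline (fun y => re_ip v (Rz j a (RtoC (exp x)) (power_integrand ga f y)))).
- do 2 f_equal; apply functional_extensionality; intros y; rewrite E; reflexivity.
- etransitivity; [symmetry; exact S|].
  f_equal; apply functional_extensionality; intros y; rewrite E.
  unfold scal; simpl; unfold mult; simpl; ring.
Qed.

Lemma power_integral_add (al ga : R) (f : X) : 0 < al -> 0 < ga -> al + ga < 1 ->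
  scal (RtoC (beta_integral (al + ga))) (power_integral al (power_integral ga f))
  = scal (RtoC (beta_integral al * beta_integral ga)) (power_integral (al + ga) f).
Proof.
intros Hal Hga Hs; apply re_ip_ext; intros v.
unfold re_ip; rewrite !ip_scal_l, !Re_scal_R.
change (beta_integral (al + ga) * re_ip v (power_integral al (power_integral ga f))
  = beta_integral al * beta_integral ga * re_ip v (power_integral (al + ga) f)).
rewrite power_integral_double by lra.
rewrite (re_ip_power_integral (fun x => x) v f (al + ga) ltac:(lra)).
2: { apply real_linear_intro with 1; intros; auto; lra. }
rewrite Rmult_comm.
exact (double_line_power al ga _ _ _ Hal Hga Hs (resolvent_kernel_Rr f v)).
Qed.

Lemma power_integral_complement (al ga : R) (f : X) : 0 < al -> 0 < ga -> al + ga = 1 ->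
  power_integral al (power_integral ga f)
  = scal (RtoC (beta_integral al * beta_integral ga)) (Rr 0 f).
Proof.
intros Hal Hga Hs; apply re_ip_ext; intros v.
unfold re_ip at 2; rewrite ip_scal_l, Re_scal_R, power_integral_double by lra.
apply (double_line_power_one al ga _ _ _ _ Hal Hga Hs (resolvent_kernel_Rr f v)).
(* Lipschitz continuity of the resolvent at 0 makes the profile approach its limit at the rate
   [exp x]. *)
intros x; assert (Hx := exp_pos x).
assert (H := Rr_lipschitz 0 (exp x) f (Rle_refl 0) (Rlt_le _ _ Hx)).
rewrite Rminus_0_r, (Rabs_pos_eq (exp x)) in H by lra.
apply (re_ip_le v) in H; unfold re_ip in H; rewrite ip_minus_l in H.
change (Rabs (profile f v x - Re (inner (Rr 0 f) v)) <= rc ^ 2 * norm f * exp x * norm v) in H.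
apply Rle_trans with (1 := H); unfold kernel_const.
assert (Hr : 0 < rc) by exact (res_const_pos j a c0 C0 HA).
assert (0 <= norm f * norm v * exp x).
{ repeat apply Rmult_le_pos; try apply hnorm_ge_0; lra. }
nra.
Qed.

End FractionalPowers.

(** * The semigroup of negative powers *)

Definition nat_floor (r : R) : nat := Z.to_nat (Int_part r).

Lemma nat_floor_spec (r : R) : 0 <= r -> INR (nat_floor r) <= r < INR (nat_floor r) + 1.
Proof.
intros Hr; destruct (base_Int_part r) as [H1 H2].
assert (Hz : (0 <= Int_part r)%Z).
{ assert (IZR (-1) < IZR (Int_part r)) by lra; apply lt_IZR in H; lia. }
unfold nat_floor; rewrite INR_IZR_INZ, Z2Nat.id by exact Hz; lra.
Qed.

Lemma nat_floor_unique (r : R) (n : nat) : INR n <= r < INR n + 1 -> nat_floor r = n.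
Proof.
intros H; assert (H0 : 0 <= r) by (generalize (pos_INR n); lra).
assert (H1 := nat_floor_spec r H0).
assert (A1 : INR n < INR (S (nat_floor r))) by (rewrite S_INR; lra).
assert (A2 : INR (nat_floor r) < INR (S n)) by (rewrite S_INR; lra).
apply INR_lt in A1; apply INR_lt in A2; lia.
Qed.

Lemma nat_ceil_spec (r : R) : 0 <= r -> INR (nat_ceil r) - 1 < r <= INR (nat_ceil r).
Proof.
intros Hr; destruct (base_Int_part (- r)) as [H1 H2].
assert (Hz : (0 <= - Int_part (- r))%Z).
{ assert (IZR (Int_part (- r)) < IZR 1) by lra; apply lt_IZR in H; lia. }
unfold nat_ceil; rewrite INR_IZR_INZ, Z2Nat.id, opp_IZR by exact Hz; lra.
Qed.

Section NegativePowers.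

Context {X Y : HilbertSpace} (j : Y -> X) (a : Y -> Y -> C) (c0 C0 : R).
Context (HA : regularly_accretive j a c0 C0).

Let rc := res_const c0 C0.
Let B (f : X) : X := Rz j a (RtoC 0) f.
Let commuting := commutes_with_resolvent (X := X) j a.

(** With the beta integral as normalisation, the constants of [power_integral_add] and
    [power_integral_complement] cancel and the semigroup law holds exactly. *)
Definition frac_pow (th : R) (f : X) : X :=
  if Req_EM_T th 0 then f else scal (RtoC (/ beta_integral th)) (power_integral j a th f).

(* [A^(-r)] for [r >= 0]. *)
Definition inv_pow (r : R) (f : X) : X :=
  Nat.iter (nat_floor r) B (frac_pow (r - INR (nat_floor r)) f).

Lemma beta_integral_pos (al : R) : 0 < al < 1 -> 0 < beta_integral al.
Proof.
intros Hal; destruct (beta_integral_bounds al Hal) as [H _].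
apply Rlt_le_trans with (2 := H), Rinv_0_lt_compat.
assert (0 < al * (1 - al)) by (apply Rmult_lt_0_compat; lra); lra.
Qed.

Lemma B_real_linear : real_linear B.
Proof. apply (Rz_real_linear j a c0 C0 HA); simpl; lra. Qed.

Lemma B_commutes : commuting B.
Proof. apply (Rz_commutes j a c0 C0 HA); simpl; lra. Qed.

Lemma commuting_comp (L1 L2 : X -> X) : commuting L1 -> commuting L2 -> commuting (fun x => L2 (L1 x)).
Proof. intros H1 H2 mu f Hmu; rewrite H1, H2 by exact Hmu; reflexivity. Qed.

Lemma commuting_B (L : X -> X) (f : X) : commuting L -> L (B f) = B (L f).
Proof. intros H; apply H; lra. Qed.

Lemma commuting_iter (L : X -> X) (n : nat) (f : X) : commuting L ->
  L (Nat.iter n B f) = Nat.iter n B (L f).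
Proof.
intros H; induction n as [|n IH]; [reflexivity|]; simpl.
rewrite commuting_B, IH by exact H; reflexivity.
Qed.

Lemma commuting_scal (r : R) : commuting (fun x => scal (RtoC r) x).
Proof.
intros mu f Hmu; rewrite (Rz_scal j a c0 C0 HA) by exact Hmu; reflexivity.
Qed.

Lemma frac_pow_real_linear (th : R) : 0 <= th < 1 -> real_linear (frac_pow th).
Proof.
intros Hth; unfold frac_pow; destruct (Req_EM_T th 0) as [E|E].
- apply real_linear_intro with 1; intros; auto; lra.
- apply (real_linear_comp (power_integral j a th) (fun x => scal (RtoC (/ beta_integral th)) x)).
  + apply (power_integral_real_linear j a c0 C0 HA); lra.
  + apply real_linear_scale.
Qed.

Lemma frac_pow_commutes (th : R) : 0 <= th < 1 -> commuting (frac_pow th).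
Proof.
intros Hth; unfold frac_pow; destruct (Req_EM_T th 0) as [E|E].
- intros mu f Hmu; reflexivity.
- apply (commuting_comp (power_integral j a th) (fun x => scal (RtoC (/ beta_integral th)) x)).
  + apply (power_integral_resolvent j a c0 C0 HA); lra.
  + apply commuting_scal.
Qed.

(** The growth [1 / (th (1 - th))] of the integral is cancelled by the lower bound for the beta
    integral. *)
Lemma frac_pow_bound (th : R) (f : X) : 0 <= th < 1 -> norm (frac_pow th f) <= (1 + 4 * rc) * norm f.
Proof.
intros Hth; assert (Hr : 0 < rc) by exact (res_const_pos j a c0 C0 HA).
assert (Hf := hnorm_ge_0 f).
unfold frac_pow; destruct (Req_EM_T th 0) as [E|E]; [nra|].
assert (Ht : 0 < th < 1) by lra.
assert (Hb := beta_integral_pos th Ht); destruct (beta_integral_bounds th Ht) as [H1 _].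
assert (Hc : 0 < th * (1 - th)) by (apply Rmult_lt_0_compat; lra).
rewrite hnorm_scal, Cmod_R, Rabs_pos_eq by (left; apply Rinv_0_lt_compat, Hb).
apply Rle_trans with (/ beta_integral th * (rc * (/ (th * (1 - th))) * norm f)).
{ apply Rmult_le_compat_l; [left; apply Rinv_0_lt_compat, Hb|].
  now apply (power_integral_bound j a c0 C0 HA). }
assert (H2 : / beta_integral th <= 4 * (th * (1 - th))).
{ rewrite <- (Rinv_inv (4 * (th * (1 - th)))); apply Rinv_le_contravar; [|exact H1].
  apply Rinv_0_lt_compat; lra. }
apply Rle_trans with (4 * (th * (1 - th)) * (rc * (/ (th * (1 - th))) * norm f)).
- apply Rmult_le_compat_r; [|exact H2].
  repeat apply Rmult_le_pos; try lra; left; apply Rinv_0_lt_compat; lra.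
- replace (4 * (th * (1 - th)) * (rc * / (th * (1 - th)) * norm f)) with (4 * rc * norm f) by (field; lra).
  nra.
Qed.

Lemma frac_pow_add_lt (th et : R) (f : X) : 0 <= th -> 0 <= et -> th + et < 1 ->
  frac_pow th (frac_pow et f) = frac_pow (th + et) f.
Proof.
intros Ht He Hs; unfold frac_pow.
destruct (Req_EM_T th 0) as [E1|E1]; [subst th; rewrite Rplus_0_l; reflexivity|].
destruct (Req_EM_T et 0) as [E2|E2].
{ subst et; rewrite Rplus_0_r; destruct (Req_EM_T th 0); [contradiction|reflexivity]. }
destruct (Req_EM_T (th + et) 0) as [E3|E3]; [lra|].
assert (P1 := beta_integral_pos th ltac:(lra)); assert (P2 := beta_integral_pos et ltac:(lra)).
assert (P3 := beta_integral_pos (th + et) ltac:(lra)).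
rewrite (real_linear_scal _ _ _ (power_integral_real_linear j a c0 C0 HA th ltac:(lra))).
assert (E := power_integral_add j a c0 C0 HA th et f ltac:(lra) ltac:(lra) Hs).
apply ip_ext; intros v; apply (f_equal (fun t => inner t v)) in E.
rewrite !ip_scal_l in *.
transitivity (Cmult (RtoC (/ beta_integral th * / beta_integral et * / beta_integral (th + et)))
  (Cmult (RtoC (beta_integral (th + et))) (inner (power_integral j a th (power_integral j a et f)) v))).
- rewrite !Cmult_assoc, <- !RtoC_mult; do 2 f_equal; field; lra.
- rewrite E, Cmult_assoc, <- RtoC_mult; do 2 f_equal; field; lra.
Qed.

Lemma frac_pow_add_one (th et : R) (f : X) : 0 < th -> 0 < et -> th + et = 1 ->
  frac_pow th (frac_pow et f) = B f.
Proof.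
intros Ht He Hs; unfold frac_pow.
destruct (Req_EM_T th 0) as [E1|E1]; [lra|]; destruct (Req_EM_T et 0) as [E2|E2]; [lra|].
assert (P1 := beta_integral_pos th ltac:(lra)); assert (P2 := beta_integral_pos et ltac:(lra)).
rewrite (real_linear_scal _ _ _ (power_integral_real_linear j a c0 C0 HA th ltac:(lra))).
rewrite (power_integral_complement j a c0 C0 HA th et f Ht He Hs).
apply ip_ext; intros v; rewrite !ip_scal_l, !Cmult_assoc, <- !RtoC_mult.
replace (/ beta_integral th * / beta_integral et * (beta_integral th * beta_integral et))
  with 1 by (field; lra).
apply Cmult_1_l.
Qed.

(** Writing [et = (1 - th) + (th + et - 1)] lets [th] and [1 - th] combine to a full inverse. *)
Lemma frac_pow_add_ge (th et : R) (f : X) : th < 1 -> et < 1 -> 1 <= th + et ->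
  frac_pow th (frac_pow et f) = B (frac_pow (th + et - 1) f).
Proof.
intros Ht He Hs.
replace (frac_pow et f) with (frac_pow (1 - th) (frac_pow (th + et - 1) f)).
- apply frac_pow_add_one; lra.
- rewrite frac_pow_add_lt by lra; f_equal; ring.
Qed.

Lemma iter_real_linear (n : nat) : real_linear (fun f => Nat.iter n B f).
Proof.
induction n as [|n IH]; [apply real_linear_intro with 1; intros; simpl; auto; lra|].
apply (real_linear_comp (fun f => Nat.iter n B f) B IH B_real_linear).
Qed.

Lemma iter_commutes (n : nat) : commuting (fun f => Nat.iter n B f).
Proof.
induction n as [|n IH]; [intros mu f Hmu; reflexivity|].
apply (commuting_comp (fun f => Nat.iter n B f) B IH B_commutes).
Qed.

Lemma inv_pow_split (n : nat) (th : R) (f : X) : 0 <= th < 1 ->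
  inv_pow (INR n + th) f = Nat.iter n B (frac_pow th f).
Proof.
intros Hth; unfold inv_pow; rewrite (nat_floor_unique (INR n + th) n) by lra.
do 2 f_equal; ring.
Qed.

Lemma inv_pow_frac (th : R) (f : X) : 0 <= th < 1 -> inv_pow th f = frac_pow th f.
Proof.
intros Hth; rewrite <- (Rplus_0_l th) at 1; exact (inv_pow_split 0 th f Hth).
Qed.

Lemma inv_pow_nat (n : nat) (f : X) : inv_pow (INR n) f = Nat.iter n B f.
Proof.
rewrite <- (Rplus_0_r (INR n)), inv_pow_split by lra.
unfold frac_pow; destruct (Req_EM_T 0 0) as [_|H]; [reflexivity|now elim H].
Qed.

Lemma nat_frac_decomposition (r : R) : 0 <= r -> exists n th, 0 <= th < 1 /\ r = INR n + th.
Proof.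
intros Hr; exists (nat_floor r), (r - INR (nat_floor r)).
generalize (nat_floor_spec r Hr); split; lra.
Qed.

Lemma inv_pow_real_linear (r : R) : 0 <= r -> real_linear (inv_pow r).
Proof.
intros Hr; assert (H := nat_floor_spec r Hr); unfold inv_pow.
apply (real_linear_comp (frac_pow (r - INR (nat_floor r))) (fun f => Nat.iter (nat_floor r) B f)).
- apply frac_pow_real_linear; lra.
- apply iter_real_linear.
Qed.

Lemma inv_pow_commutes (r : R) : 0 <= r -> commuting (inv_pow r).
Proof.
intros Hr; assert (H := nat_floor_spec r Hr); unfold inv_pow.
apply (commuting_comp (frac_pow (r - INR (nat_floor r))) (fun f => Nat.iter (nat_floor r) B f)).
- apply frac_pow_commutes; lra.
- apply iter_commutes.
Qed.

Lemma inv_pow_add (r q : R) (f : X) : 0 <= r -> 0 <= q -> inv_pow r (inv_pow q f) = inv_pow (r + q) f.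
Proof.
intros Hr Hq.
destruct (nat_frac_decomposition r Hr) as [n [th [Hth ->]]].
destruct (nat_frac_decomposition q Hq) as [m [et [Het ->]]].
rewrite !inv_pow_split by assumption.
rewrite (commuting_iter (frac_pow th)) by now apply frac_pow_commutes.
rewrite <- Nat.iter_add.
(* In the second case the fractional parts carry over to the integer part. *)
destruct (Rlt_le_dec (th + et) 1) as [Hs|Hs].
- replace (INR n + th + (INR m + et)) with (INR (n + m) + (th + et)) by (rewrite plus_INR; ring).
  rewrite inv_pow_split by lra; rewrite frac_pow_add_lt by lra; reflexivity.
- replace (INR n + th + (INR m + et)) with (INR (n + m + 1) + (th + et - 1))
    by (rewrite !plus_INR; simpl; ring).
  rewrite inv_pow_split by lra; rewrite frac_pow_add_ge by lra.
  rewrite (Nat.iter_add (n + m) 1); reflexivity.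
Qed.

(** A further negative power completes [r] to an integer, and [B] is injective. *)
Lemma inv_pow_inj (r : R) (f g : X) : 0 <= r -> inv_pow r f = inv_pow r g -> f = g.
Proof.
intros Hr E; assert (H := nat_floor_spec r Hr).
set (n := S (nat_floor r)).
assert (Hn : INR n = (INR n - r) + r) by ring.
assert (Hq : 0 <= INR n - r) by (unfold n; rewrite S_INR; lra).
apply (f_equal (inv_pow (INR n - r))) in E.
rewrite !inv_pow_add, <- Hn, !inv_pow_nat in E by assumption.
clear - HA E; revert E; induction n as [|n IH]; [auto|]; simpl; intros E.
apply IH, (Rz0_inj j a c0 C0 HA), E.
Qed.

Definition inv_pow_const (r : R) : R := rc ^ nat_floor r * (1 + 4 * rc).

Lemma inv_pow_bound (r : R) (f : X) : 0 <= r -> norm (inv_pow r f) <= inv_pow_const r * norm f.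
Proof.
intros Hr; assert (H := nat_floor_spec r Hr); unfold inv_pow, inv_pow_const.
assert (Hrc : 0 < rc) by exact (res_const_pos j a c0 C0 HA).
assert (Hb := frac_pow_bound (r - INR (nat_floor r)) f ltac:(lra)).
assert (Hit : forall n g, norm (Nat.iter n B g) <= rc ^ n * norm g).
{ induction n as [|n IH]; intros g; [simpl; lra|]; simpl.
  apply Rle_trans with (rc * norm (Nat.iter n B g)).
  - apply (Rz_bound_uniform j a c0 C0 HA); simpl; lra.
  - rewrite Rmult_assoc; apply Rmult_le_compat_l; [lra|apply IH]. }
apply Rle_trans with (1 := Hit _ _); rewrite Rmult_assoc.
apply Rmult_le_compat_l; [apply pow_le; lra|exact Hb].
Qed.

(** Together with [npow_iter] this makes membership in [D(A^n)] an equation with [B^n], the form in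
    which domains are used and established. *)
Lemma dom_npow_iter (n : nat) (x : X) : dom_npow j a n x -> x = Nat.iter n B (npow j a n x).
Proof.
revert x; induction n as [|n IH]; intros x H; [reflexivity|].
destruct H as [[f Hf] H]; rewrite (solution_op_rsol j a c0 C0 HA) in Hf.
assert (Eop : op j a x = f) by (rewrite <- Hf; apply (op_Rz0 j a c0 C0 HA)).
rewrite Eop in H; specialize (IH f H).
unfold npow; rewrite (Nat.iter_succ_r n _ (op j a) x), Eop; fold (npow j a n f).
simpl; rewrite <- IH; symmetry; exact Hf.
Qed.

Lemma npow_iter (n : nat) (h : X) :
  dom_npow j a n (Nat.iter n B h) /\ npow j a n (Nat.iter n B h) = h.
Proof.
induction n as [|n [IH1 IH2]]; [split; [exact Logic.I|reflexivity]|].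
unfold npow in *; rewrite (Nat.iter_succ_r n _ (op j a)); simpl.
assert (E : op j a (B (Nat.iter n B h)) = Nat.iter n B h) by apply (op_Rz0 j a c0 C0 HA).
rewrite E; split; [split; [apply (dom_Rz0 j a c0 C0 HA)|exact IH1]|exact IH2].
Qed.

Lemma neg_part_pow_inv_pow (r : R) (x : X) : 0 <= r ->
  neg_part_pow j a r x
  = scal (RtoC (power_ratio (INR (nat_ceil r) - r))) (inv_pow (INR (nat_ceil r) - r) x).
Proof.
intros Hr; assert (H := nat_ceil_spec r Hr); unfold neg_part_pow.
rewrite inv_pow_frac by lra; unfold power_ratio, frac_pow.
destruct (Req_EM_T r (INR (nat_ceil r))) as [E|E];
  destruct (Req_EM_T (INR (nat_ceil r) - r) 0) as [E'|E']; try lra.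
- symmetry; exact (scal_one (K := C_AbsRing) x).
- assert (Ht : 0 < INR (nat_ceil r) - r < 1) by lra.
  rewrite (neg_pow_integral j a c0 C0 HA) by exact Ht.
  assert (P := beta_integral_pos _ Ht).
  apply ip_ext; intros v; rewrite !ip_scal_l, Cmult_assoc, <- RtoC_mult; do 2 f_equal; field.
  generalize PI_RGT_0; lra.
Qed.

End NegativePowers.

(** * The quadrature error *)

Section QuadratureError.

Context {X Y : HilbertSpace} (j : Y -> X) (a : Y -> Y -> C) (c0 C0 : R).
Context (HA : regularly_accretive j a c0 C0).
Context (beta : R) (Hbeta : 0 < beta < 1) (k : R) (Hk : 0 < k) (M N : nat).

Let rc := res_const c0 C0.
Let B (f : X) : X := Rz j a (RtoC 0) f.
Let node (i : nat) : R := (INR i - INR M) * k.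

Fixpoint vsum (u : nat -> X) (n : nat) : X :=
  match n with
  | O => u O
  | S m => plus (vsum u m) (u n)
  end.

Lemma sum_n_vsum (u : nat -> X) (n : nat) : sum_n u n = vsum u n.
Proof.
induction n as [|n IH]; [exact (sum_O u)|].
etransitivity; [exact (sum_Sn u n)|]; rewrite IH; reflexivity.
Qed.

Lemma vsum_linear (L : X -> X) (u : nat -> X) (n : nat) :
  real_linear L -> L (vsum u n) = vsum (fun i => L (u i)) n.
Proof.
intros HL; induction n as [|n IH]; [reflexivity|]; simpl.
rewrite real_linear_plus, IH by exact HL; reflexivity.
Qed.

Lemma vsum_ext (u w : nat -> X) (n : nat) : (forall i, u i = w i) -> vsum u n = vsum w n.
Proof. intros E; induction n as [|n IH]; simpl; rewrite ?IH, E; reflexivity. Qed.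

Lemma re_ip_vsum (v : X) (u : nat -> X) (n : nat) :
  re_ip v (vsum u n) = sum_n (fun i => re_ip v (u i)) n.
Proof.
induction n as [|n IH]; [symmetry; exact (sum_O (fun i => re_ip v (u i)))|].
rewrite sum_Sn, <- IH; simpl; unfold re_ip; rewrite ip_plus_l; reflexivity.
Qed.

Let weight (G : R -> X) (y : R) : X := scal (RtoC (exp ((1 - beta) * y))) (G y).

(** [G] stands in place of the resolvent. Besides [R(e^y) f] itself it will be [A R(e^y) u], whose
    quadrature error is [A] applied to that of [R(e^y) u]. *)
Definition quad_err (G : R -> X) : X :=
  scal (RtoC (sin (PI * beta) / PI))
    (minus (line (V := realified X) (weight G) : X)
           (scal (RtoC k) (vsum (fun i => weight G (node i)) (M + N)))).

Definition err_op (f : X) : X := minus (neg_pow j a beta f) (sinc_quadrature j a beta k M N f).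

Lemma err_op_quad_err (f : X) : err_op f = quad_err (fun y => Rz j a (RtoC (exp y)) f).
Proof.
unfold err_op; rewrite (neg_pow_integral j a c0 C0 HA) by exact Hbeta.
assert (E : sinc_quadrature j a beta k M N f = scal (RtoC (k * sin (PI * beta) / PI))
  (vsum (fun i => weight (fun y => Rz j a (RtoC (exp y)) f) (node i)) (M + N))).
{ unfold sinc_quadrature; apply (f_equal (fun s : X => scal (RtoC (k * sin (PI * beta) / PI)) s)).
  etransitivity; [exact (sum_n_vsum _ (M + N))|].
  apply vsum_ext; intros i; cbv zeta.
  rewrite (resolvent_Rz j a c0 C0 HA) by (left; apply exp_pos); reflexivity. }
rewrite E; unfold quad_err; apply ip_ext; intros v.
rewrite ip_minus_l, !ip_scal_l, ip_minus_l, ip_scal_l.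
unfold Rdiv; rewrite Rmult_assoc, !RtoC_mult.
unfold power_integral; change (power_integrand j a beta f) with (weight (fun y => Rz j a (RtoC (exp y)) f)).
ring.
Qed.

Lemma quad_err_linear (L : X -> X) (G : R -> X) (K1 K2 p q : R) :
  real_linear L -> decaying (V := realified X) (weight G) K1 K2 p q ->
  L (quad_err G) = quad_err (fun y => L (G y)).
Proof.
intros HL D; unfold quad_err; rewrite (real_linear_scal L _ _ HL); f_equal.
assert (Hm : forall x y : X, L (minus x y) = minus (L x) (L y)).
{ intros x y; exact (linear_minus (U := realified X) (V := realified X) L x y HL). }
rewrite Hm, (real_linear_scal L _ _ HL), (vsum_linear L _ _ HL).
assert (Ew : forall y, L (weight G y) = weight (fun y => L (G y)) y).
{ intros y; unfold weight; now rewrite real_linear_scal. }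
f_equal.
- etransitivity; [symmetry; exact (line_linear (V := realified X) (W := realified X) L _ _ _ _ _ HL D)|].
  f_equal; apply functional_extensionality; exact Ew.
- f_equal; apply vsum_ext; intros i; apply Ew.
Qed.

(** Applied to negative powers this reduces the scale of spaces [D(A^t)] to an estimate in [X]. *)
Lemma err_op_commutes (L : X -> X) (f : X) :
  real_linear L -> commutes_with_resolvent j a L -> L (err_op f) = err_op (L f).
Proof.
intros HL Hc; rewrite !err_op_quad_err.
rewrite (quad_err_linear L _ _ _ _ _ HL (power_integrand_decaying j a c0 C0 HA beta f Hbeta)).
f_equal; apply functional_extensionality; intros y; apply Hc; left; apply exp_pos.
Qed.

(** * The integrand in the strip and the error bound in [X] *)

Lemma cexp_real (x : R) : cexp x 0 = RtoC (exp x).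
Proof. unfold cexp, RtoC; rewrite cos_0, sin_0; f_equal; ring. Qed.

(** The pairing of [exp ((1 - beta) z) A R(e^z) u] with [v] at the complex point [z = x + i y]. *)
Let strip (u v : X) (x y : R) : C :=
  Cmult (exp ((1 - beta) * x) * cos ((1 - beta) * y), exp ((1 - beta) * x) * sin ((1 - beta) * y))
        (inner (ARz j a (cexp x y) u) v).

Lemma strip_holomorphic (u v : X) :
  holomorphic_pair (fun x y => Re (strip u v x y)) (fun x y => Im (strip u v x y)).
Proof.
assert (H1 := holomorphic_pair_comp_exp (fun z => inner (Rz j a z u) v)
  (fun z => Copp (inner (Rz j a z (Rz j a z u)) v))
  (fun z Hz => Rz_differentiable j a c0 C0 HA z u v (Rlt_le _ _ Hz))
  (fun z Hz => Rz_sqr_lipschitz j a c0 C0 HA z u v (Rlt_le _ _ Hz))).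
assert (H2 := holomorphic_pair_mult _ _ _ _ (holomorphic_pair_const (-1) 0)
  (holomorphic_pair_mult _ _ _ _ (holomorphic_pair_exp 1) H1)).
assert (H3 := holomorphic_pair_mult _ _ _ _ (holomorphic_pair_exp (1 - beta))
  (holomorphic_pair_plus _ _ _ _ (holomorphic_pair_const (Re (inner u v)) (Im (inner u v))) H2)).
match type of H3 with holomorphic_pair ?P ?Q =>
  replace (fun x y => Re (strip u v x y)) with P;
    [replace (fun x y => Im (strip u v x y)) with Q; [exact H3|]|] end;
  apply functional_extensionality; intros x; apply functional_extensionality; intros y;
  unfold strip, ARz; rewrite ip_minus_l, ip_scal_l, !Rmult_1_l;
  destruct (inner u v), (inner (Rz j a (cexp x y) u) v); unfold Re, Im, cexp; simpl; ring.
Qed.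

Lemma strip_bound (u v : X) (m S x y : R) : 0 <= m ->
  norm (ARz j a (cexp x y) u) <= m -> norm (ARz j a (cexp x y) u) <= m * exp (- ((1 - S) * x)) ->
  Cmod (strip u v x y) <= m * norm v * exp ((1 - beta) * x) /\
  Cmod (strip u v x y) <= m * norm v * exp (- ((beta - S) * x)).
Proof.
intros Hm H1 H2; unfold strip; rewrite Cmod_mult.
replace (Cmod (exp ((1 - beta) * x) * cos ((1 - beta) * y), exp ((1 - beta) * x) * sin ((1 - beta) * y)))
  with (exp ((1 - beta) * x)) by (symmetry; apply Cmod_cexp).
assert (Hv := hnorm_ge_0 v); assert (He := exp_pos ((1 - beta) * x)).
assert (Hc := cauchy_schwarz (ARz j a (cexp x y) u) v).
split.
- apply Rle_trans with (exp ((1 - beta) * x) * (m * norm v)); [|right; ring].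
  apply Rmult_le_compat_l; [lra|]; apply Rle_trans with (1 := Hc), Rmult_le_compat_r; assumption.
- apply Rle_trans with (exp ((1 - beta) * x) * (m * exp (- ((1 - S) * x)) * norm v)).
  + apply Rmult_le_compat_l; [lra|]; apply Rle_trans with (1 := Hc), Rmult_le_compat_r; assumption.
  + right; replace (- ((beta - S) * x)) with ((1 - beta) * x + - ((1 - S) * x)) by ring.
    rewrite exp_plus; ring.
Qed.

(** [PI] comes from the vertical sides. Of the factor 3, two parts come from the shifted contours
    and one from the integral outside the interval. *)
Definition quad_const (S : R) : R := PI + 3 * (/ (1 - beta) + / (beta - S)).

Definition quad_rate (S : R) : R :=
  / sinh (PI ^ 2 / (2 * k)) * exp (- (PI ^ 2 / (2 * k)))
  + exp (- ((beta - S) * INR N * k)) + exp (- ((1 - beta) * INR M * k)).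

Lemma quad_rate_sinh_ge_0 : 0 <= / sinh (PI ^ 2 / (2 * k)) * exp (- (PI ^ 2 / (2 * k))).
Proof.
assert (HX : 0 < PI ^ 2 / (2 * k)) by (apply Rdiv_lt_0_compat; [apply pow_lt, PI_RGT_0|lra]).
apply Rmult_le_pos; [|left; apply exp_pos]; left; apply Rinv_0_lt_compat.
unfold sinh; assert (exp (- (PI ^ 2 / (2 * k))) < exp (PI ^ 2 / (2 * k))) by (apply exp_increasing; lra).
lra.
Qed.

Section Bound.

Context (u : X) (m S : R) (HS : 0 <= S < beta) (Hm : 0 <= m).
Context (Hu : forall x y, Rabs y < PI / 2 ->
  norm (ARz j a (cexp x y) u) <= m /\ norm (ARz j a (cexp x y) u) <= m * exp (- ((1 - S) * x))).

Let G (y : R) : X := ARz j a (RtoC (exp y)) u.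

Lemma ARz_integrand_decaying : decaying (V := realified X) (weight G) m m (1 - beta) (beta - S).
Proof.
assert (H0 : Rabs 0 < PI / 2) by (rewrite Rabs_R0; generalize PI_RGT_0; lra).
assert (Hn : forall x, norm (weight G x) = exp ((1 - beta) * x) * norm (ARz j a (cexp x 0) u)).
{ intros x; unfold weight, G; rewrite cexp_real, hnorm_scal, Cmod_R, Rabs_pos_eq; [reflexivity|].
  left; apply exp_pos. }
split; try lra.
- intros x; apply (continuous_scal (V := realified X) (fun y => exp ((1 - beta) * y)) G).
  + apply (ex_derive_continuous (fun y => exp ((1 - beta) * y))); auto_derive; exact Logic.I.
  + apply (continuous_minus (V := realified X) (fun _ => u)
      (fun y => scal (RtoC (exp y)) (Rz j a (RtoC (exp y)) u) : X)).
    * apply continuous_const.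
    * apply (continuous_scal (V := realified X) exp (fun y => Rz j a (RtoC (exp y)) u)).
      -- apply (ex_derive_continuous exp); auto_derive; exact Logic.I.
      -- exact (Rr_exp_continuous j a c0 C0 HA x u).
- intros x; change (norm (weight G x) <= m * exp ((1 - beta) * x)); rewrite Hn, Rmult_comm.
  apply Rmult_le_compat_r; [left; apply exp_pos|apply Hu, H0].
- intros x; change (norm (weight G x) <= m * exp (- ((beta - S) * x))); rewrite Hn.
  apply Rle_trans with (exp ((1 - beta) * x) * (m * exp (- ((1 - S) * x)))).
  + apply Rmult_le_compat_l; [left; apply exp_pos|apply Hu, H0].
  + right; replace (- ((beta - S) * x)) with ((1 - beta) * x + - ((1 - S) * x)) by ring.
    rewrite exp_plus; ring.
Qed.

Lemma quad_err_bound : norm (quad_err G) <= quad_const S * m * quad_rate S.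
Proof.
assert (HPI := PI_RGT_0).
assert (H0 : Rabs 0 < PI / 2) by (rewrite Rabs_R0; lra).
assert (Ia : 0 < / (1 - beta)) by (apply Rinv_0_lt_compat; lra).
assert (Ib : 0 < / (beta - S)) by (apply Rinv_0_lt_compat; lra).
assert (E1 := quad_rate_sinh_ge_0).
assert (E2 := exp_pos (- ((beta - S) * INR N * k))); assert (E3 := exp_pos (- ((1 - beta) * INR M * k))).
unfold quad_const, quad_rate.
set (e1 := / sinh (PI ^ 2 / (2 * k)) * exp (- (PI ^ 2 / (2 * k)))) in *.
set (e2 := exp (- ((beta - S) * INR N * k))) in *; set (e3 := exp (- ((1 - beta) * INR M * k))) in *.
apply norm_le_re_ip; [repeat apply Rmult_le_pos; lra|]; intros v.
set (U := fun x y => Re (strip u v x y)); set (W := fun x y => Im (strip u v x y)).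
set (K := m * norm v).
assert (HK : 0 <= K) by (apply Rmult_le_pos; [exact Hm|apply hnorm_ge_0]).
assert (HU : exp_decay U K (1 - beta) (beta - S)).
{ intros x y Hy; destruct (Hu x y Hy) as [B1 B2].
  destruct (strip_bound u v m S x y Hm B1 B2) as [D1 D2].
  split; apply Rle_trans with (1 := Re_abs_le_Cmod _); assumption. }
assert (HW : exp_decay W K (1 - beta) (beta - S)).
{ intros x y Hy; destruct (Hu x y Hy) as [B1 B2].
  destruct (strip_bound u v m S x y Hm B1 B2) as [D1 D2].
  split; apply Rle_trans with (1 := Im_abs_le_Cmod _); assumption. }
assert (EU : forall x, re_ip v (weight G x) = U x 0).
{ intros x; unfold re_ip, weight, G, U, strip.
  rewrite cexp_real, ip_scal_l, Rmult_0_r, cos_0, sin_0, !Rmult_1_r, Rmult_0_r; reflexivity. }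
assert (D := decaying_linear (V := realified X) (W := R_CompleteNormedModule) (re_ip v) (weight G)
  (norm v) _ _ _ _ (re_ip_linear v) (hnorm_ge_0 v)
  (fun x => Rle_trans _ _ _ (Re_inner_le (X := X) x v) (Req_le _ _ (Rmult_comm _ _)))
  ARz_integrand_decaying).
assert (EF : (fun x => re_ip v (weight G x)) = (fun x => U x 0))
  by (apply functional_extensionality; exact EU).
rewrite EF in D.
assert (Eq : re_ip v (quad_err G) = sin (PI * beta) / PI *
   (rline (fun x => U x 0) - k * sum_n (fun i => U ((INR i - INR M) * k) 0) (M + N))).
{ unfold quad_err, re_ip; rewrite ip_scal_l, Re_scal_R, ip_minus_l, ip_scal_l; f_equal.
  change (re_ip v (line (V := realified X) (weight G)) -
    Re (Cmult (RtoC k) (inner (vsum (fun i => weight G (node i)) (M + N)) v)) =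
    rline (fun x => U x 0) - k * sum_n (fun i => U ((INR i - INR M) * k) 0) (M + N)).
  rewrite Re_scal_R; f_equal.
  - rewrite <- EF; symmetry.
    exact (line_linear (V := realified X) (W := R_CompleteNormedModule) (re_ip v) _ _ _ _ _
      (re_ip_linear v) ARz_integrand_decaying).
  - f_equal; f_equal; etransitivity; [exact (re_ip_vsum v _ (M + N))|].
    apply sum_n_ext; intros i; apply EU. }
rewrite Eq, Rabs_mult.
assert (Hs : Rabs (sin (PI * beta) / PI) <= 1).
{ unfold Rdiv; rewrite Rabs_mult, (Rabs_pos_eq (/ PI)) by (left; apply Rinv_0_lt_compat; lra).
  assert (Rabs (sin (PI * beta)) <= 1) by (apply Rabs_le, SIN_bound).
  assert (/ PI <= 1) by (rewrite <- Rinv_1; apply Rinv_le_contravar; generalize PI2_1; lra).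
  assert (0 < / PI) by (apply Rinv_0_lt_compat; lra).
  generalize (Rabs_pos (sin (PI * beta))); nra. }
set (TA := - ((INR M + / 2) * k)); set (TB := (INR N + / 2) * k).
assert (Q1 := line_truncation (V := R_CompleteNormedModule) _ _ _ _ _ TA TB D).
change (Rabs (rline (fun x => U x 0) - RInt (fun x => U x 0) TA TB) <=
  norm v * m / (1 - beta) * exp ((1 - beta) * TA) + norm v * m / (beta - S) * exp (- ((beta - S) * TB))) in Q1.
assert (Q2 := sinc_quadrature_bound U W K (1 - beta) (beta - S) k M N
  (strip_holomorphic u v) ltac:(lra) ltac:(lra) HK Hk HU HW).
fold TA TB e1 e2 e3 in Q2.
assert (T3 : exp ((1 - beta) * TA) <= e3).
{ apply exp_le; unfold TA; assert (0 < (1 - beta) * k) by (apply Rmult_lt_0_compat; lra); nra. }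
assert (T2 : exp (- ((beta - S) * TB)) <= e2).
{ apply exp_le; unfold TB; assert (0 < (beta - S) * k) by (apply Rmult_lt_0_compat; lra); nra. }
assert (Q1' : Rabs (rline (fun x => U x 0) - RInt (fun x => U x 0) TA TB)
  <= K * (/ (1 - beta) * e3 + / (beta - S) * e2)).
{ apply Rle_trans with (1 := Q1); unfold K.
  rewrite (Rmult_plus_distr_l (m * norm v)); apply Rplus_le_compat.
  - replace (norm v * m / (1 - beta) * exp ((1 - beta) * TA))
      with (m * norm v * (/ (1 - beta) * exp ((1 - beta) * TA))) by (field; lra).
    apply Rmult_le_compat_l; [exact HK|]; apply Rmult_le_compat_l; lra.
  - replace (norm v * m / (beta - S) * exp (- ((beta - S) * TB)))
      with (m * norm v * (/ (beta - S) * exp (- ((beta - S) * TB)))) by (field; lra).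
    apply Rmult_le_compat_l; [exact HK|]; apply Rmult_le_compat_l; lra. }
set (s := k * sum_n (fun i => U ((INR i - INR M) * k) 0) (M + N)) in *.
set (I0 := RInt (fun x => U x 0) TA TB) in *; set (I1 := rline (fun x => U x 0)) in *.
assert (Hd : Rabs (I1 - s) <= K * (PI + 3 * (/ (1 - beta) + / (beta - S))) * (e1 + e2 + e3)).
{ replace (I1 - s) with ((I1 - I0) + - (s - I0)) by ring.
  apply Rle_trans with (1 := Rabs_triang _ _); rewrite Rabs_Ropp.
  apply Rle_trans with (K * (/ (1 - beta) * e3 + / (beta - S) * e2)
    + K * (2 * (/ (1 - beta) + / (beta - S)) * e1 + PI * (e3 + e2))).
  - apply Rplus_le_compat; assumption.
  - rewrite <- Rmult_plus_distr_l, (Rmult_assoc K (PI + 3 * (/ (1 - beta) + / (beta - S)))).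
    apply Rmult_le_compat_l; [exact HK|].
    set (ia := / (1 - beta)) in *; set (ib := / (beta - S)) in *.
    assert (0 <= ia * e1) by (apply Rmult_le_pos; lra); assert (0 <= ia * e2) by (apply Rmult_le_pos; lra).
    assert (0 <= ia * e3) by (apply Rmult_le_pos; lra); assert (0 <= ib * e1) by (apply Rmult_le_pos; lra).
    assert (0 <= ib * e2) by (apply Rmult_le_pos; lra); assert (0 <= ib * e3) by (apply Rmult_le_pos; lra).
    assert (0 <= PI * e1) by (apply Rmult_le_pos; lra); nra. }
assert (0 <= Rabs (I1 - s)) by apply Rabs_pos.
apply Rle_trans with (Rabs (I1 - s)); [nra|].
apply Rle_trans with (1 := Hd); unfold K; right; ring.
Qed.

End Bound.

(* [h] is [A^S (A^(-beta) - Q) g]. *)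
Lemma error_in_domain (S : R) (g : X) : 0 <= S < beta ->
  exists h, inv_pow j a 1 h = err_op (inv_pow j a (1 - S) g) /\
    norm h <= quad_const S * (4 * (1 + rc) * rc) * quad_rate S * norm g.
Proof.
(* In [m] the 4 stems from the lower bound of the beta integral, [1 + rc] from a factor [A R] and
   [rc] from a resolvent. *)
intros HS; set (u := inv_pow j a (1 - S) g); set (m := 4 * (1 + rc) * rc * norm g).
assert (Hrc : 0 < rc) by exact (res_const_pos j a c0 C0 HA).
assert (Hg := hnorm_ge_0 g).
assert (Hm : 0 <= m) by (unfold m; repeat apply Rmult_le_pos; lra).
assert (H00 : 0 <= Re (RtoC 0)) by (simpl; lra).
assert (E1 : forall f, inv_pow j a 1 f = B f) by (intros f; exact (inv_pow_nat j a 1 f)).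
assert (Hu : forall x y, Rabs y < PI / 2 ->
  norm (ARz j a (cexp x y) u) <= m /\ norm (ARz j a (cexp x y) u) <= m * exp (- ((1 - S) * x))).
{ intros x y Hy; assert (Hz := Rlt_le _ _ (Re_cexp_pos x y Hy)).
  set (z := cexp x y) in *.
  assert (Hx := exp_pos x).
  assert (HRz : norm (Rz j a z g) <= rc * norm g / (1 + exp x)).
  { apply Rle_trans with (1 := Rz_bound j a c0 C0 HA z g Hz).
    unfold z; rewrite Cmod_cexp; right; unfold rc, Rdiv; ring. }
  assert (Hinv : / (1 + exp x) <= 1) by (rewrite <- Rinv_1; apply Rinv_le_contravar; lra).
  assert (Hinv0 : 0 < / (1 + exp x)) by (apply Rinv_0_lt_compat; lra).
  assert (Hinvx : / (1 + exp x) <= exp (- x)) by (rewrite exp_Ropp; apply Rinv_le_contravar; lra).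
  (* The power [A^(-1)] is not given by an integral, so [S = 0] is treated apart: there
     [A R(z) A^(-1) g] is simply [R(z) g]. *)
  destruct (Req_dec S 0) as [ES|ES].
  - subst S; unfold u; rewrite Rminus_0_r, E1; unfold B.
    rewrite (ARz_Rz_comm j a c0 C0 HA z (RtoC 0) g Hz H00).
    replace (ARz j a (RtoC 0) (Rz j a z g)) with (Rz j a z g).
    2: { unfold ARz; apply ip_ext; intros v; rewrite ip_minus_l, ip_scal_l; ring. }
    assert (Hrg : 0 <= rc * norm g) by (apply Rmult_le_pos; lra).
    assert (Hmm : rc * norm g <= m) by (unfold m; nra).
    split; apply Rle_trans with (1 := HRz); unfold Rdiv.
    + apply Rle_trans with (rc * norm g * 1); [apply Rmult_le_compat_l; lra|lra].
    + rewrite Rmult_1_l; apply Rmult_le_compat; lra.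
  - assert (HS' : 0 < 1 - S < 1) by lra.
    set (F := fun t => ARz j a z (power_integrand j a (1 - S) g t)).
    assert (HL : real_linear (ARz j a z)).
    { apply real_linear_intro with (1 + rc).
      - intros p q; unfold ARz; rewrite (Rz_plus j a c0 C0 HA) by exact Hz.
        apply ip_ext; intros v; rewrite ?ip_plus_l, !ip_minus_l, !ip_scal_l, ?ip_plus_l; ring.
      - intros r p; unfold ARz; rewrite (Rz_scal j a c0 C0 HA) by exact Hz.
        apply ip_ext; intros v; rewrite !ip_minus_l, !ip_scal_l, ip_minus_l, !ip_scal_l; ring.
      - intros p; now apply (ARz_bound j a c0 C0 HA). }
    set (c := (1 + rc) * rc * norm g).
    assert (Hc0 : 0 <= c) by (unfold c; repeat apply Rmult_le_pos; lra).
    assert (D0 := power_integrand_decaying j a c0 C0 HA (1 - S) g HS').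
    (* Up to the weight, [F t] is [A R(z) R(e^t) g]. Attaching [A] to [R(e^t)] leaves the decay of
       [R(z)], where [|z| = exp x]; attaching it to [R(z)] leaves that of [R(e^t)]. *)
    assert (Hnorm : forall t, norm (F t) <= exp (S * t) * (c / (1 + exp x)) /\
                              norm (F t) <= exp (S * t) * (c / (1 + exp t))).
    { intros t; unfold F, power_integrand; rewrite (real_linear_scal _ _ _ HL).
      rewrite hnorm_scal, Cmod_R, Rabs_pos_eq by (left; apply exp_pos).
      replace ((1 - (1 - S)) * t) with (S * t) by ring.
      assert (Ht := exp_pos t).
      split; apply Rmult_le_compat_l; try (left; apply exp_pos).
      - rewrite (ARz_Rz_comm j a c0 C0 HA z (RtoC (exp t)) g Hz (Rlt_le _ _ Ht)).
        apply Rle_trans with (1 := ARz_bound j a c0 C0 HA (RtoC (exp t)) _ (Rlt_le _ _ Ht)); fold rc.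
        apply Rle_trans with ((1 + rc) * (rc * norm g / (1 + exp x))).
        + apply Rmult_le_compat_l; lra.
        + right; unfold c, Rdiv; ring.
      - apply Rle_trans with (1 := ARz_bound j a c0 C0 HA z _ Hz); fold rc.
        apply Rle_trans with ((1 + rc) * (rc * norm g / (1 + exp t))).
        + apply Rmult_le_compat_l; [lra|]; apply (Rr_bound j a c0 C0 HA); lra.
        + right; unfold c, Rdiv; ring. }
    assert (Dc := decaying_linear (V := realified X) (W := realified X) _ _ (1 + rc) _ _ _ _ HL
      ltac:(lra) (fun p => ARz_bound j a c0 C0 HA z p Hz) D0).
    assert (D : decaying (V := realified X) F (c / (1 + exp x)) c S (1 - S)).
    { split; try lra.
      - apply Rdiv_le_0_compat; lra.
      - exact (decay_cont _ _ _ _ _ Dc).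
      - intros t; rewrite Rmult_comm; apply Hnorm.
      - intros t; apply Rle_trans with (1 := proj2 (Hnorm t)).
        replace (- ((1 - S) * t)) with (S * t + - t) by ring.
        rewrite exp_plus; unfold Rdiv.
        assert (Ht := exp_pos t); assert (Hst := exp_pos (S * t)).
        assert (/ (1 + exp t) <= exp (- t)) by (rewrite exp_Ropp; apply Rinv_le_contravar; lra).
        apply Rle_trans with (exp (S * t) * (c * exp (- t))); [|right; ring].
        apply Rmult_le_compat_l; [lra|]; apply Rmult_le_compat_l; lra. }
    set (ka := beta_integral (1 - S)).
    assert (Pka : 0 < ka) by now apply beta_integral_pos.
    assert (Eu : ARz j a z u = scal (RtoC (/ ka)) (line (V := realified X) F)).
    { unfold u; rewrite inv_pow_frac by lra; unfold frac_pow.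
      destruct (Req_EM_T (1 - S) 0) as [E|_]; [lra|].
      rewrite (real_linear_scal _ _ _ HL); f_equal.
      symmetry; exact (line_linear (V := realified X) (W := realified X) _ _ _ _ _ _ HL D0). }
    assert (Hka : / ka * (/ S + / (1 - S)) <= 4).
    { destruct (beta_integral_bounds (1 - S) HS') as [L _]; fold ka in L.
      replace (1 - (1 - S)) with S in L by ring.
      assert (Hp : 0 < (1 - S) * S) by (apply Rmult_lt_0_compat; lra).
      replace (/ S + / (1 - S)) with (/ ((1 - S) * S)) by (field; lra).
      apply Rmult_le_reg_l with ka; [exact Pka|].
      rewrite <- Rmult_assoc, Rinv_r, Rmult_1_l by lra.
      replace (/ (4 * ((1 - S) * S))) with (/ 4 * / ((1 - S) * S)) in L by (field; lra); lra. }
    assert (Hfin : forall e, 0 < e -> (norm (line (V := realified X) F : X) <= c * (/ S + / (1 - S)) * e) ->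
       norm (ARz j a z u) <= m * e).
    { intros e He Hle; rewrite Eu, hnorm_scal, Cmod_R.
      rewrite Rabs_pos_eq by (left; apply Rinv_0_lt_compat, Pka).
      apply Rle_trans with (/ ka * (c * (/ S + / (1 - S)) * e)).
      - apply Rmult_le_compat_l; [left; apply Rinv_0_lt_compat, Pka|exact Hle].
      - replace (/ ka * (c * (/ S + / (1 - S)) * e)) with (/ ka * (/ S + / (1 - S)) * (c * e)) by ring.
        replace (m * e) with (4 * (c * e)) by (unfold m, c; ring).
        apply Rmult_le_compat_r; [apply Rmult_le_pos; lra|exact Hka]. }
    assert (IS : 0 < / S) by (apply Rinv_0_lt_compat; lra).
    assert (IS' : 0 < / (1 - S)) by (apply Rinv_0_lt_compat; lra).
    assert (Hline : forall x0, norm (line (V := realified X) F : X) <=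
      c / (1 + exp x) / S * exp (S * x0) + c / (1 - S) * exp (- ((1 - S) * x0))).
    { intros x0; exact (norm_line_le (V := realified X) _ _ _ _ _ x0 D). }
    (* Splitting the integral at 0 gives the uniform bound; splitting at [t = x], where
       [exp t = |z|], gives the decay [|z|^(S - 1)]. *)
    split.
    + rewrite <- (Rmult_1_r m); apply Hfin; [lra|].
      apply Rle_trans with (1 := Hline 0); rewrite !Rmult_0_r, Ropp_0, exp_0.
      apply Rle_trans with (c * / S + c * / (1 - S)); [|right; ring].
      apply Rplus_le_compat; [|right; unfold Rdiv; ring].
      unfold Rdiv; rewrite Rmult_1_r, Rmult_assoc; apply Rmult_le_compat_l; [lra|nra].
    + apply Hfin; [apply exp_pos|].
      apply Rle_trans with (1 := Hline x).
      apply Rle_trans with (c * / S * exp (- ((1 - S) * x)) + c * / (1 - S) * exp (- ((1 - S) * x)));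
        [|right; ring].
      apply Rplus_le_compat; [|right; unfold Rdiv; ring].
      replace (- ((1 - S) * x)) with (S * x + - x) by ring; rewrite exp_plus.
      assert (Hsx := exp_pos (S * x)); unfold Rdiv.
      replace (c * / (1 + exp x) * / S * exp (S * x)) with (c * / S * (exp (S * x) * / (1 + exp x))) by ring.
      apply Rmult_le_compat_l; [apply Rmult_le_pos; lra|]; apply Rmult_le_compat_l; lra. }
(* The quadrature error with [A R] in place of [R]; applying [B] under the integral removes the
   [A]. *)
exists (quad_err (fun y => ARz j a (RtoC (exp y)) u)); split.
- rewrite E1, err_op_quad_err.
  rewrite (quad_err_linear B _ _ _ _ _ (B_real_linear j a c0 C0 HA) (ARz_integrand_decaying u m S HS Hm Hu)).
  f_equal; apply functional_extensionality; intros y; unfold B.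
  apply (Rz0_ARz j a c0 C0 HA); left; apply exp_pos.
- apply Rle_trans with (1 := quad_err_bound u m S HS Hm Hu); unfold m; right; ring.
Qed.

End QuadratureError.

(** * The error between [D(A^t)] and [D(A^(s + t))] *)

Theorem theorem3p2 (beta s c0 C0 : R) (hbeta : 0 < beta < 1) (hs : s < beta)
    (hc0 : 0 < c0) (hC0 : 0 < C0) :
  exists K : R,
    forall (X Y : HilbertSpace) (j : Y -> X) (a : Y -> Y -> C),
      is_dense_embedding j ->
      (forall y : Y, norm (j y) <= norm y) ->
      is_sesquilinear a ->
      (forall v : Y, c0 * norm v ^ 2 <= Re (a v v)) ->
      (forall u v : Y, Cmod (a u v) <= C0 * norm u * norm v) ->
      forall (M N : nat) (k t : R),
        (0 < M)%nat -> (0 < N)%nat -> 0 < k -> 0 <= t -> - t <= s ->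
        forall f : X,
          dom_pow j a t f ->
          let err := minus (neg_pow j a beta f) (sinc_quadrature j a beta k M N f) in
          dom_pow j a (s + t) err /\
          norm_dom_pow j a (s + t) err <=
            K * (/ sinh (PI ^ 2 / (2 * k)) * exp (- (PI ^ 2 / (2 * k)))
                 + exp (- ((beta - Rmax 0 s) * INR N * k))
                 + exp (- ((1 - beta) * INR M * k)))
              * norm_dom_pow j a t f.
Proof.
set (S := Rmax 0 s); set (rc := res_const c0 C0).
set (Q := quad_const beta S * (4 * (1 + rc) * rc)).
(* For [s < 0] the operator [A^s] is bounded on [X], and its norm enters the constant. *)
set (D := if Rle_dec 0 s then 1 else inv_pow_const c0 C0 (- s)).
(* 16 bounds the quotient [cs / ct] of two numbers in [[1/8, 2]]. *)
exists (16 * D * Q).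
intros X Y j a He Hj Ha Hco Hbd M N k t _ _ Hk Ht Hst f Hf err.
assert (HA : regularly_accretive j a c0 C0) by (split; assumption).
assert (HS : 0 <= S < beta).
{ split; [apply Rmax_l|apply Rmax_lub_lt; lra]. }
set (n := nat_ceil t); set (m := nat_ceil (s + t)).
set (tau := INR n - t); set (sig := INR m - (s + t)).
assert (Htau : 0 <= tau < 1) by (generalize (nat_ceil_spec t Ht); unfold tau, n; lra).
assert (Hsig : 0 <= sig < 1).
{ generalize (nat_ceil_spec (s + t) ltac:(lra)); unfold sig, m; lra. }
set (ct := power_ratio tau); set (cs := power_ratio sig).
assert (Hct := power_ratio_bounds tau Htau); fold ct in Hct.
assert (Hcs := power_ratio_bounds sig Hsig); fold cs in Hcs.
set (g := pow_op j a t f).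
(* The hypothesis that [f] lies in [D(A^t)], read as an equation between negative powers of [f] and
   of [g = A^t f]. *)
assert (Eg : scal (RtoC ct) (inv_pow j a tau f) = inv_pow j a (INR n) g).
{ rewrite (inv_pow_nat j a n g).
  transitivity (neg_part_pow j a t f); [symmetry; exact (neg_part_pow_inv_pow j a c0 C0 HA t f Ht)|].
  exact (dom_npow_iter j a c0 C0 HA n _ Hf). }
set (T := inv_pow j a) in *; set (E := err_op j a beta k M N).
set (rate := quad_rate beta k M N S).
assert (Tadd : forall r q x, 0 <= r -> 0 <= q -> T r (T q x) = T (r + q) x).
{ intros r q x; apply (inv_pow_add j a c0 C0 HA). }
assert (Tscal : forall r c x, 0 <= r -> T r (scal (RtoC c) x) = scal (RtoC c) (T r x)).
{ intros r c x Hr; apply real_linear_scal, (inv_pow_real_linear j a c0 C0 HA r Hr). }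
assert (TE : forall r x, 0 <= r -> T r (E x) = E (T r x)).
{ intros r x Hr; apply (err_op_commutes j a c0 C0 HA beta hbeta k M N).
  - now apply (inv_pow_real_linear j a c0 C0 HA).
  - now apply (inv_pow_commutes j a c0 C0 HA). }
assert (Tcomm : forall r q x, 0 <= r -> 0 <= q -> T r (T q x) = T q (T r x)).
{ intros r q x Hr Hq; rewrite !Tadd, Rplus_comm by assumption; reflexivity. }
assert (ET : scal (RtoC ct) (T tau (E f)) = T (INR n) (E g)).
{ assert (Hn := pos_INR n).
  rewrite !TE by lra; rewrite <- Eg.
  apply (err_op_commutes j a c0 C0 HA beta hbeta k M N (fun x => scal (RtoC ct) x)).
  - apply real_linear_scale.
  - apply (commuting_scal j a c0 C0 HA). }
(* Such an [h] is [A^(s + t)] of the error, so domain membership and norm bound follow together. *)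
assert (Hmain : exists h, scal (RtoC cs) (T sig (E f)) = T (INR m) h /\
          norm h <= 16 * D * Q * rate * norm g).
{ assert (Hm := pos_INR m); assert (Hn := pos_INR n).
  destruct (error_in_domain j a c0 C0 HA beta hbeta k Hk M N S g HS) as [h0 [Hh0 Bh0]].
  fold rc E T in Hh0, Bh0; fold rate Q in Bh0.
  assert (Hr : 0 <= cs / ct <= 16).
  { split; [apply Rdiv_le_0_compat; lra|].
    apply Rmult_le_reg_r with ct; [lra|].
    unfold Rdiv; rewrite Rmult_assoc, Rinv_l by lra; lra. }
  assert (Hh0n := hnorm_ge_0 h0).
  assert (Ecs : scal (RtoC cs) (T sig (E f)) = scal (RtoC (cs / ct)) (T sig (scal (RtoC ct) (E f)))).
  { rewrite Tscal by lra; apply ip_ext; intros v; rewrite !ip_scal_l, Cmult_assoc, <- RtoC_mult.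
    do 2 f_equal; field; lra. }
  destruct (Rle_dec 0 s) as [H0s|H0s]; unfold D.
  - assert (ES : S = s) by (apply Rmax_right; exact H0s).
    exists (scal (RtoC (cs / ct)) h0); split.
    (* The part [tau] brings in [g] through [ET], the part [1 - s] the equation that characterises
       [h0]. *)
    + apply (inv_pow_inj j a c0 C0 HA (tau + (1 - s))); [lra|]; fold T.
      rewrite Ecs, !Tscal by lra; f_equal.
      transitivity (T (1 - s) (T sig (scal (RtoC ct) (T tau (E f))))).
      { rewrite !Tscal by lra; f_equal; rewrite !Tadd by lra; f_equal; ring. }
      rewrite ET, (Tcomm (1 - s) sig), (Tcomm (1 - s) (INR n)), (TE (1 - s)) by lra.
      rewrite ES in Hh0; rewrite <- Hh0, !Tadd by lra; f_equal; unfold tau, sig; ring.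
    + rewrite hnorm_scal, Cmod_R, Rabs_pos_eq by lra.
      apply Rle_trans with (16 * (Q * rate * norm g)); [|right; ring].
      apply Rmult_le_compat; lra.
  - assert (ES : S = 0) by (apply Rmax_left; lra).
    (* For [s < 0] the estimate with [S = 0] bounds the error of [g] in [X]; the power of order
       [- s] is applied afterwards. *)
    assert (Eh0 : h0 = E g).
    { apply (inv_pow_inj j a c0 C0 HA 1); [lra|]; fold T.
      rewrite Hh0, ES, Rminus_0_r, TE by lra; reflexivity. }
    exists (scal (RtoC (cs / ct)) (T (- s) h0)); split.
    + apply (inv_pow_inj j a c0 C0 HA tau); [lra|]; fold T.
      rewrite Ecs, !Tscal by lra; f_equal.
      transitivity (T sig (scal (RtoC ct) (T tau (E f)))).
      { rewrite !Tscal, (Tcomm tau sig) by lra; reflexivity. }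
      rewrite ET, Eh0, !Tadd by lra; f_equal; unfold tau, sig; ring.
    + rewrite hnorm_scal, Cmod_R, Rabs_pos_eq by lra.
      assert (Hb := inv_pow_bound j a c0 C0 HA (- s) h0 ltac:(lra)); fold T in Hb.
      set (ip := inv_pow_const c0 C0 (- s)) in *.
      assert (Hip : 0 <= ip).
      { assert (Hrc := res_const_pos j a c0 C0 HA); unfold ip, inv_pow_const.
        apply Rmult_le_pos; [apply pow_le; lra|lra]. }
      apply Rle_trans with (16 * (ip * (Q * rate * norm g))); [|right; ring].
      apply Rmult_le_compat; try apply hnorm_ge_0; try lra.
      apply Rle_trans with (1 := Hb), Rmult_le_compat_l; lra. }
destruct Hmain as [h [Hh Bh]].
assert (En : neg_part_pow j a (s + t) err = Nat.iter m (fun x => Rz j a (RtoC 0) x) h).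
{ rewrite (neg_part_pow_inv_pow j a c0 C0 HA (s + t) err ltac:(lra)).
  etransitivity; [exact Hh|exact (inv_pow_nat j a m h)]. }
destruct (npow_iter j a c0 C0 HA m h) as [Hd Hp].
unfold dom_pow, norm_dom_pow, pow_op; rewrite En; fold m; split; [exact Hd|].
rewrite Hp; exact Bh.
Qed.
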